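(* Let $\xi_0,\xi_1,\xi_2,\ldots$ be i.i.d. complex-valued random variables having a Lebesgue density $p\colon\mathbb{C}\to[0,\infty)$ which is continuous on some open set $\mathscr{D}\subset\mathbb{C}$ and vanishes on $\mathbb{C}\setminus\mathscr{D}$. Let $f(z)=\mathbb{E}\left[\frac{1}{z-\xi_1}\right]$ be the Cauchy--Stieltjes transform, and assume that $f$ is non-zero Lebesgue-a.e. on $\mathscr{D}$. Let $Q_n(z)=\prod_{k=0}^n(z-\xi_k)$. Let $r_1,r_2,\ldots>0$ be a sequence satisfying $\lim_{n\to\infty} n r_n=+\infty$ and $\lim_{n\to\infty}\sqrt{n}\,r_n=0$. Then: (a) The probability that $Q_n$ has exactly one critical point in the disk $\bar{\mathbb{B}}_{r_n}(\xi_0)$ converges to $1$: $$\lim_{n\to\infty}\mathbb{P}\left[\text{there is a unique }\zeta\in\bar{\mathbb{B}}_{r_n}(\xi_0)\text{ such that }Q_n'(\zeta)=0\right]=1.$$ (b) Denoting by $\zeta_n$ the unique critical point of $Q_n$ in $\bar{\mathbb{B}}_{r_n}(\xi_0)$, if it exists uniquely, and defining $\zeta_n$ arbitrarily otherwise, we have $$\frac{f^2(\xi_0)}{\sqrt{\pi p(\xi_0)}}\sqrt{\frac{n}{\log n}}\left(n(\zeta_n-\xi_0)+\frac{1}{f(\xi_0)}\right)\ \longrightarrow\ \mathcal{N}_{\mathbb{C}}(0,1)$$ in distribution as $n\to\infty$.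
   Context: $\bar{\mathbb{B}}_r(u)=\{z\in\mathbb{C}\colon |z-u|\le r\}$ is the closed disk. The critical points of a polynomial $Q$ are the complex zeroes of $Q'$. The Cauchy--Stieltjes transform $f(z)=\mathbb{E}\left[\frac{1}{z-\xi_1}\right]$ is defined for those $z\in\mathbb{C}$ for which $\mathbb{E}\left|\frac{1}{z-\xi_1}\right|<\infty$; under the stated hypotheses it exists finitely everywhere on $\mathscr{D}$. $f^2(z)$ means $(f(z))^2$. $\mathcal{N}_{\mathbb{C}}(0,\sigma^2)$, $\sigma^2\ge 0$, denotes the complex normal distribution of a random variable $X$ such that $\mathrm{Re}\,X$ and $\mathrm{Im}\,X$ are independent real centered Gaussian variables, each with variance $\sigma^2/2$ (for $\sigma^2=0$, $X=0$ a.s.). *)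

(* Defs.v *)
From HB Require Import structures.
From mathcomp Require Import all_boot all_order all_algebra finmap.
From mathcomp Require Import complex.
From mathcomp Require Import all_classical all_reals all_analysis.
From mathcomp Require Import measurable_realfun lra.

Set Implicit Arguments.
Unset Strict Implicit.
Unset Printing Implicit Defensive.

Import Order.TTheory GRing.Theory Num.Theory numFieldNormedType.Exports.

Local Open Scope classical_set_scope.
Local Open Scope ring_scope.
Local Open Scope complex_scope.

(* The library puts the topology of the modulus on the alias [R[i]^o] only; it
   is copied to [R[i]] itself, together with the Borel sigma-algebra. *)
HB.instance Definition _ (R : realType) := GRing.ComAlgebra.copy R[i] R[i]^o.
HB.instance Definition _ (R : realType) := Vector.copy R[i] R[i]^o.
HB.instance Definition _ (R : realType) := NormedModule.copy R[i] R[i]^o.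
HB.instance Definition _ (R : realType) :=
  Measurable.copy R[i] (g_sigma_algebraType (@open R[i])).

Section planar_measures.
Context {R : realType}.

Definition complex_of_pair (xy : measurableTypeR R * measurableTypeR R) : R[i] :=
  (xy.1 : R) +i* (xy.2 : R).

Lemma measurable_complex_of_pair : measurable_fun setT complex_of_pair.
Proof.
apply: (measurability (@open R[i])) => // _ [A oA <-]; rewrite setTI.
pose box (q : nat * rat * rat) : set (measurableTypeR R * measurableTypeR R) :=
  ball (ratr q.1.2 : R) q.1.1.+1%:R^-1 `*` ball (ratr q.2 : R) q.1.1.+1%:R^-1.
rewrite (_ : _ @^-1` A = \bigcup_(q in [set q | box q `<=`
    complex_of_pair @^-1` A]) box q); last first.
  apply/seteqP; split => [[x y] /= Axy|xy [q /= + xyq]]; last exact.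
  have /nbhs_ballP[e /= e0 eA] : nbhs (complex_of_pair (x, y)) A.
    by apply: open_nbhs_nbhs.
  case: e e0 eA => e e' /[!ltcE]/= /andP[/eqP -> e0] eA.
  have [n [k [kE k0 ke]]] : exists n (k : R), [/\ k = n.+1%:R^-1, 0 < k & k < e / 4].
    have e4 : 0 < e / 4 by rewrite divr_gt0.
    have [n] := ltr_add_invr e4; rewrite add0r => ne.
    by exists n, n.+1%:R^-1; rewrite invr_gt0.
  have ratb (u : R) : exists a : rat, `|ratr a - u| < k.
    have /rat_in_itvoo[a] : u - k < u + k by lra.
    by rewrite in_itv/= => aI; exists a; rewrite distrC ltr_distlC.
  have [[a ax] [b bx]] := (ratb x, ratb y).
  exists (n, a, b); last by rewrite /box/= -kE.
  move=> [x' y']; rewrite /box/= -kE => -[/= ax' by']; apply: eA.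
  rewrite /ball/= /complex_of_pair/= normc_def/= ltcR.
  have half u u' c : `|ratr c - u| < k -> ball (ratr c : R) k u' ->
      `|u - u'| < e / 2.
    rewrite /ball/= => cu cu'; rewrite -(subrKA (ratr c)).
    apply: (le_lt_trans (ler_normD _ _)).
    by rewrite distrC; move: ke cu cu'; rewrite /=; lra.
  have hx := half _ _ _ ax ax'; have hy := half _ _ _ bx by'.
  rewrite -[ltRHS]gtr0_norm// -sqrtr_sqr ltr_sqrt ?exprn_gt0//.
  rewrite -(real_normK (num_real (x - x'))) -(real_normK (num_real (y - y'))).
  have := normr_ge0 (x - x'); have := normr_ge0 (y - y').
  nra.
rewrite bigcup_mkcond; apply: countable_bigcupT_measurable => // q.
case: ifP => // _; apply: measurableX; exact: measurable_ball.
Qed.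

Section pushforward_to_complex.
Variable m : {measure set (measurableTypeR R * measurableTypeR R) -> \bar R}.

Definition pushforward_complex : set R[i] -> \bar R :=
  pushforward m complex_of_pair.

Let pushforward_complex0 : pushforward_complex set0 = 0%E.
Proof. by apply: measure0; exact: measurable_complex_of_pair. Qed.

Let pushforward_complex_ge0 A : (0 <= pushforward_complex A)%E.
Proof. by apply: measure_ge0; exact: measurable_complex_of_pair. Qed.

Let pushforward_complex_sigma_additive : semi_sigma_additive pushforward_complex.
Proof.
by apply: measure_semi_sigma_additive; exact: measurable_complex_of_pair.
Qed.

HB.instance Definition _ := isMeasure.Build _ _ _ pushforward_complex
  pushforward_complex0 pushforward_complex_ge0
  pushforward_complex_sigma_additive.

End pushforward_to_complex.

Definition complex_lebesgue : set R[i] -> \bar R :=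
  pushforward_complex (@lebesgue_measure R \x @lebesgue_measure R)%E.

HB.instance Definition _ := Measure.on complex_lebesgue.

(* The complex normal distribution with variance 1. The second argument of
   [normal_prob] is the standard deviation: each coordinate has variance 1/2. *)
Definition complex_std_normal : set R[i] -> \bar R :=
  pushforward_complex (@normal_prob R 0 (Num.sqrt 2^-1) \x
                       @normal_prob R 0 (Num.sqrt 2^-1))%E.

HB.instance Definition _ := Measure.on complex_std_normal.

Let complex_std_normal_setT : complex_std_normal setT = 1%E.
Proof.
rewrite /complex_std_normal /pushforward_complex /pushforward preimage_setT.
rewrite -setXTT; apply: etrans (product_measure1E _ _ measurableT measurableT) _.
by rewrite [X in (X * _)%E]probability_setT [X in (_ * X)%E]probability_setT mule1.
Qed.

HB.instance Definition _ := Measure_isProbability.Build _ _ _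
  complex_std_normal complex_std_normal_setT.

End planar_measures.

Section complex_random_variables.
Context {d : measure_display} {T : measurableType d} {R : realType}.
Variable P : probability T R.

Definition mutually_independent (X : nat -> {RV P >-> R[i]}) : Prop :=
  forall (J : {fset nat}) (B : nat -> set R[i]),
    (forall j, measurable (B j)) ->
    P (\bigcap_(j in [set` J]) (X j @^-1` B j)) =
    (\prod_(j <- J) P (X j @^-1` B j))%E.

Definition has_density (X : {RV P >-> R[i]}) (p : R[i] -> R) : Prop :=
  forall B : set R[i], measurable B ->
    distribution P X B = (\int[complex_lebesgue]_(z in B) (p z)%:E)%E.

(* Meaningful only when the real and imaginary parts of [Y] are integrable. *)
Definition complex_expectation (Y : T -> R[i]) : R[i] :=
  fine ('E_P[fun w => complex.Re (Y w)])%E +i*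
  fine ('E_P[fun w => complex.Im (Y w)])%E.

Definition cauchy_stieltjes (X : T -> R[i]) (z : R[i]) : R[i] :=
  complex_expectation (fun w => (z - X w)^-1).

Definition cvg_in_distribution (X : nat -> T -> R[i])
    (mu : probability R[i] R) : Prop :=
  forall g : R[i] -> R, continuous g -> (exists M, forall z, `|g z| <= M) ->
    ('E_P[g \o X n])%E @[n --> \oo] --> (\int[mu]_z (g z)%:E)%E.

End complex_random_variables.

Section critical_points.
Context {R : realType}.

Definition random_poly {T : Type} (xi : nat -> T -> R[i]) (n : nat) (w : T) :
    {poly R[i]} :=
  \prod_(k < n.+1) ('X - (xi k w)%:P).

Definition critical_point_in_disk (Q : {poly R[i]}) (u : R[i]) (r : R) :
    set R[i] :=
  [set z | `|z - u| <= r%:C /\ root Q^`() z].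

End critical_points.

(* Main.v *)
Require Import Defs.
From HB Require Import structures.
From mathcomp Require Import all_boot all_order all_algebra finmap.
From mathcomp Require Import complex.
From mathcomp Require Import all_classical all_reals all_analysis.
From mathcomp Require Import measurable_realfun ring lra.

(* Condition on xi_0 = u. The critical points of Q_n other than the xi_k are the
   solutions of z - u = - 1 / h(z), where h(z) = sum_{k=1}^n 1 / (z - xi_k), so a
   critical point near u is a fixed point of z |-> u - 1 / h(z). Since
   h(u) ~ n f(u) with f(u) != 0, the sum of the |u - xi_k|^-2 is of order
   n log n, and no xi_k lies within 2 r_n of u, this map contracts the disk of
   radius r_n for n large and n (zeta - u) + 1 / f(u) is, up to negligible
   terms, (h(u) - n f(u)) / (n f(u)^2).

   The variable Y = 1 / (u - xi_1) has P(|Y| > t) of order t^-2, so it lies in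
   the non-normal domain of attraction of the Gaussian law: the truncated second
   moment of s Re Y + t Im Y grows like pi p(u) (s^2 + t^2) log, by the
   continuity of p at u. A Taylor expansion of the truncated characteristic
   function then gives the central limit theorem for
   (h(u) - n f(u)) / sqrt (n log n), and Levy's continuity theorem is proved by
   Gaussian smoothing. The theorem follows by dominated convergence in u. *)

Set Implicit Arguments.
Unset Strict Implicit.
Unset Printing Implicit Defensive.

Import Order.TTheory GRing.Theory Num.Theory numFieldNormedType.Exports.

Local Open Scope classical_set_scope.
Local Open Scope ring_scope.
Local Open Scope complex_scope.

(** Since [Y] has no second moment, the Taylor expansion is truncated where |u - xi_1| is about 1 /
    a_n, with a_n = sqrt (n log n). The event left out has probability O(a_n^-2), and every other
    error is O(a_n^-2) as well: after n summands this is O(1 / log n). The truncated variance grows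
    like log a_n, which is asymptotic to (log n) / 2; this half is why dividing by sqrt (pi p(u))
    leaves coordinates of variance 1/2. How large n must be depends on u, with no uniformity. The
    estimates are therefore made at a fixed u, the requirements on n and on the sample are kept as
    events, and only their probabilities are integrated against the law of xi_0. This needs Fubini's
    theorem for xi_0 and the remaining variables, hence joint measurability in u and in the sample
    point. Characteristic functions appear as integrals of a cosine with an arbitrary phase, which
    carry the same information as complex exponentials. Compactly supported test functions are
    uniformly continuous, so closeness in probability of the rescaled critical point and of the
    normalized sum is enough to transfer the limit law. *)

Local Notation Re := complex.Re.
Local Notation Im := complex.Im.
Local Notation normc := Normc.normc.

(** * Complex numbers through their coordinates *)

Section complex_coordinates.
Context {R : realType}.
Implicit Types z u : R[i].

Lemma normcE z : `|z| = (normc z)%:C.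
Proof. by rewrite normc_def; case: z. Qed.

Lemma normc_ge0 z : 0 <= normc z.
Proof. by case: z => a b; exact: sqrtr_ge0. Qed.

Lemma normc_triangle u z : normc (u + z) <= normc u + normc z.
Proof. by rewrite -lecR rmorphD/= -!normcE ler_normD. Qed.

Lemma normc_opp z : normc (- z) = normc z.
Proof. by apply: (@complexI R); rewrite -!normcE normrN. Qed.

Lemma normc_sub_ge u z : normc u - normc z <= normc (u - z).
Proof.
by rewrite lerBlDr; apply: le_trans (normc_triangle _ _); rewrite subrK.
Qed.

Lemma normc_eq0 z : (normc z == 0) = (z == 0).
Proof. by apply/eqP/eqP => [/Normc.eq0_normc//|->]; rewrite Normc.normc0. Qed.

Lemma normc_gt0 z : (0 < normc z) = (z != 0).
Proof. by rewrite lt_def normc_ge0 andbT normc_eq0. Qed.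

Lemma normc_sum (I : Type) (s : seq I) (F : I -> R[i]) :
  normc (\sum_(i <- s) F i) <= \sum_(i <- s) normc (F i).
Proof.
elim: s => [|i s ih]; first by rewrite !big_nil Normc.normc0.
by rewrite !big_cons; apply: le_trans (normc_triangle _ _) _; rewrite lerD2l.
Qed.

Lemma normc_Re z : `|Re z| <= normc z.
Proof.
by case: z => a b /=; rewrite -sqrtr_sqr ler_sqrt ?lerDl ?sqr_ge0// addr_ge0 ?sqr_ge0.
Qed.

Lemma normc_Im z : `|Im z| <= normc z.
Proof.
by case: z => a b /=; rewrite -sqrtr_sqr ler_sqrt ?lerDr ?sqr_ge0// addr_ge0 ?sqr_ge0.
Qed.

Lemma normc_le_ReIm z : normc z <= `|Re z| + `|Im z|.
Proof.
case: z => a b /=; rewrite -[leRHS]ger0_norm ?addr_ge0// -sqrtr_sqr.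
rewrite ler_sqrt ?sqr_ge0// -(real_normK (num_real a)) -(real_normK (num_real b)).
by have := normr_ge0 a; have := normr_ge0 b; nra.
Qed.

Lemma normc_sqr z : normc z ^+ 2 = Re z ^+ 2 + Im z ^+ 2.
Proof. by case: z => a b /=; rewrite sqr_sqrtr// addr_ge0 ?sqr_ge0. Qed.

Lemma ReB u z : Re (u - z) = Re u - Re z. Proof. by case: u z => ? ? []. Qed.
Lemma ImB u z : Im (u - z) = Im u - Im z. Proof. by case: u z => ? ? []. Qed.
Lemma ReD u z : Re (u + z) = Re u + Re z. Proof. by case: u z => ? ? []. Qed.
Lemma ImD u z : Im (u + z) = Im u + Im z. Proof. by case: u z => ? ? []. Qed.
Lemma ReV z : Re z^-1 = Re z / (Re z ^+ 2 + Im z ^+ 2).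
Proof. by case: z. Qed.
Lemma ImV z : Im z^-1 = - Im z / (Re z ^+ 2 + Im z ^+ 2).
Proof. by case: z => a b /=; rewrite mulNr. Qed.
Lemma ReM u z : Re (u * z) = Re u * Re z - Im u * Im z.
Proof. by case: u z => ? ? []. Qed.
Lemma ImM u z : Im (u * z) = Re u * Im z + Im u * Re z.
Proof. by case: u z => ? ? []. Qed.

(** Squares and disks define the same neighbourhoods; this turns continuity on [R[i]] into a pair of
    real inequalities. *)
Lemma nbhs_complexP z (A : set R[i]) : nbhs z A <->
  exists2 e : R, 0 < e & forall z', `|Re z' - Re z| < e -> `|Im z' - Im z| < e -> A z'.
Proof.
split=> [/nbhs_ballP[e /= e0 eA]|[e e0 eA]].
  case: e e0 eA => e e' /[!ltcE]/= /andP[/eqP -> e0] eA.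
  exists (e / 2); first by rewrite divr_gt0.
  move=> z' h1 h2; apply: eA; rewrite /ball/= normcE ltcR -normc_opp opprB.
  apply: le_lt_trans (normc_le_ReIm _) _; rewrite ReB ImB; lra.
apply/nbhs_ballP; exists e%:C => /=; first by rewrite ltcR.
move=> z'; rewrite /ball/= normcE ltcR -normc_opp opprB => h; apply: eA.
  by rewrite -ReB (le_lt_trans (normc_Re _)).
by rewrite -ImB (le_lt_trans (normc_Im _)).
Qed.

Lemma cvg_complexP (g : R[i] -> R) z : g z' @[z' --> z] --> g z <->
  forall e : R, 0 < e -> exists2 d : R, 0 < d &
    forall z', `|Re z' - Re z| < d -> `|Im z' - Im z| < d -> `|g z' - g z| < e.
Proof.
have FF : Filter (nbhs z) by exact: nbhs_filter.
split=> [/(@cvgrPdist_lt _ R^o _ (nbhs z) FF) h e e0|h].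
  have /nbhs_complexP[d d0 hd] := h _ e0.
  by exists d => // z' h1 h2; rewrite distrC; exact: hd.
apply/(@cvgrPdist_lt _ R^o _ (nbhs z) FF) => e e0; have [d d0 hd] := h _ e0.
by apply/nbhs_complexP; exists d => // z' h1 h2; rewrite distrC; exact: hd.
Qed.

Lemma continuous_Re : continuous (@complex.Re R).
Proof. by move=> z; apply/cvg_complexP => e e0; exists e. Qed.

Lemma continuous_Im : continuous (@complex.Im R).
Proof. by move=> z; apply/cvg_complexP => e e0; exists e. Qed.

Lemma continuousC_measurable (g : R[i] -> R) : continuous g ->
  measurable_fun [set: R[i]] g.
Proof.
move=> cg; apply: (measurability _ (RGenOpens.measurableE R)).
move=> _ [_ [a [b ->] <-]]; rewrite setTI; apply: sub_sigma_algebra.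
by move/continuousP : cg; apply; exact: interval_open.
Qed.

Lemma measurable_Re : measurable_fun [set: R[i]] (@complex.Re R).
Proof. exact: continuousC_measurable continuous_Re. Qed.

Lemma measurable_Im : measurable_fun [set: R[i]] (@complex.Im R).
Proof. exact: continuousC_measurable continuous_Im. Qed.

Lemma measurable_funC d (S : measurableType d) (F : S -> R[i]) :
  measurable_fun setT (fun s => Re (F s)) ->
  measurable_fun setT (fun s => Im (F s)) -> measurable_fun setT F.
Proof.
move=> mr mi; rewrite (_ : F = complex_of_pair \o (fun s => (Re (F s), Im (F s)))).
  apply: measurableT_comp; first exact: measurable_complex_of_pair.
  exact: measurable_fun_pair.
by apply/funext => s /=; rewrite /complex_of_pair/=; case: (F s).
Qed.

Lemma measurable_funCP d (S : measurableType d) (F : S -> R[i]) :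
  measurable_fun setT F ->
  measurable_fun setT (fun s => Re (F s)) /\ measurable_fun setT (fun s => Im (F s)).
Proof.
move=> mF; split; apply: measurableT_comp mF; [exact: measurable_Re|exact: measurable_Im].
Qed.

Section arithmetic.
Context d (S : measurableType d).
Implicit Types F G : S -> R[i].

Lemma measurable_funCD F G : measurable_fun setT F -> measurable_fun setT G ->
  measurable_fun setT (fun s => F s + G s).
Proof.
move=> /measurable_funCP[? ?] /measurable_funCP[? ?]; apply: measurable_funC.
  by under eq_fun do rewrite ReD; exact: measurable_funD.
by under eq_fun do rewrite ImD; exact: measurable_funD.
Qed.

Lemma measurable_funCB F G : measurable_fun setT F -> measurable_fun setT G ->
  measurable_fun setT (fun s => F s - G s).
Proof.
move=> /measurable_funCP[? ?] /measurable_funCP[? ?]; apply: measurable_funC.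
  by under eq_fun do rewrite ReB; exact: measurable_funB.
by under eq_fun do rewrite ImB; exact: measurable_funB.
Qed.

Lemma measurable_funCM F G : measurable_fun setT F -> measurable_fun setT G ->
  measurable_fun setT (fun s => F s * G s).
Proof.
move=> /measurable_funCP[? ?] /measurable_funCP[? ?]; apply: measurable_funC.
  by under eq_fun do rewrite ReM; apply: measurable_funB; exact: measurable_funM.
by under eq_fun do rewrite ImM; apply: measurable_funD; exact: measurable_funM.
Qed.

Lemma measurable_invr : measurable_fun [set: R] (@GRing.inv R).
Proof.
rewrite -(setvU [set 0]); apply/measurable_funU => //; first exact: measurableC.
split; last exact: measurable_fun_set1.
apply: open_continuous_measurable_fun; first by rewrite openC; exact: closed_eq.
by move=> x; rewrite inE/= => /eqP x0; exact: inv_continuous.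
Qed.

Lemma measurable_funinv (f : S -> R) : measurable_fun setT f ->
  measurable_fun setT (fun s => (f s)^-1).
Proof. by move=> mf; apply: measurableT_comp mf; exact: measurable_invr. Qed.

Lemma measurable_funCV F : measurable_fun setT F ->
  measurable_fun setT (fun s => (F s)^-1).
Proof.
move=> /measurable_funCP[? ?].
have ? : measurable_fun setT (fun s => (Re (F s) ^+ 2 + Im (F s) ^+ 2)^-1).
  by apply: measurable_funinv; apply: measurable_funD; exact: measurable_funX.
apply: measurable_funC.
  by under eq_fun do rewrite ReV; exact: measurable_funM.
under eq_fun do rewrite ImV; apply: measurable_funM => //.
exact: measurableT_comp.
Qed.

Lemma measurable_fun_realC (f : S -> R) : measurable_fun setT f ->
  measurable_fun setT (fun s => (f s)%:C).
Proof. by move=> mf; apply: measurable_funC. Qed.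

Lemma measurable_funC_sum (I : Type) (s : seq I) (F : I -> S -> R[i]) :
  (forall i, measurable_fun setT (F i)) ->
  measurable_fun setT (fun x => \sum_(i <- s) F i x).
Proof.
move=> mF; elim: s => [|i s ih].
  by under eq_fun do rewrite big_nil; exact: measurable_cst.
by under eq_fun do rewrite big_cons; exact: measurable_funCD.
Qed.

Lemma measurable_normc F : measurable_fun setT F ->
  measurable_fun setT (fun s => normc (F s)).
Proof.
move=> /measurable_funCP[? ?].
rewrite (_ : (fun _ => _) = Num.sqrt \o (fun s => Re (F s) ^+ 2 + Im (F s) ^+ 2)).
  apply: (measurableT_comp (continuous_measurable_fun (@sqrt_continuous R))).
  by apply: measurable_funD; exact: measurable_funX.
by apply/funext => s /=; case: (F s).
Qed.

End arithmetic.

(** Bolzano-Weierstrass in the form of a cluster point, which spares the extraction of a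
    subsequence. It serves for the fixed point, for zeros in a disk and for uniform continuity. *)
Lemma box_cluster (A : R) (z : nat -> R[i]) :
  (forall n, `|Re (z n)| <= A) -> (forall n, `|Im (z n)| <= A) ->
  exists z0, [/\ `|Re z0| <= A, `|Im z0| <= A &
   forall (e : R) N, 0 < e -> exists n, [/\ (N <= n)%N, `|Re (z n) - Re z0| < e & `|Im (z n) - Im z0| < e]].
Proof.
move=> hr hi.
pose K : set (R * R) := `[- A, A] `*` `[- A, A].
have cK : compact K by apply: compact_setX; exact: segment_compact.
pose w n : R * R := (Re (z n), Im (z n)).
have KF : (w n @[n --> \oo]) K.
  by exists 0%N => // n _; split; rewrite /= in_itv/= -ler_norml.
have [[x y] [[/= Kx Ky] cl]] := cK _ _ KF.
exists (x +i* y); split; [by move: Kx; rewrite /= in_itv/= -ler_norml|by move: Ky; rewrite /= in_itv/= -ler_norml|].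
move=> e N e0.
have h1 : (w n @[n --> \oo]) (w @` [set n | (N <= n)%N]).
  by exists N => // n /= Nn; exists n.
have h2 : nbhs (x, y) (ball x e `*` ball y e).
  by exists (ball x e, ball y e) => //=; split; exact: nbhsx_ballx.
have [_ [[n Nn <-] [/= h3 h4]]] := cl _ _ h1 h2.
exists n; split => //; first by rewrite distrC.
by rewrite distrC.
Qed.

End complex_coordinates.

(** * The critical point as a fixed point *)

Lemma normc_distC {R : realType} (a b : R[i]) : normc (a - b) = normc (b - a).
Proof. by rewrite -normc_opp opprB. Qed.

Lemma normc_split {R : realType} (a b c : R[i]) : normc (a - c) <= normc (a - b) + normc (b - c).
Proof. by have := normc_triangle (a - b) (b - c); rewrite addrA subrK. Qed.

Section contraction.
Context {R : realType}.
Variables (x : nat -> R[i]) (n : nat) (u : R[i]) (r m : R).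

Definition inverse_sum (z : R[i]) : R[i] := \sum_(1 <= k < n.+1) (z - x k)^-1.
Let W : R := \sum_(1 <= k < n.+1) normc (u - x k)^-1 ^+ 2.

Hypotheses (r0 : 0 < r) (m0 : 0 < m).
Hypothesis far : forall k, (1 <= k < n.+1)%N -> 2 * r < normc (u - x k).
Hypothesis mS : m + 2 * r * W <= normc (inverse_sum u).
Hypotheses (mr : m^-1 <= r) (mW : 8 * W <= m ^+ 2).

Let disk z := normc (z - u) <= r.

Let disk_far z k : disk z -> (1 <= k < n.+1)%N -> normc (u - x k) / 2 <= normc (z - x k).
Proof.
move=> dz /far fk; have := normc_triangle (u - z) (z - x k).
rewrite (_ : u - z + (z - x k) = u - x k); last by ring.
have -> : normc (u - z) = normc (z - u) by rewrite -normc_opp opprB.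
by move: dz; rewrite /disk; lra.
Qed.

Let far0 k : (1 <= k < n.+1)%N -> 0 < normc (u - x k).
Proof. by move=> /far; move: r0; lra. Qed.

Let disk_neq z k : disk z -> (1 <= k < n.+1)%N -> z - x k != 0.
Proof.
by move=> dz hk; rewrite -normc_gt0; have := disk_far dz hk; have := far0 hk; lra.
Qed.

Let normc_inv (z : R[i]) : normc z^-1 = (normc z)^-1.
Proof.
have [->|z0] := eqVneq z 0; first by rewrite invr0 Normc.normc0 invr0.
by apply: (mulIf (_ : normc z != 0)); [rewrite normc_eq0|rewrite -Normc.normcM !mulVf// ?normc_eq0//; exact: Normc.normc1].
Qed.

(** Resolvent identity: 1/(z - x) - 1/(z' - x) = (z' - z) / ((z - x)(z' - x)). The factors [c] and
    [c'] stay separate because a point of the disk costs a factor 2 and the centre [u] only 1. *)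
Lemma inverse_sum_lipschitz (c c' : R) z z' :
  (forall k, (1 <= k < n.+1)%N -> [/\ z - x k != 0, z' - x k != 0,
     (normc (z - x k))^-1 <= c * (normc (u - x k))^-1 &
     (normc (z' - x k))^-1 <= c' * (normc (u - x k))^-1]) ->
  normc (inverse_sum z - inverse_sum z') <= c * c' * W * normc (z - z').
Proof.
move=> H; rewrite /inverse_sum -sumrB /W mulrAC mulr_sumr.
apply: le_trans (normc_sum _ _) _; rewrite !big_nat; apply: ler_sum => k hk.
have [z0 z'0 h1 h2] := H k hk.
have -> : (z - x k)^-1 - (z' - x k)^-1 = (z' - z) * ((z - x k)^-1 * (z' - x k)^-1).
  by field; rewrite z0 z'0.
rewrite !Normc.normcM !normc_inv -[normc (z' - z)]normc_opp opprB mulrC [leRHS]mulrAC.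
apply: ler_wpM2r; first exact: normc_ge0.
have i0 (v : R[i]) : 0 <= (normc v)^-1 by rewrite invr_ge0 normc_ge0.
apply: le_trans (ler_pM (i0 _) (i0 _) h1 h2) _.
by rewrite expr2 mulrACA.
Qed.

Let disk_inv z k : disk z -> (1 <= k < n.+1)%N ->
  (normc (z - x k))^-1 <= 2 * (normc (u - x k))^-1.
Proof.
move=> dz hk; have f0 := far0 hk; have h := disk_far dz hk.
rewrite -[leRHS]invrK invfM invrK lef_pV2 ?posrE//; last by rewrite mulr_gt0.
  by rewrite mulrC.
by apply: lt_le_trans h; rewrite divr_gt0.
Qed.

Let W0 : 0 <= W.
Proof. by apply: sumr_ge0 => k _; exact: sqr_ge0. Qed.

Let disk_u : disk u.
Proof. by rewrite /disk subrr Normc.normc0 ltW. Qed.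

Lemma inverse_sum_center z : disk z ->
  normc (inverse_sum z - inverse_sum u) <= 2 * W * normc (z - u).
Proof.
move=> dz; rewrite -[2]mulr1; apply: inverse_sum_lipschitz => k hk; split.
- exact: disk_neq.
- exact: disk_neq.
- exact: disk_inv.
- by rewrite mul1r.
Qed.

(** Moving from [u] to [z] changes the sum by at most [2 * W * r], which is the margin reserved in
    [mS]. *)
Lemma inverse_sum_ge z : disk z -> m <= normc (inverse_sum z).
Proof.
move=> dz; have h := inverse_sum_center dz.
have := normc_sub_ge (inverse_sum u) (inverse_sum u - inverse_sum z).
rewrite subKr -[normc (_ - inverse_sum z)]normc_opp opprB.
have : 2 * W * normc (z - u) <= 2 * W * r by apply: ler_wpM2l => //; rewrite mulr_ge0.
by move: mS; lra.
Qed.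

(* [z] is a critical point iff [1 + (z - u) * inverse_sum z = 0], that is,
   iff [z] is a fixed point of [Phi]. *)
Let Phi z := u - (inverse_sum z)^-1.

Let Phi_disk z : disk z -> disk (Phi z).
Proof.
move=> /inverse_sum_ge h; rewrite /disk /Phi addrAC subrr add0r normc_opp normc_inv.
by apply: le_trans mr; rewrite lef_pV2 ?posrE// (lt_le_trans m0).
Qed.

Let Phi_contract z z' : disk z -> disk z' -> normc (Phi z - Phi z') <= 2^-1 * normc (z - z').
Proof.
move=> dz dz'; have h := inverse_sum_ge dz; have h' := inverse_sum_ge dz'.
have L : normc (inverse_sum z - inverse_sum z') <= 2 * 2 * W * normc (z - z').
  by apply: inverse_sum_lipschitz => k hk; split; [exact: disk_neq|exact: disk_neq|exact: disk_inv|exact: disk_inv].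
have n0 v : m <= normc v -> v != 0 by move=> hv; rewrite -normc_gt0 (lt_le_trans m0).
have -> : Phi z - Phi z' = (inverse_sum z - inverse_sum z') * ((inverse_sum z)^-1 * (inverse_sum z')^-1).
  by rewrite /Phi; field; rewrite !n0.
rewrite !Normc.normcM !normc_inv.
have i0 v : m <= normc v -> 0 <= (normc v)^-1 <= m^-1.
  by move=> hv; rewrite invr_ge0 normc_ge0 lef_pV2 ?posrE// (lt_le_trans m0).
have /andP[a0 a1] := i0 _ h; have /andP[b0 b1] := i0 _ h'.
apply: le_trans (ler_pM (normc_ge0 _) (mulr_ge0 a0 b0) L (ler_pM a0 b0 a1 b1)) _.
rewrite mulrAC; apply: ler_wpM2r; first exact: normc_ge0.
(* The Lipschitz constant obtained is 4 W / m^2, at most 1/2 by [mW]. *)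
rewrite -invfM ler_pdivrMr ?mulr_gt0//; move: mW; rewrite expr2; lra.
Qed.

Let iterate := fix iterate j := if j is j'.+1 then Phi (iterate j') else u.

Let iterate_disk j : disk (iterate j).
Proof. by elim: j => [|j ih]; [exact: disk_u|exact: Phi_disk]. Qed.

Let iterate_step j : normc (iterate j.+1 - iterate j) <= r / 2 ^+ j.
Proof.
elim: j => [|j ih]; first by rewrite expr0 divr1; exact: (@Phi_disk _ disk_u).
apply: le_trans (Phi_contract (iterate_disk j.+1) (iterate_disk j)) _.
by rewrite exprS invfM mulrCA ler_pM2l.
Qed.

(** Compactness replaces completeness: the iterates have a cluster point in the disk, consecutive
    iterates get arbitrarily close, and since [Phi] is contracting the cluster point is at distance
    0 from its image. *)
Lemma fixed_point : exists2 z, disk z & z - u = - (inverse_sum z)^-1.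
Proof.
have bd j : normc (iterate j) <= normc u + r.
  have := normc_triangle (iterate j - u) u; rewrite subrK => h; apply: le_trans h _.
  by rewrite addrC lerD2l; exact: iterate_disk.
have [z [_ _ hz]] := box_cluster (fun j => le_trans (normc_Re _) (bd j)) (fun j => le_trans (normc_Im _) (bd j)).
have close (e : R) N : 0 < e -> exists2 j, (N <= j)%N & normc (iterate j - z) <= e.
  move=> e0; have e2 : 0 < e / 2 by rewrite divr_gt0.
  have [j [Nj h1 h2]] := hz _ N e2; exists j => //.
  by apply: le_trans (normc_le_ReIm _) _; rewrite ReB ImB; lra.
have dz : disk z.
  rewrite /disk; apply/ler_addgt0Pr => e e0; have [j _ hj] := close e 0%N e0.
  have := normc_triangle (z - iterate j) (iterate j - u).
  rewrite (_ : z - iterate j + (iterate j - u) = z - u); last by ring.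
  have := iterate_disk j; rewrite /disk -[normc (z - iterate j)]normc_opp opprB; lra.
exists z => //; apply/eqP; rewrite -subr_eq0 -normc_eq0 eq_le normc_ge0 andbT.
have -> : z - u - - (inverse_sum z)^-1 = z - Phi z by rewrite /Phi; ring.
apply/ler_addgt0Pr => e e0; rewrite add0r.
have e4 : 0 < e / 4 by rewrite divr_gt0.
have [N _ hN] : \forall N \near \oo, r / 2 ^+ N <= e / 4.
  near=> N; have : 4 * r / e <= N%:R by near: N; exact: nbhs_infty_ger.
  rewrite ler_pdivrMr// => hN; rewrite ler_pdivrMr ?exprn_gt0//.
  have : (N%:R : R) <= 2 ^+ N by rewrite -natrX ler_nat ltnW// ltn_expl.
  by move=> h; have := ler_wpM2r (ltW e0) h; lra.
have [j Nj hj] := close _ N e4.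
have s1 := Phi_contract (iterate_disk j) dz.
have s2 : normc (Phi (iterate j) - iterate j) <= r / 2 ^+ j := iterate_step j.
have s3 : r / 2 ^+ j <= e / 4 := hN j Nj.
have t1 := normc_split z (iterate j) (Phi z).
have t2 := normc_split (iterate j) (Phi (iterate j)) (Phi z).
rewrite normc_distC in hj; rewrite normc_distC in s2.
rewrite [normc (iterate j - z)]normc_distC in s1.
move: hj s1 (le_trans s2 s3) t1 t2.
move: (normc _) (normc _) (normc _) (normc _) (normc _) => a b c f g; lra.
Unshelve. all: by end_near.
Qed.

Lemma fixed_point_unique z z' : disk z -> disk z' ->
  z - u = - (inverse_sum z)^-1 -> z' - u = - (inverse_sum z')^-1 -> z = z'.
Proof.
move=> dz dz' e e'; have h := Phi_contract dz dz'.
have Pz : Phi z = z by rewrite /Phi -e subrKC.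
have Pz' : Phi z' = z' by rewrite /Phi -e' subrKC.
move: h; rewrite Pz Pz' => h.
apply/eqP; rewrite -subr_eq0 -normc_eq0 eq_le normc_ge0 andbT.
move: h; move: (normc _) => q; lra.
Qed.

End contraction.

Section critical_point.
Context {R : realType} {T : Type}.
Variables (xi : nat -> T -> R[i]) (n : nat) (w : T).
Let x k := xi k w.

Lemma deriv_prod_XsubC (s : seq nat) (z : R[i]) : {in s, forall k, z - x k != 0} ->
  (\prod_(k <- s) ('X - (x k)%:P))^`().[z] =
  (\prod_(k <- s) ('X - (x k)%:P)).[z] * \sum_(k <- s) (z - x k)^-1.
Proof.
elim: s => [|k s ih] hs; first by rewrite !big_nil derivC hornerC mulr0.
rewrite !big_cons derivM derivXsubC mul1r hornerD !hornerM hornerXsubC ih; last first.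
  by move=> j js; apply: hs; rewrite inE js orbT.
have k0 : z - x k != 0 by apply: hs; rewrite mem_head.
by rewrite mulrDr mulrAC divff// mul1r !mulrA.
Qed.

(** With B the product of the factors of index at least 1, the logarithmic derivative gives Q' = B
    (1 + (z - x_0) h), and B does not vanish at [z]. *)
Lemma root_deriv_random_poly z : (forall k, (1 <= k < n.+1)%N -> z - x k != 0) ->
  root (random_poly xi n w)^`() z = (1 + (z - x 0%N) * inverse_sum x n z == 0).
Proof.
move=> hz; rewrite /random_poly -(big_mkord xpredT (fun k => 'X - (x k)%:P)) big_ltn//.
have hs : {in index_iota 1 n.+1, forall k, z - x k != 0}.
  by move=> k; rewrite mem_index_iota; exact: hz.
rewrite rootE derivM derivXsubC mul1r hornerD !hornerM hornerXsubC deriv_prod_XsubC//.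
set B := _.[z]; rewrite mulrCA -[X in X + _]mulr1 -mulrDr mulf_eq0 (_ : (B == 0) = false)//.
apply/negbTE; rewrite /B horner_prod prodf_seq_neq0; apply/allP => k /hs.
by rewrite hornerXsubC.
Qed.

End critical_point.

(** * Integration with respect to probability measures *)

Section bounded_integrals.
Context d (S : measurableType d) {R : realType}.

Lemma bounded_integrable (mu : {finite_measure set S -> \bar R}) (f : S -> R) (M : R) :
  measurable_fun setT f -> (forall x, `|f x| <= M) -> mu.-integrable setT (EFin \o f).
Proof.
move=> mf fM; apply: measurable_bounded_integrable => //.
  by rewrite -ge0_fin_numE// fin_num_measure.
exists M; split; first exact: num_real.
by move=> x Mx y _ /=; rewrite (le_trans (fM y)) ?ltW.
Qed.

Lemma EFin_Rintegral (mu : {measure set S -> \bar R}) (f : S -> R) :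
  mu.-integrable setT (EFin \o f) ->
  ((\int[mu]_x f x)%R)%:E = (\int[mu]_x (f x)%:E)%E.
Proof. by move=> fi; rewrite /Rintegral fineK//; exact: integrable_fin_num. Qed.

Section probability_measure.
Variable mu : probability S R.

Lemma Rintegral_cst_prob (c : R) : (\int[mu]_x c)%R = c.
Proof. by rewrite Rintegral_cst//= [mu setT]probability_setT/= mulr1. Qed.

Lemma Rintegral_bound (f : S -> R) (M : R) : measurable_fun setT f ->
  (forall x, `|f x| <= M) -> `|(\int[mu]_x f x)%R| <= M.
Proof.
move=> mf fM; have fi := bounded_integrable mu mf fM.
apply: le_trans (le_normr_Rintegral _ fi) _ => //.
rewrite -[leRHS]Rintegral_cst_prob; apply: le_Rintegral => //.
- by apply: (@bounded_integrable _ _ M) => [|x]; [exact: measurableT_comp|rewrite normr_id].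
- exact: (@bounded_integrable _ _ `|M|).
Qed.

Lemma bounded_cvg_Rintegral (f_ : nat -> S -> R) (f : S -> R) (M : R) :
  (forall n, measurable_fun setT (f_ n)) -> measurable_fun setT f ->
  (forall n x, `|f_ n x| <= M) ->
  {ae mu, forall x, f_ n x @[n --> \oo] --> f x} ->
  (\int[mu]_x f_ n x)%R @[n --> \oo] --> (\int[mu]_x f x)%R.
Proof.
move=> mf_ mf fM ff.
have [|||||fi _ cv] := @dominated_convergence _ _ _ mu _ measurableT
   (fun n => EFin \o f_ n) (EFin \o f) (cst M%:E).
- by move=> n; exact/measurable_EFinP.
- exact/measurable_EFinP.
- apply: filterS ff => x h _; apply: cvg_EFin => //; exact: nearW.
- exact: finite_measure_integrable_cst.
- by apply: aeW => x n _; rewrite /= lee_fin.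
apply: (@fine_cvg _ _ _ _ (fun n => (\int[mu]_x (f_ n x)%:E)%E)).
by rewrite -[X in _ --> X]EFin_Rintegral// in cv.
Qed.

End probability_measure.
End bounded_integrals.

Section density.
Context d (S : measurableType d) {R : realType}.
Variables (m nu : {measure set S -> \bar R}) (f : S -> R).
Hypothesis mf : measurable_fun setT f.
Hypothesis f0 : forall x, 0 <= f x.
Hypothesis nuE : forall A, measurable A -> nu A = (\int[m]_(x in A) (f x)%:E)%E.

Import HBNNSimple.
Local Open Scope ereal_scope.

(** By monotone convergence along simple functions the claim reduces to indicators of level sets,
    where it is [nuE]. *)
Lemma ge0_integral_density (h : S -> \bar R) :
  measurable_fun setT h -> (forall x, 0 <= h x) ->
  \int[nu]_x h x = \int[m]_x (h x * (f x)%:E).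
Proof.
move=> mh h0.
pose g := nnsfun_approx measurableT mh.
have mEf : measurable_fun setT (EFin \o f) by exact/measurable_EFinP.
have -> : \int[nu]_x h x = lim (\int[nu]_x (EFin \o g n) x @[n --> \oo]).
  have gE x : h x = lim ((EFin \o g n) x @[n --> \oo]).
    by apply/esym/cvg_lim => //; exact: cvg_nnsfun_approx.
  under eq_integral => x _ do rewrite gE.
  apply: monotone_convergence => //.
  - by move=> n; exact/measurable_EFinP.
  - by move=> n x _ //=; rewrite lee_fin.
  - by move=> x _ a b ab; rewrite lee_fin; exact/lefP/nd_nnsfun_approx.
have -> : \int[m]_x (h x * (f x)%:E) =
    lim (\int[m]_x ((EFin \o g n) x * (f x)%:E) @[n --> \oo]).
  have gE x : h x * (f x)%:E = lim ((EFin \o g n) x * (f x)%:E @[n --> \oo]).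
    by apply/esym/cvg_lim => //; apply: cvgeZr => //; exact: cvg_nnsfun_approx.
  under eq_integral => x _ do rewrite gE.
  apply: monotone_convergence => //.
  - by move=> n; apply: emeasurable_funM => //; exact/measurable_EFinP.
  - by move=> n x _ //=; rewrite mule_ge0 ?lee_fin.
  - by move=> x _ a b ab; rewrite lee_wpmul2r ?lee_fin//; exact/lefP/nd_nnsfun_approx.
suff suf n : \int[m]_x ((EFin \o g n) x * (f x)%:E) = \int[nu]_x (EFin \o g n) x.
  by under [in RHS]eq_fun do rewrite suf.
transitivity (\int[nu]_x
   (\sum_(y \in range (g n)) (y * \1_(g n @^-1` [set y]) x)%:E)); last first.
  by apply: eq_integral => t tE; rewrite /= fimfunE -fsumEFin.
have indich k r : measurable_fun setT (fun x => (r * \1_(g k @^-1` [set r]) x)%:E).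
  by apply: (measurable_comp measurableT) => //; exact: measurable_funM.
rewrite ge0_integral_fsum//; last by move=> y x _; exact: nnfun_muleindic_ge0.
transitivity (\int[m]_x (\sum_(y \in range (g n))
    (y * \1_(g n @^-1` [set y]) x)%:E * (f x)%:E)).
  under [RHS]eq_integral => x xE.
    rewrite -ge0_mule_fsuml => [|y]; last exact: nnfun_muleindic_ge0.
    rewrite fsumEFin // -(fimfunE _ x); over.
  by [].
rewrite ge0_integral_fsum//; last 2 first.
  - by move=> y; exact: emeasurable_funM.
  - by move=> y x _; rewrite mule_ge0 ?nnfun_muleindic_ge0 ?lee_fin//.
apply: eq_fsbigr => r rhn.
under [RHS]eq_integral do rewrite EFinM.
rewrite integralZl_indic_nnsfun => //.
under eq_integral do rewrite EFinM -muleA.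
rewrite ge0_integralZl//.
- under eq_integral do rewrite muleC.
  rewrite (eq_integral ((EFin \o f) \_ (g n @^-1` [set r]))); last first.
    by move=> x xE; rewrite epatch_indic.
  by rewrite -integral_mkcondr integral_indic// setIT -nuE// setTI.
- by apply: emeasurable_funM => //; exact/measurable_EFinP.
- by move=> t Et; rewrite mule_ge0 ?lee_fin ?f0.
- by move: rhn; rewrite inE => -[t _ <-]; rewrite lee_fin.
Qed.

Lemma integral_density (h : S -> R) : measurable_fun setT h ->
  \int[nu]_x (h x)%:E = \int[m]_x (h x * f x)%:E.
Proof.
move=> mh; rewrite integralE [RHS]integralE.
have mEh : measurable_fun setT (EFin \o h) by exact/measurable_EFinP.
rewrite !ge0_integral_density//; last 2 first.
- exact: measurable_funeneg.
- exact: measurable_funepos.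
congr (_ - _); apply: eq_integral => x _.
  by rewrite !funeposE/= -!EFin_max -EFinM maxr_pMl// mul0r.
by rewrite !funenegE/= -!EFin_max -EFinM maxr_pMl// mul0r mulNr.
Qed.

Lemma Rintegral_density (h : S -> R) : measurable_fun setT h ->
  (\int[nu]_x h x = \int[m]_x (h x * f x))%R.
Proof. by move=> mh; rewrite /Rintegral integral_density. Qed.

End density.

Section normal_density.
Context {R : realType}.

Lemma integral_normal_prob (m s : R) (h : R -> R) :
  measurable_fun setT h ->
  (\int[normal_prob m s]_x h x)%R = (\int[lebesgue_measure]_x (h x * normal_pdf m s x))%R.
Proof.
move=> mh; apply: (@Rintegral_density _ _ R lebesgue_measure (normal_prob m s)
  (normal_pdf m s) (measurable_normal_pdf m s) (normal_pdf_ge0 m s) _ h mh).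
by [].
Qed.

End normal_density.

Section cvg_tools.
Context {R : realType}.

(** Three-epsilon argument. The approximating sequence and its limit may depend on the tolerance,
    and closeness is asked only for large [n]. *)
Lemma cvg_uniform_limit (u : nat -> R) (l : R) :
  (forall e : R, 0 < e -> exists u' : nat -> R, exists l' : R,
     [/\ \forall n \near \oo, `|u n - u' n| <= e, `|l - l'| <= e & u' n @[n --> \oo] --> l']) ->
  u n @[n --> \oo] --> l.
Proof.
move=> h; apply/cvgrPdist_le => e e0.
have e3 : 0 < e / 3 by lra.
have [u' [l' [uu ll /cvgrPdist_le/(_ _ e3) cv]]] := h _ e3.
near=> n.
have h1 : `|l' - u' n| <= e / 3 by near: n.
have h2 : `|u n - u' n| <= e / 3 by near: n.
rewrite (_ : l - u n = (l - l') + (l' - u' n) - (u n - u' n)); last by ring.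
apply: le_trans (ler_normB _ _) _; apply: le_trans (lerD (ler_normD _ _) (lexx _)) _.
lra.
Unshelve. all: by end_near.
Qed.

End cvg_tools.

(** * Independence *)

Section independence.
Context {d : measure_display} {T : measurableType d} {R : realType}.
Variables (P : probability T R) (xi : nat -> {RV P >-> R[i]}).
Hypothesis xi_indep : mutually_independent xi.

Definition cylinders (i : nat) : set (set T) :=
  [set A | exists (J : {fset nat}) (B : nat -> set R[i]),
    [/\ i \notin J, forall j, measurable (B j) &
        A = \bigcap_(j in [set` J]) (xi j @^-1` B j)]].

(* [T] with a smaller sigma-algebra plays the part of the second factor of a
   product space: by independence, [w |-> (xi i w, w)] into
   [R[i] * others i] has a product law, which gives Fubini's theorem. *)
Definition others (i : nat) := g_sigma_algebraType (cylinders i).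

Lemma measurable_preimage_xi j (B : set R[i]) : measurable B ->
  measurable (xi j @^-1` B).
Proof. by move=> mB; rewrite -[X in measurable X]setTI; exact: measurable_funP. Qed.

Lemma cylinders_measurable i : cylinders i `<=` measurable.
Proof.
move=> _ [J [B [_ mB ->]]]; apply: fin_bigcap_measurable => // j _.
exact: measurable_preimage_xi.
Qed.

Lemma others_measurable i (A : set T) : <<s cylinders i >> A -> measurable A.
Proof.
apply: smallest_sub; [exact: sigma_algebra_measurable|exact: cylinders_measurable].
Qed.

Lemma cylindersI i : setI_closed (cylinders i).
Proof.
move=> _ _ [J [B [iJ mB ->]]] [K [C [iK mC ->]]].
exists (J `|` K)%fset, (fun j => (if j \in J then B j else setT) `&`
  (if j \in K then C j else setT)); split.
- by rewrite in_fsetU negb_or iJ iK.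
- by move=> j; apply: measurableI; case: ifP.
- apply/seteqP; split => [w [h1 h2] j /=|w h].
    rewrite in_fsetU => jJK; split.
      by case: ifPn => // jJ; exact: (h1 j jJ).
    by case: ifPn => // jK; exact: (h2 j jK).
  split=> j /= jJ; have /= := h j; rewrite in_fsetU jJ ?orbT => -[]//.
Qed.

Lemma cylindersT i : cylinders i setT.
Proof.
by exists fset0, (fun=> setT); split => //; rewrite set_fset0 bigcap_set0.
Qed.

(** For fixed [B] both sides are finite measures in [A]; they agree on the cylinders, which are
    stable under intersection and generate the sigma-algebra, hence everywhere on it. *)
Lemma indep_others i (A : set T) (B : set R[i]) : measurable B ->
  <<s cylinders i >> A -> P (xi i @^-1` B `&` A) = (P (xi i @^-1` B) * P A)%E.
Proof.
move=> mB sA; have mX : measurable (xi i @^-1` B) by exact: measurable_preimage_xi.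
have PXfin : P (xi i @^-1` B) \is a fin_num by exact: fin_num_measure.
have PX0 : 0 <= fine (P (xi i @^-1` B)) by rewrite fine_ge0.
rewrite setIC -[LHS]/(mrestr P mX A) -[X in (X * _)%E]fineK//.
rewrite -[RHS]/(mscale (NngNum PX0) P A).
apply: (@g_sigma_algebra_measure_unique _ _ _ (cylinders i)
  (@cylinders_measurable i) (fun=> setT)) => //.
- by move=> _; exact: cylindersT.
- by rewrite bigcup_const//; exists 0%N.
- exact: cylindersI.
- move=> _ [J [C [iJ mC ->]]]; rewrite /mrestr -[RHS]/((fine (P (xi i @^-1` B)))%:E * P _)%E fineK//.
  pose C' j := if j == i then B else C j.
  have := xi_indep (i |` J)%fset (B := C').
  have -> : \bigcap_(j in [set` (i |` J)%fset]) xi j @^-1` C' j =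
      (\bigcap_(j in [set` J]) (xi j @^-1` C j)) `&` (xi i @^-1` B).
    apply/seteqP; split => [w h|w [h1 h2] j /=].
      split=> [j /= jJ|].
        have := h j; rewrite /= in_fset1U jJ orbT => /(_ isT).
        by rewrite /C'; case: eqP jJ iJ => // -> ->.
      by have := h i; rewrite /= in_fset1U eqxx => /(_ isT); rewrite /C' eqxx.
    by rewrite in_fset1U /C' => /predU1P[->|jJ]; [rewrite eqxx|case: eqP => [->//|_]; exact: h1].
  rewrite -[X in _ -> X = _]/(P ((\bigcap_(j in [set` J]) (xi j @^-1` C j)) `&` xi i @^-1` B)).
  move=> ->; last by move=> j; rewrite /C'; case: ifP.
  rewrite big_fsetU1//= {1}/C' eqxx; congr (_ * _)%E.
  rewrite xi_indep//; apply: eq_big_seq => j jJ.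
  by rewrite /C'; case: eqP jJ iJ => // -> ->.
- move=> _; rewrite -[X in (X < _)%E]/(P (setT `&` xi i @^-1` B)) setTI.
  by rewrite (le_lt_trans (probability_le1 _ _))// ltry.
Qed.

Lemma measurable_others i d' (S : measurableType d') (f : others i -> S) :
  measurable_fun setT f -> measurable_fun [set: T] (f : T -> S).
Proof.
move=> mf _ B mB; apply: (@others_measurable i).
exact: mf.
Qed.

Lemma measurable_xi_others i j : i != j -> measurable_fun [set: others i] (xi j : T -> R[i]).
Proof.
move=> ij _ B mB; rewrite setTI; apply: sub_sigma_algebra.
exists [fset j]%fset, (fun=> B); split => //; first by rewrite inE.
by rewrite set_fset1 bigcap_set1.
Qed.

Lemma measurable_to_others i : measurable_fun [set: T] (id : T -> others i).
Proof. by move=> _ B mB; rewrite setTI preimage_id; exact: (@others_measurable i). Qed.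

(** The joint law of [xi i] and of the identity into [others i] is a product measure because it is
    one on rectangles; Tonelli's theorem then gives the iterated integral. *)
Lemma integral_indep i (Psi : R[i] * others i -> \bar R) :
  measurable_fun setT Psi -> (forall x, 0 <= Psi x)%E ->
  (\int[P]_w Psi (xi i w, w) =
   \int[distribution P (xi i)]_x \int[P]_w Psi (x, w))%E.
Proof.
move=> mPsi Psi0.
pose idm : {mfun T >-> others i} := mfun_Sub (mem_set (@measurable_to_others i)).
have mpair : measurable_fun [set: T] (fun w : T => (xi i w, w : others i)).
  by apply: measurable_fun_pair => //; exact: measurable_to_others.
pose pm : {mfun T >-> (R[i] * others i)%type} := mfun_Sub (mem_set mpair).
transitivity (\int[distribution P pm]_z Psi z)%E.
  by rewrite ge0_integral_distribution.
transitivity (\int[(distribution P (xi i) \x distribution P idm)%E]_z Psi z)%E.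
  apply: eq_measure_integral => A mA _; apply/esym.
  apply: product_measure_unique => // B C mB mC.
  exact: indep_others.
rewrite fubini_tonelli1//; apply: eq_integral => x _.
rewrite /fubini_F ge0_integral_distribution//.
exact: measurableT_comp.
Qed.

End independence.

(** * Gaussian characteristic function *)

Section derivative_integral.
Context {R : realType}.
Notation mu := (@lebesgue_measure R).

(** Fundamental theorem of calculus on the intervals [-(n+1), n+1], followed by dominated
    convergence with majorant |k|. *)
Lemma Rintegral_derivative0 (K k : R -> R) :
  (forall x : R, is_derive x (1 : R) K (k x)) -> continuous k ->
  mu.-integrable setT (EFin \o k) ->
  K n.+1%:R @[n --> \oo] --> (0 : R) -> K (- n.+1%:R) @[n --> \oo] --> (0 : R) ->
  (\int[mu]_x k x)%R = 0.
Proof.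
move=> dK ck ik K1 K2.
have cK : continuous K.
  move=> x; apply: differentiable_continuous; apply/derivable1_diffP.
  by have [] := dK x.
pose I n := (`[- n.+1%:R, n.+1%:R]%classic : set R).
have mk : measurable_fun setT (EFin \o k) by exact: (measurable_int mu).
have [||||_ _ cv] := @dominated_convergence _ _ _ mu _ measurableT
  (fun n => (EFin \o k) \_ (I n)) (EFin \o k) (abse \o (EFin \o k)) _ mk.
- move=> n; apply/(measurable_restrictT _ _).1 => //; first exact: measurable_itv.
  exact: measurable_funTS.
- apply: aeW => x _; apply: cvg_near_cst.
  near=> n; rewrite patchE ifT//; rewrite inE /I/= in_itv/= -ler_norml.
  near: n; exists (Num.truncn `|x|) => // n /= hn.
  apply: le_trans (ltW (truncnS_gt _)) _; by rewrite ler_nat.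
- exact: integrable_abse.
- apply: aeW => x n _; rewrite patchE; case: ifP => // _.
  by rewrite (_ : point = 0%E) ?abse0//=.
have h n : (\int[mu]_x ((EFin \o k) \_ (I n)) x = (K n.+1%:R - K (- n.+1%:R))%:E)%E.
  rewrite -integral_mkcond/= (@continuous_FTC2 _ k K) -?EFinB//.
  - by rewrite gtrN// ltr0n.
  - exact: continuous_subspaceT.
  - split => [x _||].
    + by have [] := dK x.
    + exact/cvg_at_right_filter/cK.
    + exact/cvg_at_left_filter/cK.
  - by move=> x _; rewrite derive1E; apply: derive_val.
have cv' : (\int[mu]_x ((EFin \o k) \_ (I n)) x)%E @[n --> \oo] --> (0 : \bar R)%E.
  under eq_fun do rewrite h.
  apply: cvg_EFin; first exact: nearW.
  rewrite -[X in _ --> X](subr0 (0 : R)); exact: cvgB.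
have := cvg_unique _ cv cv'; rewrite /Rintegral => -> //.
Unshelve. all: by end_near.
Qed.

End derivative_integral.

Section gaussian_characteristic_function.
Context {R : realType}.
Variable s : R.
Hypothesis s0 : 0 < s.
Notation mu := (@lebesgue_measure R).
Let g := normal_pdf 0 s.
(** Integrable majorant of |x| g(x): half of the Gaussian exponent absorbs the factor |x|, and the
    other half is a Gaussian of deviation sqrt 2 s. *)
Let G (x : R) := Num.sqrt 2 * (2 * s) * normal_pdf 0 (Num.sqrt 2 * s) x.

Let gE x : g x = normal_peak s * expR (- x ^+ 2 / (s ^+ 2 *+ 2)).
Proof. by rewrite /g normal_pdfE ?gt_eqF// /normal_fun subr0. Qed.

Let s2 : Num.sqrt 2 * s != 0.
Proof. by rewrite mulf_neq0 ?gt_eqF// sqrtr_gt0. Qed.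

Let peakE : normal_peak s = Num.sqrt 2 * normal_peak (Num.sqrt 2 * s).
Proof.
have pi0 := @pi_gt0 R.
rewrite /normal_peak exprMn sqr_sqrtr//.
rewrite (_ : 2 * s ^+ 2 * pi *+ 2 = 2 * (s ^+ 2 * pi *+ 2)); last by ring.
rewrite sqrtrM// invfM.
by rewrite mulrA divff ?mul1r// gt_eqF// sqrtr_gt0.
Qed.

Let G_ge0 x : 0 <= G x.
Proof. by rewrite /G !mulr_ge0 ?normal_pdf_ge0// ?sqrtr_ge0// ltW. Qed.

Let G_ub x : `|x| * g x <= G x.
Proof.
rewrite gE /G normal_pdfE// /normal_fun subr0 peakE.
have pk0 := normal_peak_ge0 (Num.sqrt 2 * s).
have q0 : 0 <= Num.sqrt (2 : R) by rewrite sqrtr_ge0.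
rewrite exprMn sqr_sqrtr//.
set E := expR (- x ^+ 2 / (2 * s ^+ 2 *+ 2)).
have -> : expR (- x ^+ 2 / (s ^+ 2 *+ 2)) = E * E.
  rewrite -expRD; congr expR.
  by field; rewrite gt_eqF.
have E0 : 0 < E by rewrite expR_gt0.
(* From 1 + v <= exp v with v = x^2 / (4 s^2); the remaining quadratic inequality is a completed
   square. *)
have h : `|x| * E <= 2 * s.
  rewrite -ler_pdivlMr// /E -expRN.
  apply: (@le_trans _ _ (2 * s * (1 + x ^+ 2 / (2 * s ^+ 2 *+ 2)))); last first.
    rewrite ler_wpM2l//; first by rewrite mulr_ge0// ltW.
    apply: le_trans (expR_ge1Dx _) _; rewrite mulNr opprK//.
  rewrite -(real_normK (num_real x)).
  rewrite (_ : 2 * s * _ = 2 * s + `|x| ^+ 2 / (2 * s)); last first.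
    by field; rewrite gt_eqF.
  rewrite -subr_ge0 (_ : _ - _ = (`|x| - s) ^+ 2 / (2 * s) + 3 / 2 * s); last first.
    by field; rewrite gt_eqF.
  have s0' : 0 <= s by rewrite ltW.
  by apply: addr_ge0; [apply: divr_ge0; [exact: sqr_ge0|exact: mulr_ge0]|apply: mulr_ge0].
have k0 : 0 <= Num.sqrt 2 * normal_peak (Num.sqrt 2 * s) * E.
  by rewrite !mulr_ge0// ltW.
by move: (ler_wpM2l k0 h); congr (_ <= _); ring.
Qed.

Let mg : measurable_fun setT g. Proof. exact: measurable_normal_pdf. Qed.

Let ig : mu.-integrable setT (EFin \o g). Proof. exact: integrable_normal_pdf. Qed.

Let iG : mu.-integrable setT (EFin \o G).
Proof.
rewrite (_ : _ \o _ = fun x => ((Num.sqrt 2 * (2 * s))%:E * (normal_pdf 0 (Num.sqrt 2 * s) x)%:E)%E).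
  by apply: integrableZl => //; exact: integrable_normal_pdf.
by apply/funext => x; rewrite /= EFinM.
Qed.

Let le_int (f h : R -> R) : measurable_fun setT f -> (forall x, `|f x| <= h x) ->
  mu.-integrable setT (EFin \o h) -> mu.-integrable setT (EFin \o f).
Proof.
move=> mf fh; apply: le_integrable => //; first exact/measurable_EFinP.
by move=> x _ /=; rewrite lee_fin (le_trans (fh x))// ler_norm.
Qed.

Let mcos t : measurable_fun setT (fun y : R => cos (t * y)).
Proof.
apply: continuous_measurable_fun => y; apply: continuous_comp; last exact: continuous_cos.
by apply: continuousM; [exact: cst_continuous|].
Qed.

Let msin t : measurable_fun setT (fun y : R => sin (t * y)).
Proof.
apply: continuous_measurable_fun => y; apply: continuous_comp; last exact: continuous_sin.
by apply: continuousM; [exact: cst_continuous|].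
Qed.

Let C (t : R) := (\int[mu]_y (cos (t * y) * g y))%R.

Let gdrv (y : R) : is_derive y (1 : R) g (- (y / s ^+ 2) * g y).
Proof.
rewrite (_ : g = fun y => normal_peak s * expR (- y ^+ 2 / (s ^+ 2 *+ 2))); last first.
  by apply/funext => z; rewrite gE.
apply: is_derive_eq; rewrite /GRing.scale/=.
by field; rewrite gt_eqF.
Qed.

Let dcos (y t : R) : is_derive t (1 : R) (fun t => cos (t * y) * g y) (- (y * sin (t * y) * g y)).
Proof. by apply: is_derive_eq; rewrite /GRing.scale/=; ring. Qed.

Let gcos0 : forall t, mu.-integrable setT (EFin \o (fun y => cos (t * y) * g y)).
Proof.
move=> t; apply: le_int ig; first exact: measurable_funM.
move=> y; rewrite normrM (ger0_norm (normal_pdf_ge0 _ _ _)) ler_piMl ?normal_pdf_ge0//.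
by rewrite ler_norml cos_geN1 cos_le1.
Qed.

Let gsin_le t y : `|y * sin (t * y) * g y| <= G y.
Proof.
apply: le_trans (G_ub y).
rewrite normrM (ger0_norm (normal_pdf_ge0 _ _ _)) ler_wpM2r ?normal_pdf_ge0//.
by rewrite normrM ler_piMr// ler_norml sin_geN1 sin_le1.
Qed.

Let mysin t : measurable_fun setT (fun y : R => y * sin (t * y) * g y).
Proof. by apply: measurable_funM => //; apply: measurable_funM. Qed.

Let iysin t : mu.-integrable setT (EFin \o (fun y => y * sin (t * y) * g y)).
Proof. by apply: le_int iG. Qed.

(* integration by parts: [s^2 y g(y)] is minus the derivative of [g] *)
Let parts t : (\int[mu]_y (y * sin (t * y) * g y) = s ^+ 2 * t * C t)%R.
Proof.
have ht1 y : is_derive y (1 : R) (fun y => - s ^+ 2 * (sin (t * y) * g y))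
    (y * sin (t * y) * g y - s ^+ 2 * t * (cos (t * y) * g y)).
  have gd := gdrv y.
  apply: is_derive_eq; rewrite /GRing.scale/=.
  by field; rewrite gt_eqF.
apply/eqP; rewrite -subr_eq0; apply/eqP.
have i2 : mu.-integrable setT (EFin \o (fun y => s ^+ 2 * t * (cos (t * y) * g y))).
  rewrite (_ : _ \o _ = (fun y => (s ^+ 2 * t)%:E * (cos (t * y) * g y)%:E)%E); last first.
    by apply/funext => y; rewrite -EFinM.
  exact: (integrableZl measurableT _ (gcos0 t)).
rewrite /C -RintegralZl// -RintegralB//.
have lim (u : nat -> R) : (forall n, g (u n) <= normal_peak s * n.+1%:R^-1 * (2 * s ^+ 2)) ->
    - s ^+ 2 * (sin (t * u n) * g (u n)) @[n --> \oo] --> (0 : R).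
  move=> gu; rewrite -[X in _ --> X](mulr0 (- s ^+ 2)).
  apply: cvgMr.
  apply: (@squeeze_cvgr _ _ _ _ (fun n => - (normal_peak s * n.+1%:R^-1 * (2 * s ^+ 2)))
    (fun n => normal_peak s * n.+1%:R^-1 * (2 * s ^+ 2))).
  - apply: nearW => n; rewrite -ler_norml normrM (ger0_norm (normal_pdf_ge0 _ _ _)).
    apply: le_trans (gu n); rewrite ler_piMl ?normal_pdf_ge0//.
    by rewrite ler_norml sin_geN1 sin_le1.
  - rewrite -oppr0; apply: cvgN; rewrite -(mul0r (2 * s ^+ 2)) -(mulr0 (normal_peak s)).
    by apply: cvgMl; apply: cvgMr; exact: cvg_harmonic.
  - rewrite -(mul0r (2 * s ^+ 2)) -(mulr0 (normal_peak s)).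
    by apply: cvgMl; apply: cvgMr; exact: cvg_harmonic.
(* Again exp v >= 1 + v, now with v = x^2 / (2 s^2); a decay of order 1/n is enough to kill the
   boundary terms. *)
have gn (x : R) n : x ^+ 2 = n.+1%:R ^+ 2 -> g x <= normal_peak s * n.+1%:R^-1 * (2 * s ^+ 2).
  move=> xn; rewrite gE -mulrA ler_wpM2l ?normal_peak_ge0// xn mulNr expRN.
  rewrite -(invrK (n.+1%:R^-1 * _)) lef_pV2 ?posrE ?expR_gt0//; last first.
    by rewrite invr_gt0 mulr_gt0// mulr_gt0// exprn_gt0.
  apply: le_trans (ltW (expR_gt1Dx _)); last by rewrite gt_eqF// divr_gt0// ?exprn_gt0// pmulrn_lgt0// exprn_gt0.
  rewrite invfM invrK.
  apply: (@le_trans _ _ (n.+1%:R ^+ 2 / (s ^+ 2 *+ 2))); last by rewrite lerDr.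
  rewrite -(mulr_natl (s ^+ 2)) ler_wpM2r//; first by rewrite invr_ge0 mulr_ge0// ltW// exprn_gt0.
  by rewrite expr2 ler_peMl// ler1n.
have cg : continuous g.
  by move=> y; apply: differentiable_continuous; apply/derivable1_diffP; have [] := gdrv y.
have cs : continuous (fun y : R => sin (t * y)).
  move=> y; apply: continuous_comp; last exact: continuous_sin.
  by apply: continuousM; [exact: cst_continuous|].
have cc : continuous (fun y : R => cos (t * y)).
  move=> y; apply: continuous_comp; last exact: continuous_cos.
  by apply: continuousM; [exact: cst_continuous|].
apply: (Rintegral_derivative0 ht1).
- move=> y; apply: cvgB.
    by apply: cvgM; [apply: cvgM; [|exact: cs]|exact: cg].
  by apply: cvgM; [exact: cvg_cst|apply: cvgM; [exact: cc|exact: cg]].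
- exact: (integrableB measurableT (iysin t) i2).
- by apply: lim => n; apply: gn.
- by apply: lim => n; apply: gn; rewrite sqrrN.
Qed.

(** The majorant [G] does not depend on the frequency, so differentiation under the integral is
    allowed; [parts] turns the derivative into a linear differential equation for [C]. *)
Let Cdrv (t : R) : is_derive t (1 : R) C (- s ^+ 2 * t * C t).
Proof.
have It : (`]t - 1, t + 1[%classic : set R) t by rewrite /= in_itv/=; lra.
have dd : forall x y : R, partial1of2 (fun t y => cos (t * y) * g y) x y = - (y * sin (x * y) * g y).
  by move=> x y; rewrite partial1of2E; apply: derive_val.
have h1 : forall x y : R, (`]t - 1, t + 1[%classic : set R) x -> (setT : set R) y ->
    derivable ((fun t y => cos (t * y) * g y) ^~ y) x 1.
  by move=> x y _ _; have [] := dcos y x.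
have h2 : forall x y : R, (`]t - 1, t + 1[%classic : set R) x -> (setT : set R) y ->
    `|partial1of2 (fun t y => cos (t * y) * g y) x y| <= G y.
  by move=> x y _ _; rewrite dd normrN.
apply: DeriveDef.
  exact: (derivable_under_integral measurableT It (fun x _ => gcos0 x) h1 G_ge0 iG h2).
rewrite -derive1E (differentiation_under_integral measurableT It (fun x _ => gcos0 x) h1 G_ge0 iG h2).
under eq_Rintegral => y _ do rewrite dd -mulN1r.
by rewrite RintegralZl// parts; ring.
Qed.

(** The differential equation is solved by checking that [C] times exp (s^2 t^2 / 2) has zero
    derivative; its value at 0 is the total mass 1. *)
Lemma gauss_cos t : (\int[normal_prob 0 s]_y cos (t * y))%R = expR (- (s ^+ 2 * t ^+ 2) / 2).
Proof.
rewrite integral_normal_prob// -/(C t).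
pose E t := C t * expR (s ^+ 2 * t ^+ 2 / 2).
have E' x : is_derive x (1 : R) E 0.
  by have Cd := Cdrv x; apply: is_derive_eq; rewrite /GRing.scale/=; field.
have -> : C t = E t * expR (- (s ^+ 2 * t ^+ 2) / 2).
  by rewrite /E -mulrA -expRD mulNr subrr expR0 mulr1.
rewrite (is_derive_0_is_cst t 0 E') /E expr0n/= mulr0 mul0r expR0 mulr1.
rewrite /C; under eq_Rintegral => y _ do rewrite mul0r cos0 mul1r.
by rewrite /Rintegral integral_normal_pdf/= mul1r.
Qed.

Lemma gauss_sin t : (\int[normal_prob 0 s]_y sin (t * y))%R = 0.
Proof.
rewrite integral_normal_prob//.
pose K y := sin (t * y) * g y.
have mK : measurable_fun setT K by exact: measurable_funM.
have iK : mu.-integrable setT (EFin \o K).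
  apply: le_int ig => // y.
  rewrite normrM (ger0_norm (normal_pdf_ge0 _ _ _)) ler_piMl ?normal_pdf_ge0//.
  by rewrite ler_norml sin_geN1 sin_le1.
have KN y : K (- y) = - K y by rewrite /K mulrN sinN mulNr !gE sqrrN.
have h : (\int[mu]_y (K y)%:E = \int[mu]_y (K (- y))%:E)%E.
  have iKN : mu.-integrable setT ((EFin \o K) \o -%R).
    rewrite (_ : _ \o _ = (fun y => ((-1)%:E * (EFin \o K) y)%E)).
      exact: integrableZl.
    by apply/funext => y /=; rewrite KN -EFinM mulN1r.
  have mN : measurable_fun setT (-%R : measurableTypeR R -> measurableTypeR R).
    exact: oppr_measurable.
  have mEK : measurable_fun setT (EFin \o K) by exact/measurable_EFinP.
  have := @integral_pushforward _ _ (measurableTypeR R) (measurableTypeR R) R _ mN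
    lebesgue_measure setT (EFin \o K) mEK iKN measurableT.
  rewrite preimage_setT => <-.
  by apply: eq_measure_integral => //= A mA _; exact/esym/lebesgue_measureN.
have : (\int[mu]_y K y = - \int[mu]_y K y)%R.
  rewrite {1}/Rintegral h; under eq_integral => y _ do rewrite KN -mulN1r.
  by rewrite -[LHS]/(\int[mu]_y (-1 * K y))%R (RintegralZl (-1) measurableT iK) mulN1r.
by rewrite -/(\int[mu]_y K y)%R; lra.
Qed.

Lemma gauss_cosD t th :
  (\int[normal_prob 0 s]_y cos (t * y + th))%R = expR (- (s ^+ 2 * t ^+ 2) / 2) * cos th.
Proof.
under eq_Rintegral => y _ do rewrite cosD.
have b1 (f : R -> R) c : measurable_fun setT f -> (forall y, `|f y| <= 1) ->
    (normal_prob 0 s).-integrable setT (EFin \o (fun y => f y * c)).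
  move=> mf f1; apply: (bounded_integrable _ (M := `|c|)); first exact: measurable_funM.
  by move=> y; rewrite normrM ler_piMl.
have b2 (f : R -> R) : measurable_fun setT f -> (forall y, `|f y| <= 1) ->
    (normal_prob 0 s).-integrable setT (EFin \o f).
  by move=> mf f1; apply: (bounded_integrable _ (M := 1)).
have c1 y : `|cos (t * y)| <= 1 by rewrite ler_norml cos_geN1 cos_le1.
have s1 y : `|sin (t * y)| <= 1 by rewrite ler_norml sin_geN1 sin_le1.
rewrite RintegralB ?RintegralZr ?gauss_cos ?gauss_sin ?mul0r ?subr0//; do ?exact: b1; exact: b2.
Qed.

End gaussian_characteristic_function.

(** * Levy's continuity theorem in the plane *)

Section mixtures.
Context d (S : measurableType d) {R : realType}.

Section fubini.
Context d' (A : measurableType d').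
Variables (al : {sigma_finite_measure set A -> \bar R}) (m : probability S R).
Variables (H : A * S -> R) (D : A -> R).
Hypothesis mH : measurable_fun setT H.
Hypothesis HD : forall a z, `|H (a, z)| <= D a.
Hypothesis iD : al.-integrable setT (EFin \o D).

Let mH1 a : measurable_fun setT (fun z => H (a, z)).
Proof. exact: measurableT_comp. Qed.

Let mH2 z : measurable_fun setT (fun a => H (a, z)).
Proof. exact: measurableT_comp. Qed.

Let D0 (z : S) a : 0 <= D a.
Proof. exact: le_trans (normr_ge0 _) (HD a z). Qed.

Let i1 a : m.-integrable setT (EFin \o (fun z => H (a, z))).
Proof. by apply: (bounded_integrable _ (M := D a)). Qed.

Let i2 z : al.-integrable setT (EFin \o (fun a => H (a, z))).
Proof.
apply: le_integrable iD => //; first exact/measurable_EFinP.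
by move=> a _ /=; rewrite lee_fin (le_trans (HD a z))// ler_norm.
Qed.

Lemma mixture_integrable : (al \x m)%E.-integrable setT (EFin \o H).
Proof.
apply/integrable12ltyP; first exact/measurable_EFinP.
apply: (@le_lt_trans _ _ (\int[al]_a (`|D a|)%:E)%E); last first.
  by have /integrableP[_] := iD.
apply: ge0_le_integral => //.
- by move=> a _; apply: integral_ge0.
- apply: (measurable_fun_fubini_tonelli_F (fun z => `|(EFin \o H) z|%E)).
  by apply: measurableT_comp => //; exact/measurable_EFinP.
    by move=> x.
- by apply/measurable_EFinP; apply: measurableT_comp => //; exact/measurable_EFinP/(measurable_int al).
- move=> a _; rewrite -[leRHS]mule1 -(@probability_setT _ _ _ m) -integral_cst//.
  apply: ge0_le_integral => //.
  + by apply/measurable_EFinP; exact: measurableT_comp.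
  + by move=> z _; rewrite lee_fin (le_trans (HD a z))// ler_norm.
Qed.

Lemma mixture_measurable : measurable_fun setT (fun z => \int[al]_a H (a, z))%R.
Proof.
apply: (measurableT_comp (@fine_measurable R setT measurableT)).
exact: (measurable_fubini_G mixture_integrable).
Qed.

Lemma mixture_measurable_l : measurable_fun setT (fun a => \int[m]_z H (a, z))%R.
Proof.
apply: (measurableT_comp (@fine_measurable R setT measurableT)).
exact: (measurable_fubini_F mixture_integrable).
Qed.

Lemma Rintegral_mixture :
  (\int[m]_z \int[al]_a H (a, z) = \int[al]_a \int[m]_z H (a, z))%R.
Proof.
rewrite /Rintegral; congr fine.
transitivity (\int[m]_z \int[al]_a (H (a, z))%:E)%E.
  by apply: eq_integral => z _; rewrite -[LHS]/((\int[al]_a H (a, z))%R%:E) EFin_Rintegral.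
rewrite -(Fubini mixture_integrable); apply: eq_integral => a _.
by rewrite -[RHS]/((\int[m]_z H (a, z))%R%:E) EFin_Rintegral.
Qed.

End fubini.

Variables (mu : nat -> probability S R) (nu : probability S R).

Definition weak_conv (h : S -> R) :=
  (\int[mu n]_z h z)%R @[n --> \oo] --> (\int[nu]_z h z)%R.

(** Fubini exchanges the two integrals and dominated convergence takes the limit in [a]. The mixing
    measure is only sigma-finite so as to cover both Gaussian averages over frequencies and Lebesgue
    integrals over translations. *)
Lemma weak_conv_mixture d' (A : measurableType d')
  (al : {sigma_finite_measure set A -> \bar R}) (H : A * S -> R) (D : A -> R) :
  measurable_fun setT H -> (forall a z, `|H (a, z)| <= D a) ->
  al.-integrable setT (EFin \o D) ->
  (forall a, weak_conv (fun z => H (a, z))) ->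
  weak_conv (fun z => \int[al]_a H (a, z))%R.
Proof.
move=> mH HD iD cv; rewrite /weak_conv.
under eq_fun do rewrite (Rintegral_mixture _ mH HD iD).
rewrite (Rintegral_mixture _ mH HD iD).
have [|||||fi _ h] := @dominated_convergence _ _ _ al _ measurableT
   (fun n => EFin \o (fun a => \int[mu n]_z H (a, z))%R)
   (EFin \o (fun a => \int[nu]_z H (a, z))%R) (EFin \o D).
- by move=> n; apply/measurable_EFinP; exact: (mixture_measurable_l (mu n) mH HD iD).
- by apply/measurable_EFinP; exact: (mixture_measurable_l nu mH HD iD).
- apply: aeW => a _; apply: cvg_EFin; [exact: nearW|exact: cv].
- exact: iD.
- apply: aeW => a n _; rewrite /= lee_fin; apply: Rintegral_bound => //.
  exact: measurableT_comp.
apply: (@fine_cvg _ _ _ _ (fun n => (\int[al]_a (\int[mu n]_z H (a, z))%R%:E)%E)).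
by rewrite -[X in _ --> X]EFin_Rintegral// in h.
Qed.

Lemma weak_conv_uniform (h : S -> R) (M : R) : measurable_fun setT h ->
  (forall z, `|h z| <= M) ->
  (forall e : R, 0 < e -> exists h' : S -> R, [/\ measurable_fun setT h',
      (exists M' : R, forall z, `|h' z| <= M'), (forall z, `|h z - h' z| <= e) & weak_conv h']) ->
  weak_conv h.
Proof.
move=> mh hM H; apply: cvg_uniform_limit => e e0.
have [h' [mh' [M' hM'] hh cv]] := H _ e0.
have cl (m : probability S R) : `|(\int[m]_z h z)%R - (\int[m]_z h' z)%R| <= e.
  rewrite -RintegralB//; last 2 first.
  - exact: (bounded_integrable _ mh hM).
  - exact: (bounded_integrable _ mh' hM').
  by apply: Rintegral_bound => //; exact: measurable_funB.
exists (fun n => \int[mu n]_z h' z)%R, (\int[nu]_z h' z)%R.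
by split=> //; exact: nearW.
Qed.

End mixtures.

Section levy_continuity.
Context {R : realType}.
Notation leb := (@lebesgue_measure R).
Variables (mu : nat -> probability R[i] R) (nu : probability R[i] R).

Lemma weak_convZ (c : R) (h : R[i] -> R) (M : R) : measurable_fun setT h ->
  (forall z, `|h z| <= M) -> weak_conv mu nu h -> weak_conv mu nu (fun z => c * h z).
Proof.
move=> mh hM cv; rewrite /weak_conv.
under eq_fun do rewrite RintegralZl ?(bounded_integrable _ mh hM)//.
rewrite RintegralZl ?(bounded_integrable _ mh hM)//.
exact: cvgMr.
Qed.

Lemma measurable_cosf d (S : measurableType d) (f : S -> R) :
  measurable_fun setT f -> measurable_fun setT (fun x => cos (f x)).
Proof.
by move=> mf; apply: (measurableT_comp (continuous_measurable_fun (@continuous_cos R))).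
Qed.

Lemma measurable_expRf d (S : measurableType d) (f : S -> R) :
  measurable_fun setT f -> measurable_fun setT (fun x => expR (f x)).
Proof. by move=> mf; apply: (measurableT_comp (@measurable_expR R)). Qed.

(** Half of the exponent is spent on the small factor, the other half is kept as a wider normal
    density, whose integral is 1. *)
Lemma normal_pdf_tail (m e dl x : R) : 0 < e -> 0 < dl -> dl < `|x - m| ->
  normal_pdf m e x <= Num.sqrt 2 * expR (- (dl ^+ 2 / (4 * e ^+ 2))) * normal_pdf m (Num.sqrt 2 * e) x.
Proof.
move=> e0 dl0 hx.
have q0 : 0 < Num.sqrt (2 : R) by rewrite sqrtr_gt0.
have pi0 := @pi_gt0 R.
rewrite !normal_pdfE ?mulf_neq0 ?gt_eqF// /normal_fun exprMn sqr_sqrtr//.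
have -> : normal_peak e = Num.sqrt 2 * normal_peak (Num.sqrt 2 * e).
  rewrite /normal_peak exprMn sqr_sqrtr//.
  rewrite (_ : 2 * e ^+ 2 * pi *+ 2 = 2 * (e ^+ 2 * pi *+ 2)); last by ring.
  by rewrite sqrtrM// invfM mulrA divff ?mul1r// gt_eqF.
have h2 : dl ^+ 2 <= (x - m) ^+ 2.
  rewrite -(real_normK (num_real (x - m))) ler_pXn2r ?nnegrE ?normr_ge0 ?ltW//.
have key : expR (- (x - m) ^+ 2 / (e ^+ 2 *+ 2)) <=
    expR (- (dl ^+ 2 / (4 * e ^+ 2))) * expR (- (x - m) ^+ 2 / (2 * e ^+ 2 *+ 2)).
  rewrite -expRD ler_expR -subr_ge0.
  rewrite (_ : _ - _ = ((x - m) ^+ 2 - dl ^+ 2) / (4 * e ^+ 2)); last first.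
    by field; rewrite gt_eqF.
  by rewrite divr_ge0 ?subr_ge0// mulr_ge0 ?sqr_ge0.
have k0 : 0 <= Num.sqrt 2 * normal_peak (Num.sqrt 2 * e).
  by rewrite mulr_ge0 ?sqrtr_ge0 ?normal_peak_ge0.
by move: (ler_wpM2l k0 key); congr (_ <= _); ring.
Qed.

(** Within [dl] of [m] the oscillation is at most [eta]; beyond it the difference is at most [2 * M]
    and the density obeys [normal_pdf_tail]. *)
Lemma normal_smoothing (h : R -> R) (M m e dl eta : R) : 0 < e -> 0 < dl ->
  measurable_fun setT h -> (forall x, `|h x| <= M) ->
  (forall x, `|x - m| <= dl -> `|h x - h m| <= eta) ->
  `|(\int[leb]_x (h x * normal_pdf m e x))%R - h m| <=
    eta + 2 * M * (Num.sqrt 2 * expR (- (dl ^+ 2 / (4 * e ^+ 2)))).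
Proof.
move=> e0 dl0 mh hM hc.
have eta0 : 0 <= eta by apply: le_trans (normr_ge0 _) (hc m _); rewrite subrr normr0 ltW.
have M0 : 0 <= M by apply: le_trans (normr_ge0 _) (hM m).
set q := Num.sqrt 2 * _.
have q0 : 0 <= q by rewrite /q mulr_ge0 ?sqrtr_ge0 ?expR_ge0.
have mpdf s : measurable_fun setT (normal_pdf m s) by exact: measurable_normal_pdf.
have ipdf s := @integrable_normal_pdf R m s.
have Ipdf s : (\int[leb]_x normal_pdf m s x)%R = 1 by rewrite /Rintegral integral_normal_pdf.
have ih : leb.-integrable setT (EFin \o (fun x => h x * normal_pdf m e x)).
  apply: (le_integrable _ _ _ (integrableZl measurableT M (ipdf e))) => //.
    by apply/measurable_EFinP; exact: (measurable_funM mh (mpdf e)).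
  move=> x _ /=; rewrite lee_fin !normrM ler_wpM2r//.
  by rewrite (le_trans (hM x))// ler_norm.
have ic (c : R) s : leb.-integrable setT (EFin \o (fun x => c * normal_pdf m s x)).
  exact: (integrableZl measurableT c (ipdf s)).
have -> : h m = (\int[leb]_x (h m * normal_pdf m e x))%R.
  by rewrite RintegralZl ?Ipdf ?mulr1//; exact: ipdf.
rewrite -RintegralB//.
apply: (le_trans (le_normr_Rintegral measurableT (integrableB measurableT ih (ic (h m) e)))).
have -> : eta + 2 * M * q = (\int[leb]_x (eta * normal_pdf m e x + (2 * M * q) * normal_pdf m (Num.sqrt 2 * e) x))%R.
  rewrite RintegralD// ?RintegralZl ?Ipdf ?mulr1//; exact: ipdf.
apply: le_Rintegral => //.
- exact: (integrable_norm (integrableB measurableT ih (ic (h m) e))).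
- exact: (integrableD measurableT (ic _ e) (ic _ _)).
- move=> x _; rewrite -mulrBl normrM (ger0_norm (normal_pdf_ge0 _ _ _)).
  have [xm|xm] := leP `|x - m| dl.
    rewrite (@le_trans _ _ (eta * normal_pdf m e x))//.
      by rewrite ler_wpM2r ?normal_pdf_ge0// hc.
    by rewrite lerDl mulr_ge0 ?normal_pdf_ge0// !mulr_ge0.
  rewrite (@le_trans _ _ (2 * M * q * normal_pdf m (Num.sqrt 2 * e) x))//; last first.
    by rewrite lerDr mulr_ge0 ?normal_pdf_ge0.
  rewrite -mulrA; apply: ler_pM => //; first exact: normal_pdf_ge0.
    by apply: le_trans (ler_normB _ _) _; have := hM x; have := hM m; lra.
  exact: normal_pdf_tail.
Qed.

Hypothesis cos_conv : forall s t th : R,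
  weak_conv mu nu (fun z => cos (s * Re z + t * Im z + th)).

Let cos1 (x : R) : `|cos x| <= 1.
Proof. by rewrite ler_norml cos_geN1 cos_le1. Qed.

Let one_integrable (e : R) : (normal_prob 0 e^-1).-integrable setT (EFin \o (fun=> 1 : R)).
Proof. by apply: (bounded_integrable _ (M := 1)) => // x; rewrite normr1. Qed.

(** A Gaussian in [Re z] is an average of cosines over normal frequencies of deviation 1/e. The
    cosine in [Im z] is carried along inside the phase, ready for the same treatment. *)
Lemma weak_conv_gauss1 (e x t th : R) : 0 < e ->
  weak_conv mu nu (fun z => expR (- (x - Re z) ^+ 2 / (e ^+ 2 *+ 2)) * cos (t * Im z + th)).
Proof.
move=> e0.
have := @weak_conv_mixture _ _ _ mu nu _ _ (normal_prob 0 e^-1)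
  (fun az => cos ((Re az.2 - x) * az.1 + (t * Im az.2 + th))) (fun=> 1) _ _ (one_integrable e) _.
rewrite (_ : (fun z => \int[_]_a _) =
  (fun z => expR (- (x - Re z) ^+ 2 / (e ^+ 2 *+ 2)) * cos (t * Im z + th))); last first.
  apply/funext => z; rewrite /= gauss_cosD ?invr_gt0//; congr (expR _ * _).
  by field; rewrite gt_eqF.
apply.
- have m2 : measurable_fun [set: R * R[i]] (fun az => Re az.2).
    by apply: measurableT_comp; [exact: measurable_Re|exact: measurable_snd].
  have m3 : measurable_fun [set: R * R[i]] (fun az => Im az.2).
    by apply: measurableT_comp; [exact: measurable_Im|exact: measurable_snd].
  apply: measurable_cosf; apply: measurable_funD.
    by apply: measurable_funM; [exact: measurable_funB|exact: measurable_fst].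
  by apply: measurable_funD => //; exact: measurable_funM.
- by move=> a z; exact: cos1.
- move=> a; have := @cos_conv a t (th - a * x).
  by congr weak_conv; apply/funext => z /=; congr cos; ring.
Qed.

(** The second average, over the frequency in [Im z], makes both coordinates Gaussian. *)
Lemma weak_conv_gauss2 (e x y : R) : 0 < e ->
  weak_conv mu nu (fun z => normal_pdf (Re z) e x * normal_pdf (Im z) e y).
Proof.
move=> e0.
have ex (z : R[i]) : `|expR (- (x - Re z) ^+ 2 / (e ^+ 2 *+ 2))| <= 1.
  rewrite ger0_norm ?expR_ge0// -expR0 ler_expR mulNr oppr_le0 divr_ge0 ?sqr_ge0//.
  by rewrite mulrn_wge0 ?sqr_ge0.
have mex : measurable_fun [set: R[i]] (fun z => expR (- (x - Re z) ^+ 2 / (e ^+ 2 *+ 2))).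
  apply: measurable_expRf; apply: measurable_funM => //; apply: measurableT_comp => //.
  by apply: measurable_funX; apply: measurable_funB => //; exact: measurable_Re.
have := @weak_conv_mixture _ _ _ mu nu _ _ (normal_prob 0 e^-1)
  (fun az => expR (- (x - Re az.2) ^+ 2 / (e ^+ 2 *+ 2)) * cos ((Im az.2 - y) * az.1)) (fun=> 1) _ _ (one_integrable e) _.
rewrite (_ : (fun z => \int[_]_a _) =
  (fun z => expR (- (x - Re z) ^+ 2 / (e ^+ 2 *+ 2)) * expR (- (y - Im z) ^+ 2 / (e ^+ 2 *+ 2)))); last first.
  apply/funext => z /=; rewrite RintegralZl//; last first.
    apply: (bounded_integrable _ (M := 1)) => //.
    by apply: measurable_cosf; exact: measurable_funM.
  rewrite gauss_cos ?invr_gt0//; congr (_ * expR _).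
  by field; rewrite gt_eqF.
move=> h.
have m3 : measurable_fun [set: R * R[i]] (fun az => Im az.2).
  by apply: measurableT_comp; [exact: measurable_Im|exact: measurable_snd].
have {h} := h _ _ _; move=> h.
rewrite (_ : (fun z => _) = (fun z => (normal_peak e * normal_peak e) *
  (expR (- (x - Re z) ^+ 2 / (e ^+ 2 *+ 2)) * expR (- (y - Im z) ^+ 2 / (e ^+ 2 *+ 2))))); last first.
  apply/funext => z; rewrite !normal_pdfE ?gt_eqF// /normal_fun.
  by ring.
apply: (weak_convZ _ (M := 1)).
- apply: measurable_funM => //.
  apply: measurable_expRf; apply: measurable_funM => //; apply: measurableT_comp => //.
  by apply: measurable_funX; apply: measurable_funB => //; exact: measurable_Im.
- move=> z; rewrite normrM -[leRHS]mulr1 ler_pM//.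
  rewrite ger0_norm ?expR_ge0// -expR0 ler_expR mulNr oppr_le0 divr_ge0 ?sqr_ge0//.
  by rewrite mulrn_wge0 ?sqr_ge0.
- apply: h.
  + apply: measurable_funM; last first.
      apply: measurable_cosf; apply: measurable_funM; last exact: measurable_fst.
      exact: measurable_funB.
    exact: (measurableT_comp mex).
  + move=> a z; rewrite normrM -[leRHS]mulr1 ler_pM//.
  + move=> a; have := @weak_conv_gauss1 e x a (- (a * y)) e0.
    by congr weak_conv; apply/funext => z /=; congr (_ * cos _); ring.
Qed.

Lemma measurable_normal_pdf_comp d (S : measurableType d) (f g : S -> R) (e : R) :
  0 < e -> measurable_fun setT f -> measurable_fun setT g ->
  measurable_fun setT (fun x => normal_pdf (f x) e (g x)).
Proof.
move=> e0 mf mg; rewrite (_ : (fun _ => _) =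
  (fun x => normal_peak e * expR (- (g x - f x) ^+ 2 / (e ^+ 2 *+ 2)))); last first.
  by apply/funext => x; rewrite normal_pdfE ?gt_eqF.
apply: measurable_funM => //; apply: measurable_expRf; apply: measurable_funM => //.
by apply: measurableT_comp => //; apply: measurable_funX; exact: measurable_funB.
Qed.

Section smoothed.
Variables (g : R[i] -> R) (M A e : R).
Hypotheses (mg : measurable_fun setT g) (gM : forall z, `|g z| <= M) (e0 : 0 < e).
Hypothesis gA : forall z, A < `|Re z| \/ A < `|Im z| -> g z = 0.
Let I : set R := `[- A, A]%classic.
Let pk := normal_peak e.
(** Lebesgue measure being infinite, a constant bound would not be integrable; the bounded support
    of [g] provides the indicator. *)
Let B (x : R) : R := M * (pk * pk) * \1_I x.

Let M0 : 0 <= M. Proof. exact: le_trans (normr_ge0 _) (gM 0). Qed.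
Let pk0 : 0 <= pk. Proof. exact: normal_peak_ge0. Qed.

Let iB (c : R) : leb.-integrable setT (EFin \o (fun x => c * \1_I x)).
Proof. apply: (@integrableZl _ _ _ leb _ measurableT c (EFin \o \1_I)); exact: integrable_indic_itv. Qed.

Let notI x : x \notin I -> A < `|x|.
Proof. by rewrite notin_setE /I/= in_itv/= -ler_norml => /negP; rewrite -ltNge. Qed.

Let gB x y (k l : R) : 0 <= k -> k <= pk -> 0 <= l -> l <= pk ->
  `|g (x +i* y) * k * l| <= B x.
Proof.
move=> k0 kp l0 lp; rewrite /B.
have [xI|xI] := boolP (x \in I).
  rewrite indicE xI mulr1 !normrM (ger0_norm k0) (ger0_norm l0) -mulrA.
  by rewrite ler_pM// ?mulr_ge0// ler_pM.
rewrite gA ?mul0r ?normr0; last first.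
  by left; exact: notI.
by rewrite indicE (negbTE xI) mulr0.
Qed.

Let H1 (p : R * (R * R[i])) :=
  g (p.1 +i* p.2.1) * normal_pdf (Re p.2.2) e p.1 * normal_pdf (Im p.2.2) e p.2.1.

Let mH1 : measurable_fun setT H1.
Proof.
have mx : measurable_fun [set: R * (R * R[i])] (fun p => p.1) by exact: measurable_fst.
have my : measurable_fun [set: R * (R * R[i])] (fun p => p.2.1).
  by apply: measurableT_comp; [exact: measurable_fst|exact: measurable_snd].
have mz : measurable_fun [set: R * (R * R[i])] (fun p => p.2.2).
  by apply: measurableT_comp; [exact: measurable_snd|exact: measurable_snd].
have [mr mi] := measurable_funCP mz.
apply: measurable_funM; last exact: measurable_normal_pdf_comp.
apply: measurable_funM; last exact: measurable_normal_pdf_comp.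
by apply: (measurableT_comp mg); apply: measurable_funC.
Qed.

Let H1B x yz : `|H1 (x, yz)| <= B x.
Proof. by apply: gB; rewrite ?normal_pdf_ge0// normal_pdf_ub ?gt_eqF. Qed.

Let H2 (yz : R * R[i]) := (\int[leb]_x H1 (x, yz))%R.

Let mH2 : measurable_fun setT H2.
Proof.
(* Only measurability is at stake, so any probability on the second factor will do; a Dirac mass is
   taken. *)
exact: (@mixture_measurable _ _ R _ _ leb (\d_ (0 : R, 0 : R[i])) H1 B mH1 H1B (iB _)).
Qed.

Let K := (\int[leb]_x B x)%R.

Let H2B y z : `|H2 (y, z)| <= K * \1_I y.
Proof.
have iH1 : leb.-integrable setT (EFin \o (fun x => H1 (x, (y, z)))).
  apply: (le_integrable _ _ _ (iB (M * (pk * pk)))) => //.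
    by apply/measurable_EFinP; exact: measurableT_comp.
  by move=> x _ /=; rewrite lee_fin (le_trans (H1B _ _))// ler_norm.
have [yI|yI] := boolP (y \in I).
  rewrite indicE yI mulr1; apply: (le_trans (le_normr_Rintegral measurableT iH1)).
  by apply: (le_Rintegral measurableT (integrable_norm iH1) (iB _)) => x _; exact: H1B.
rewrite indicE (negbTE yI) mulr0 /H2 /H1/=.
have h x : g (x +i* y) = 0 by apply: gA; right; exact: notI.
under eq_Rintegral => x _ do rewrite h !mul0r.
by rewrite /Rintegral integral0 normr0.
Qed.

(** Convolution of [g] with a planar Gaussian of deviation [e] in each coordinate. Read as a mixture
    over the translation, it is a superposition of the kernels of [weak_conv_gauss2]. *)
Definition smoothing (z : R[i]) : R :=
  (\int[leb]_y ((\int[leb]_x (g (x +i* y) * normal_pdf (Re z) e x)) * normal_pdf (Im z) e y))%R.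

Let smoothingE : smoothing = (fun z => \int[leb]_y H2 (y, z))%R.
Proof.
apply/funext => z; apply: eq_Rintegral => y _; rewrite /H2 /H1/=.
rewrite RintegralZr//.
apply: (le_integrable _ _ _ (iB (M * pk))) => //.
  apply/measurable_EFinP; apply: measurable_funM; last exact: measurable_normal_pdf.
  by apply: (measurableT_comp mg); apply: measurable_funC => /=; [exact: measurable_id|exact: measurable_cst].
move=> x _ /=; rewrite lee_fin normrM (ger0_norm (normal_pdf_ge0 _ _ _)).
have [xI|xI] := boolP (x \in I).
  rewrite indicE xI mulr1 [leRHS]ger0_norm ?mulr_ge0// ler_pM ?normal_pdf_ge0//.
  by rewrite normal_pdf_ub ?gt_eqF.
rewrite gA ?mul0r ?normr0 ?mul0r//.
by left; exact: notI.
Qed.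

Lemma measurable_smoothing : measurable_fun setT smoothing.
Proof.
rewrite smoothingE.
exact: (@mixture_measurable _ _ R _ _ leb nu H2 (fun y => K * \1_I y) mH2 H2B (iB _)).
Qed.

Lemma weak_conv_smoothing : weak_conv mu nu smoothing.
Proof.
rewrite smoothingE.
apply: (@weak_conv_mixture _ _ _ mu nu _ _ leb H2 (fun y => K * \1_I y) mH2 H2B (iB _)) => y.
have := @weak_conv_mixture _ _ _ mu nu _ _ leb (fun xz => H1 (xz.1, (y, xz.2))) B _ _ (iB _).
apply.
- apply: (measurableT_comp mH1); apply: measurable_fun_pair => //.
  by apply: measurable_fun_pair => //; exact: measurable_snd.
- by move=> x z; exact: H1B.
- move=> x; rewrite /H1/=.
  rewrite (_ : (fun z => _) = (fun z => g (x +i* y) * (normal_pdf (Re z) e x * normal_pdf (Im z) e y))); last first.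
    by apply/funext => z; rewrite mulrA.
  apply: (weak_convZ _ (M := pk * pk)); last exact: weak_conv_gauss2.
    by apply: measurable_funM; apply: measurable_normal_pdf_comp => //; [exact: measurable_Re|exact: measurable_Im].
  move=> z; rewrite normrM !ger0_norm ?normal_pdf_ge0//.
  by rewrite ler_pM ?normal_pdf_ge0// normal_pdf_ub ?gt_eqF.
Qed.

End smoothed.

(** Uniform continuity makes [g] a uniform limit of its smoothings. Smoothing one coordinate at a
    time costs eta/2 each. *)
Lemma weak_conv_Cc (g : R[i] -> R) (M A : R) : measurable_fun setT g ->
  (forall z, `|g z| <= M) ->
  (forall e, 0 < e -> exists2 dl, 0 < dl &
     forall z z', `|Re z' - Re z| <= dl -> `|Im z' - Im z| <= dl -> `|g z' - g z| <= e) ->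
  (forall z, A < `|Re z| \/ A < `|Im z| -> g z = 0) ->
  weak_conv mu nu g.
Proof.
move=> mg gM gu gA; have M0 : 0 <= M by exact: le_trans (normr_ge0 _) (gM 0).
apply: (weak_conv_uniform mg gM) => eta eta0.
have eta4 : 0 < eta / 4 by lra.
have [dl dl0 hu] := gu _ eta4.
(* With e^2 = [c] the exponent dl^2 / (4 e^2) is 16 (M + 1) / eta; since exp (- v) <= 1/v, the tail
   term is then at most eta/4. *)
pose c := dl ^+ 2 * eta / (64 * (M + 1)).
have c0 : 0 < c by rewrite divr_gt0 ?mulr_gt0 ?exprn_gt0//; lra.
pose e := Num.sqrt c.
have e0 : 0 < e by rewrite sqrtr_gt0.
have e2 : e ^+ 2 = c by rewrite sqr_sqrtr// ltW.
have M1 : 0 < M + 1 by exact: ltr_wpDl.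
have tail : 2 * M * (Num.sqrt 2 * expR (- (dl ^+ 2 / (4 * e ^+ 2)))) <= eta / 4.
  have h1 : Num.sqrt (2 : R) <= 2.
    rewrite -[leRHS]ger0_norm// -sqrtr_sqr ler_sqrt ?sqr_ge0//; lra.
  have h2 : expR (- (dl ^+ 2 / (4 * e ^+ 2))) <= eta / (16 * (M + 1)).
    rewrite expRN -[leRHS]invrK lef_pV2 ?posrE ?expR_gt0//; last first.
      by rewrite invr_gt0 divr_gt0// mulr_gt0.
    apply: le_trans (expR_ge1Dx _); rewrite e2 /c.
    rewrite (_ : (eta / (16 * (M + 1)))^-1 = dl ^+ 2 / (4 * (dl ^+ 2 * eta / (64 * (M + 1))))).
      by rewrite lerDr.
    by field; rewrite !gt_eqF.
  have h3 : 0 <= expR (- (dl ^+ 2 / (4 * e ^+ 2))) by exact: expR_ge0.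
  have h4 : Num.sqrt 2 * expR (- (dl ^+ 2 / (4 * e ^+ 2))) <= 2 * (eta / (16 * (M + 1))).
    by rewrite ler_pM ?sqrtr_ge0.
  apply: le_trans (ler_wpM2l _ h4) _; first by rewrite mulr_ge0.
  rewrite (_ : 2 * M * _ = eta / 4 * (M / (M + 1))); last by field; rewrite gt_eqF.
  by rewrite ler_piMr ?(ltW eta4)// ler_pdivrMr// mul1r lerDl.
pose h' := smoothing g e.
have mgy y : measurable_fun setT (fun x : R => g (x +i* y)).
  by apply: (measurableT_comp mg); apply: measurable_funC => /=; [exact: measurable_id|exact: measurable_cst].
have mgx x : measurable_fun setT (fun y : R => g (x +i* y)).
  by apply: (measurableT_comp mg); apply: measurable_funC => /=; [exact: measurable_cst|exact: measurable_id].
have ipdf m : leb.-integrable setT (EFin \o (normal_pdf m e)) by exact: integrable_normal_pdf.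
have bpdf m (f : R -> R) N : measurable_fun setT f -> (forall x, `|f x| <= N) ->
    leb.-integrable setT (EFin \o (fun x => f x * normal_pdf m e x)).
  move=> mf fN; apply: (le_integrable _ _ _ (integrableZl measurableT N (ipdf m))) => //.
    by apply/measurable_EFinP; apply: (measurable_funM mf); exact: measurable_normal_pdf.
  move=> x _ /=; rewrite lee_fin !normrM ler_wpM2r//.
  by rewrite (le_trans (fN x))// ler_norm.
have Ipdf m (N : R) : (\int[leb]_x (N * normal_pdf m e x))%R = N.
  by rewrite RintegralZl// /Rintegral integral_normal_pdf/= mulr1.
have gh' z : `|g z - h' z| <= eta.
  pose G1 y := (\int[leb]_x (g (x +i* y) * normal_pdf (Re z) e x))%R.
  have G1g y : `|G1 y - g (Re z +i* y)| <= eta / 2.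
    apply: le_trans (@normal_smoothing (fun x => g (x +i* y)) M (Re z) e dl (eta / 4) e0 dl0 (mgy y) _ _) _.
    - by move=> x; exact: gM.
    - by move=> x xz; apply: hu => //=; rewrite subrr normr0 ltW.
    - lra.
  have mG1 : measurable_fun setT G1.
    apply: (@mixture_measurable _ _ R _ _ leb (normal_prob 0 1)
      (fun xy => g (xy.1 +i* xy.2) * normal_pdf (Re z) e xy.1) (fun x => M * normal_pdf (Re z) e x)).
    - apply: measurable_funM; last by apply: measurable_normal_pdf_comp => //; exact: measurable_fst.
      apply: (measurableT_comp mg).
      by apply: measurable_funC => /=; [exact: measurable_fst|exact: measurable_snd].
    - move=> x y /=; rewrite normrM (ger0_norm (normal_pdf_ge0 _ _ _)).
      by rewrite ler_wpM2r ?normal_pdf_ge0.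
    - exact: (integrableZl measurableT M (ipdf (Re z))).
  have bG1 y : `|G1 y| <= M + eta / 2.
    rewrite -(subrK (g (Re z +i* y)) (G1 y)) addrC; apply: le_trans (ler_normD _ _) _.
    by rewrite lerD.
  pose G2 := (\int[leb]_y (g (Re z +i* y) * normal_pdf (Im z) e y))%R.
  have h1 : `|h' z - G2| <= eta / 2.
    rewrite /h' /smoothing -/G1 /G2 -RintegralB//; last 2 first.
    - exact: (bpdf _ _ _ mG1 bG1).
    - exact: (bpdf _ _ M (mgx _)).
    have iD := integrableB measurableT (bpdf (Im z) _ _ mG1 bG1) (bpdf (Im z) _ M (mgx (Re z)) (fun y => gM _)).
    apply: (le_trans (le_normr_Rintegral measurableT iD)).
    rewrite -(Ipdf (Im z) (eta / 2)).
    apply: (le_Rintegral measurableT (integrable_norm iD) (integrableZl measurableT _ (ipdf _))) => y _.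
    by rewrite /= -mulrBl normrM (ger0_norm (normal_pdf_ge0 _ _ _)) ler_wpM2r ?normal_pdf_ge0.
  have h2 : `|G2 - g z| <= eta / 2.
    rewrite [in g z](_ : z = Re z +i* Im z); last by case: (z).
    apply: le_trans (@normal_smoothing (fun y => g (Re z +i* y)) M (Im z) e dl (eta / 4) e0 dl0 (mgx (Re z)) _ _) _.
    - by move=> x; exact: gM.
    - by move=> x xz; apply: hu => //=; rewrite subrr normr0 ltW.
    - lra.
  rewrite distrC -(subrKA G2); apply: le_trans (ler_normD _ _) _; lra.
exists h'; split => //.
- exact: (measurable_smoothing mg gM e0 gA).
- exists (M + eta) => z; rewrite -(subKr (g z) (h' z)); apply: le_trans (ler_normB _ _) _.
  by rewrite lerD.
- exact: (weak_conv_smoothing mg gM e0 gA).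
Qed.

End levy_continuity.

(** * Compactly supported test functions, cutoffs, and the passage to bounded ones *)

Section compactly_supported.
Context {R : realType}.

(** Otherwise some pairs of points at distance at most 1/(n+1) keep values more than [e] apart; a
    cluster point of these pairs contradicts continuity there. *)
Lemma compactly_supported_unif_cont (g : R[i] -> R) (A : R) : continuous g ->
  (forall z, A < `|Re z| \/ A < `|Im z| -> g z = 0) ->
  forall e : R, 0 < e -> exists2 dl : R, 0 < dl &
     forall z z', `|Re z' - Re z| <= dl -> `|Im z' - Im z| <= dl -> `|g z' - g z| <= e.
Proof.
move=> cg gA e e0; apply/not_exists2P => H.
have {}H n : exists zz : R[i] * R[i], [/\ `|Re zz.2 - Re zz.1| <= n.+1%:R^-1,
    `|Im zz.2 - Im zz.1| <= n.+1%:R^-1 & e < `|g zz.2 - g zz.1|].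
  have [|] := H n.+1%:R^-1; first by move=> h; exfalso; apply: h; rewrite invr_gt0.
  move=> /existsNP[z /existsNP[z' h]]; exists (z, z') => /=.
  move: h => /not_implyP[h1 /not_implyP[h2 /negP]]; rewrite -ltNge => h3.
  by split.
have /choice[zz hz] := H.
have n1 n : n.+1%:R^-1 <= 1 :> R by rewrite invf_le1 ?ler1n.
(* If a coordinate of the first point exceeded A + 1, that of the second would exceed A, and [g]
   would vanish at both. *)
have hA n : `|Re (zz n).1| <= A + 1 /\ `|Im (zz n).1| <= A + 1.
  have [h1 h2 h3] := hz n; have := n1 n => {}n1.
  apply: contrapT => /not_andP H'; move: h3; apply/negP; rewrite -leNgt.
  have [z1 z2] : (A < `|Re (zz n).1| \/ A < `|Im (zz n).1|) /\
                 (A < `|Re (zz n).2| \/ A < `|Im (zz n).2|).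
    have hR : `|Re (zz n).1| <= `|Re (zz n).2| + 1.
      by rewrite -lerBlDl (le_trans (lerB_dist _ _))// distrC (le_trans h1).
    have hI : `|Im (zz n).1| <= `|Im (zz n).2| + 1.
      by rewrite -lerBlDl (le_trans (lerB_dist _ _))// distrC (le_trans h2).
    by case: H' => /negP; rewrite -ltNge => ?; split; [left|left|right|right]; lra.
  by rewrite !gA// subrr normr0 ltW.
have [z0 [_ _ cl]] := box_cluster (fun n => (hA n).1) (fun n => (hA n).2).
have e2 : 0 < e / 2 by lra.
have /cvg_complexP/(_ _ e2)[dl dl0 hdl] := cg z0.
have dl2 : 0 < dl / 2 by lra.
pose N := Num.truncn (2 / dl).
have [n [Nn hr hi]] := cl _ N dl2.
have [h1 h2 h3] := hz n.
have nd : n.+1%:R^-1 < dl / 2.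
  rewrite -[ltRHS]invrK ltf_pV2 ?posrE ?invr_gt0// invf_div.
  by apply: lt_le_trans (truncnS_gt _) _; rewrite ler_nat ltnS.
move: nd h1 h2; move: (n.+1%:R^-1) => q nd h1 h2.
have k1 : `|g (zz n).1 - g z0| < e / 2 by apply: hdl; lra.
have k2 : `|g (zz n).2 - g z0| < e / 2.
  apply: hdl.
    rewrite -(subrKA (Re (zz n).1)); apply: le_lt_trans (ler_normD _ _) _; lra.
  rewrite -(subrKA (Im (zz n).1)); apply: le_lt_trans (ler_normD _ _) _; lra.
move: h3; rewrite -(subrKA (g z0)) => h3.
have := lt_le_trans h3 (ler_normD _ _); rewrite (distrC (g z0)); lra.
Qed.

(** A trapezoid: 1 on [-m, m], 0 outside [-(m+1), m+1], with slopes 1 and -1 between. *)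
Definition cutoff1 (m : nat) (x : R) : R := Num.max 0 (Num.min 1 (m.+1%:R - `|x|)).

Lemma cutoff1_01 m x : 0 <= cutoff1 m x <= 1.
Proof. by rewrite /cutoff1 le_max lexx/= ge_max ler01/= ge_min lexx. Qed.

Lemma cutoff1_lip m x y : `|cutoff1 m x - cutoff1 m y| <= `|x - y|.
Proof.
have P (t : R) : [\/ (t <= 0 /\ Num.max 0 (Num.min 1 t) = 0),
    ((0 <= t /\ t <= 1) /\ Num.max 0 (Num.min 1 t) = t) |
    (1 <= t /\ Num.max 0 (Num.min 1 t) = 1)].
  have [t0|t0] := leP t 0.
    by apply: Or31; rewrite min_r ?max_l//; lra.
  have [t1|t1] := leP t 1.
    by apply: Or32; rewrite max_r// ltW.
  by apply: Or33; rewrite max_r// ltW.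
rewrite /cutoff1; have := lerB_dist x y; have := lerB_dist y x.
rewrite (distrC y x); move: `|x - y| `|x| `|y| => a b c.
have := P (m.+1%:R - b); have := P (m.+1%:R - c).
by case=> -[? ->]; case=> -[? ->] ? ?; rewrite ler_norml; lra.
Qed.

Lemma cutoff1_1 m x : `|x| <= m%:R -> cutoff1 m x = 1.
Proof.
move=> xm; rewrite /cutoff1 min_l ?max_r//; last by rewrite -natr1; lra.
Qed.

Lemma cutoff1_0 m x : m.+1%:R < `|x| -> cutoff1 m x = 0.
Proof.
move=> xm; rewrite /cutoff1 max_l// ge_min; apply/orP; right; lra.
Qed.

Definition cutoff m (z : R[i]) := cutoff1 m (Re z) * cutoff1 m (Im z).

Lemma cutoff_01 m z : 0 <= cutoff m z <= 1.
Proof.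
have /andP[? ?] := cutoff1_01 m (Re z); have /andP[? ?] := cutoff1_01 m (Im z).
by rewrite /cutoff mulr_ge0//= mulr_ile1.
Qed.

Lemma continuous_cutoff m : continuous (cutoff m).
Proof.
move=> z; apply/cvg_complexP => e e0; exists (e / 2); first lra.
move=> z' h1 h2; rewrite /cutoff.
have := le_lt_trans (cutoff1_lip m (Re z') (Re z)) h1.
have := le_lt_trans (cutoff1_lip m (Im z') (Im z)) h2.
have := cutoff1_01 m (Re z'); have := cutoff1_01 m (Im z).
move: (cutoff1 m (Re z')) (cutoff1 m (Re z)) (cutoff1 m (Im z')) (cutoff1 m (Im z)).
move=> a a' b' b /andP[? ?] /andP[? ?] k1 k2.
rewrite (_ : a * b' - a' * b = a * (b' - b) + (a - a') * b); last by ring.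
apply: le_lt_trans (ler_normD _ _) _; rewrite !normrM (ger0_norm (x := a))// (ger0_norm (x := b))//.
have := normr_ge0 (b' - b); have := normr_ge0 (a - a'); nra.
Qed.

Lemma cutoff_0 m z : m.+1%:R < `|Re z| \/ m.+1%:R < `|Im z| -> cutoff m z = 0.
Proof. by rewrite /cutoff => -[h|h]; rewrite (cutoff1_0 h) ?mul0r ?mulr0. Qed.

Lemma cvg_cutoff z : cutoff m z @[m --> \oo] --> (1 : R).
Proof.
apply: cvg_near_cst; near=> m.
rewrite /cutoff !cutoff1_1 ?mulr1//; near: m.
  exists (Num.truncn `|Im z|).+1 => // m /= hm.
  by apply: le_trans (ltW (truncnS_gt _)) _; rewrite ler_nat.
exists (Num.truncn `|Re z|).+1 => // m /= hm.
by apply: le_trans (ltW (truncnS_gt _)) _; rewrite ler_nat.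
Unshelve. all: by end_near.
Qed.

Lemma measurable_cutoff m : measurable_fun setT (cutoff m).
Proof. exact: (continuousC_measurable (@continuous_cutoff m)). Qed.

Lemma cutoff_le1 m z : `|cutoff m z| <= 1.
Proof. by have /andP[? ?] := cutoff_01 m z; rewrite ger0_norm. Qed.

End compactly_supported.

Section weak_convergence.
Context {R : realType}.
Variables (mu : nat -> probability R[i] R) (nu : probability R[i] R).

(** Vague convergence to a limit of total mass 1 is weak convergence: no mass can escape, because
    the cutoffs are themselves admissible test functions. *)
Lemma weak_conv_bounded :
  (forall (g : R[i] -> R) (M A : R), continuous g -> (forall z, `|g z| <= M) ->
     (forall z, A < `|Re z| \/ A < `|Im z| -> g z = 0) -> weak_conv mu nu g) ->
  forall (g : R[i] -> R) (M : R), continuous g -> (forall z, `|g z| <= M) ->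
    weak_conv mu nu g.
Proof.
move=> H g M cg gM; have M0 : 0 <= M by exact: le_trans (normr_ge0 _) (gM 0).
have mg := continuousC_measurable cg.
have cC m : continuous (fun z => g z * cutoff m z).
  move=> z; exact: (@cvgM _ _ (nbhs z) (@nbhs_filter _ z) g (cutoff m) (g z) (cutoff m z) (cg z) (@continuous_cutoff _ m z)).
have mC m := continuousC_measurable (cC m).
have C1 m z : `|g z * cutoff m z| <= M.
  rewrite normrM -[leRHS]mulr1 ler_pM// cutoff_le1//.
have diff (pr : probability R[i] R) m : `|(\int[pr]_z g z)%R - (\int[pr]_z (g z * cutoff m z))%R|
     <= M * (1 - \int[pr]_z cutoff m z)%R.
  have i1 := bounded_integrable pr mg gM.
  have i2 := bounded_integrable pr (mC m) (C1 m).
  have i3 := bounded_integrable pr (measurable_cutoff m) (cutoff_le1 m).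
  have i4 : pr.-integrable setT (EFin \o (fun=> 1 : R)).
    by apply: (bounded_integrable _ (M := 1)) => // x; rewrite normr1.
  rewrite -RintegralB//; have iB := integrableB measurableT i1 i2.
  apply: (le_trans (le_normr_Rintegral measurableT iB)).
  rewrite -{1}(Rintegral_cst_prob pr 1) -RintegralB//.
  have iB' := integrableB measurableT i4 i3.
  rewrite -RintegralZl//.
  apply: (le_Rintegral measurableT (integrable_norm iB) (integrableZl measurableT _ iB')) => z _ /=.
  rewrite -{1}(mulr1 (g z)) -mulrBr normrM; apply: ler_pM => //.
  by have /andP[? ?] := cutoff_01 m z; rewrite ger0_norm// subr_ge0.
apply: cvg_uniform_limit => e e0.
have hc : (\int[nu]_z cutoff m z)%R @[m --> \oo] --> (1 : R).
  rewrite -[X in _ --> X](Rintegral_cst_prob nu 1).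
  apply: (bounded_cvg_Rintegral (M := 1)) => //.
  - by move=> m; exact: measurable_cutoff.
  - exact: cutoff_le1.
  - by apply: aeW => z; exact: cvg_cutoff.
pose e' := e / (2 * (M + 1)).
have e'0 : 0 < e' by rewrite divr_gt0//; lra.
have [m hm] : exists m, 1 - (\int[nu]_z cutoff m z)%R <= e'.
  have /cvgrPdist_le/(_ _ e'0)[m _ hm] := hc.
  exists m; apply: le_trans (hm m _) => //=; exact: ler_norm.
have Me' : M * (2 * e') <= e.
  rewrite /e' (_ : M * _ = e * (M / (M + 1))); last by field; rewrite gt_eqF//; lra.
  by rewrite ler_piMr// ?ltW// ltr_pdivrMr; lra.
exists (fun n => \int[mu n]_z (g z * cutoff m z))%R, (\int[nu]_z (g z * cutoff m z))%R; split.
(* Convergence of the integrals of the cutoff transfers the tightness of [nu] to [mu n] for large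
   [n]. *)
- have /cvgrPdist_le/(_ _ e'0) hn : weak_conv mu nu (cutoff m).
    apply: (H _ 1 m.+1%:R) => //; [exact: continuous_cutoff|exact: cutoff_le1|exact: cutoff_0].
  near=> n; apply: le_trans (diff _ _) _; apply: le_trans Me'; apply: ler_wpM2l => //.
  have : `|(\int[nu]_z cutoff m z)%R - (\int[mu n]_z cutoff m z)%R| <= e' by near: n.
  by rewrite ler_norml => /andP[? ?]; lra.
- apply: le_trans (diff _ _) _; apply: le_trans Me'; apply: ler_wpM2l => //; lra.
- apply: (H _ M m.+1%:R) => // z hz; by rewrite cutoff_0// mulr0.
Unshelve. all: by end_near.
Qed.

Theorem levy_continuity :
  (forall s t th : R, weak_conv mu nu (fun z => cos (s * Re z + t * Im z + th))) ->
  forall (g : R[i] -> R) (M : R), continuous g -> (forall z, `|g z| <= M) ->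
    weak_conv mu nu g.
Proof.
move=> H; apply: weak_conv_bounded => g M A cg gM gA.
apply: (weak_conv_Cc H (continuousC_measurable cg) gM _ gA).
exact: (compactly_supported_unif_cont cg gA).
Qed.

End weak_convergence.

(** * Measurability of the unique critical point event *)

Section zeros_in_disk.
Context {R : realType}.

Definition rational_point (q : rat * rat) : R[i] := ratr q.1 +i* ratr q.2.

Lemma rational_point_dense (y : R[i]) (e : R) : 0 < e -> exists q, normc (rational_point q - y) < e.
Proof.
move=> e0; have e2 : 0 < e / 2 by rewrite divr_gt0.
have ratb (v : R) : exists a : rat, `|ratr a - v| < e / 2.
  have /rat_in_itvoo[a] : v - e / 2 < v + e / 2 by lra.
  by rewrite in_itv/= => aI; exists a; rewrite distrC ltr_distlC.
have [[a ha] [b hb]] := (ratb (Re y), ratb (Im y)); exists (a, b).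
by apply: le_lt_trans (normc_le_ReIm _) _; rewrite ReB ImB /=; lra.
Qed.

Lemma rational_point_dense_disk (y : R[i]) (e : R) : normc y <= 1 -> 0 < e ->
  exists2 q, normc (rational_point q) <= 1 & normc (rational_point q - y) < e.
Proof.
(* The point [y] is first shrunk by the factor 1 - s, so that a rational point at distance less than
   s remains in the disk; shrinking and approximating cost s each. *)
move=> y1 e0; pose s := Num.min (1 / 2) (e / 2).
have s0 : 0 < s by rewrite lt_min !divr_gt0.
have s1 : s <= 1 / 2 by rewrite ge_min lexx.
have se : s <= e / 2 by rewrite ge_min lexx orbT.
have [q hq] := rational_point_dense ((1 - s)%:C * y) s0.
have n1 : normc ((1 - s)%:C : R[i]) = 1 - s by rewrite /= expr0n/= addr0 sqrtr_sqr ger0_norm//; lra.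
have n2 : normc (s%:C : R[i]) = s by rewrite /= expr0n/= addr0 sqrtr_sqr ger0_norm// ltW.
have t1 := normc_triangle (rational_point q - (1 - s)%:C * y) ((1 - s)%:C * y).
have t2 := normc_split (rational_point q) ((1 - s)%:C * y) y.
have e1 : normc ((1 - s)%:C * y) <= 1 - s.
  by rewrite Normc.normcM n1 -[leRHS]mulr1; apply: ler_wpM2l => //; lra.
have e2 : normc ((1 - s)%:C * y - y) <= s.
  have -> : (1 - s)%:C * y - y = - (s%:C * y) by rewrite rmorphB/= rmorph1; ring.
  by rewrite normc_opp Normc.normcM n2 -[leRHS]mulr1; apply: ler_wpM2l => //; exact: ltW.
exists q; last by lra.
by move: t1; rewrite subrK; lra.
Qed.

Section lipschitz_zeros.
Variables (phi : R[i] -> R) (K : R).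
Hypothesis phi0 : forall y, 0 <= phi y.
Hypothesis phiK : forall y y', normc y <= 1 -> normc y' <= 1 ->
  phi y <= phi y' + K * normc (y - y').

(** Compactness of the disk turns the uncountable existential into countable operations over
    rational points, which is what measurability requires. *)
Lemma exists_zero_disk : (exists2 y, normc y <= 1 & phi y = 0) <->
  forall m : nat, exists2 q, normc (rational_point q) <= 1 & phi (rational_point q) < m.+1%:R^-1.
Proof.
have K0 : 0 <= K.
  have := phiK (y := 1) (y' := 0); have := phiK (y := 0) (y' := 1).
  rewrite subr0 sub0r normc_opp Normc.normc1 Normc.normc0 lexx ler01 => /(_ isT isT) h1 /(_ isT isT) h2; lra.
have K1 : 0 < K + 1 by lra.
split=> [[y y1 py] m|H].
  have m0 : 0 < (m.+1%:R : R)^-1 / (K + 1) by rewrite divr_gt0.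
  have [q q1 hq] := rational_point_dense_disk y1 m0; exists q => //.
  move: hq; rewrite ltr_pdivlMr// => hq.
  apply: le_lt_trans (phiK q1 y1) _; rewrite py add0r.
  by apply: le_lt_trans hq; rewrite mulrC ler_wpM2l ?normc_ge0//; lra.
have /choice[q hq] : forall m : nat, exists q, normc (rational_point q) <= 1 /\ phi (rational_point q) < m.+1%:R^-1.
  by move=> m; have [q ? ?] := H m; exists q.
have bd m : normc (rational_point (q m)) <= 1 by have [] := hq m.
have [y [_ _ hy]] := box_cluster (fun j => le_trans (normc_Re _) (bd j)) (fun j => le_trans (normc_Im _) (bd j)).
have close (e : R) N : 0 < e -> exists2 j, (N <= j)%N & normc (rational_point (q j) - y) <= e.
  move=> e0; have e2 : 0 < e / 2 by rewrite divr_gt0.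
  have [j [Nj h1 h2]] := hy _ N e2; exists j => //.
  by apply: le_trans (normc_le_ReIm _) _; rewrite ReB ImB; lra.
have y1 : normc y <= 1.
  apply/ler_addgt0Pr => e e0; have [j _ hj] := close e 0%N e0.
  have := normc_triangle (y - rational_point (q j)) (rational_point (q j)); rewrite subrK normc_distC.
  by have := bd j; lra.
exists y => //; apply/eqP; rewrite eq_le phi0 andbT; apply/ler_addgt0Pr => e e0.
have e2 : 0 < e / 2 by rewrite divr_gt0.
have [N _ hN] : \forall N \near \oo, (N.+1%:R : R)^-1 <= e / 2.
  near=> N; rewrite invf_ple ?posrE//.
  have : (e / 2)^-1 <= N%:R by near: N; exact: nbhs_infty_ger.
  by move=> h; apply: le_trans h _; rewrite ler_nat.
have eK : 0 < e / 2 / (K + 1) by rewrite divr_gt0.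
have [j Nj hj] := close _ N eK.
have hqj : phi (rational_point (q j)) < j.+1%:R^-1 by have [] := hq j.
have hNj : (j.+1%:R : R)^-1 <= e / 2 := hN j Nj.
have pj := phiK y1 (bd j); move: hj; rewrite ler_pdivlMr// => hj.
rewrite normc_distC in pj.
have n0 := normc_ge0 (rational_point (q j) - y).
move: hqj hNj pj hj n0; move: (_^-1) => ii; move: (normc _) (phi (rational_point _)) => a b h1 h2 h3 h4 h5.
rewrite add0r; nra.
Unshelve. all: by end_near.
Qed.

End lipschitz_zeros.

Lemma measurable_exists_zero_disk d (T : measurableType d) (phi : T -> R[i] -> R) (K : T -> R) :
  (forall w y, 0 <= phi w y) ->
  (forall w y y', normc y <= 1 -> normc y' <= 1 -> phi w y <= phi w y' + K w * normc (y - y')) ->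
  (forall y, measurable_fun setT (fun w => phi w y)) ->
  measurable [set w | exists2 y, normc y <= 1 & phi w y = 0].
Proof.
move=> phi0 phiK mphi.
rewrite (_ : [set w | _] = \bigcap_m \bigcup_(q in [set q | normc (rational_point q) <= 1])
    [set w | phi w (rational_point q) < m.+1%:R^-1]); last first.
  apply/seteqP; split=> w /=.
    move/(exists_zero_disk (phi0 w) (phiK w)) => H m _; have [q q1 hq] := H m; by exists q.
  move=> H; apply/(exists_zero_disk (phi0 w) (phiK w)) => m.
  by have [q q1 hq] := H m I; exists q.
apply: bigcapT_measurable => m; rewrite bigcup_mkcond.
apply: countable_bigcupT_measurable => // q; case: ifP => // _.
rewrite -[X in measurable X]setTI.
exact: (measurable_fun_ltr (mphi _) (@measurable_cst _ _ _ _ setT _) measurableT (Y := [set true])).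
Qed.

Lemma poly_lipschitz (p : {poly R[i]}) (A : R) : 0 <= A -> exists2 K : R, 0 <= K &
  forall z z', normc z <= A -> normc z' <= A -> normc (p.[z] - p.[z']) <= K * normc (z - z').
Proof.
move=> A0; elim/poly_ind: p => [|p c [K K0 hK]].
  by exists 0 => // z z' _ _; rewrite !horner0 subrr Normc.normc0 mul0r.
exists (K * A + (normc p.[0] + K * A)).
  by rewrite !addr_ge0 ?mulr_ge0 ?normc_ge0.
move=> z z' hz hz'; rewrite !hornerMXaddC.
have -> : p.[z] * z + c - (p.[z'] * z' + c) = (p.[z] - p.[z']) * z + p.[z'] * (z - z') by ring.
apply: le_trans (normc_triangle _ _) _; rewrite !Normc.normcM [leRHS]mulrDl; apply: lerD.
  rewrite mulrAC; apply: ler_pM; rewrite ?normc_ge0//; exact: hK.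
apply: ler_wpM2r; first exact: normc_ge0.
have h0 : normc (0 : R[i]) <= A by rewrite Normc.normc0.
have := hK z' 0 hz' h0; rewrite subr0 => h.
have := normc_triangle (p.[z'] - p.[0]) p.[0]; rewrite subrK => h'.
have : K * normc z' <= K * A by exact: ler_wpM2l.
by lra.
Qed.

End zeros_in_disk.

Section critical_event.
Context {d : measure_display} {T : measurableType d} {R : realType}.
Variables (xi : nat -> T -> R[i]) (n : nat) (r : R).
Hypotheses (mxi : forall k, measurable_fun setT (xi k)) (r0 : 0 < r).

(** In the variable [y] the random disk becomes the fixed unit disk, whose rational points do not
    depend on [w]. *)
Let Q' (w : T) (y : R[i]) : R := normc (random_poly xi n w)^`().[xi 0%N w + r%:C * y].

Let mQ' y : measurable_fun setT (fun w => Q' w y).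
Proof.
apply: measurable_normc.
have mF : measurable_fun setT (fun w => xi 0%N w + r%:C * y) by apply: measurable_funCD.
rewrite /random_poly; set F := fun w => _ in mF.
suff H (s : seq 'I_n.+1) :
    measurable_fun setT (fun w => (\prod_(k <- s) ('X - (xi k w)%:P)).[F w]) /\
    measurable_fun setT (fun w => (\prod_(k <- s) ('X - (xi k w)%:P))^`().[F w]).
  by have [_] := H (index_enum _).
elim: s => [|k s [ih1 ih2]].
  by split; under eq_fun do rewrite big_nil ?derivC hornerC//; exact: measurable_cst.
split; under eq_fun do rewrite big_cons ?derivM ?derivXsubC ?mul1r ?hornerD !hornerM ?hornerXsubC.
  by apply: measurable_funCM => //; exact: measurable_funCB.
by apply: measurable_funCD => //; apply: measurable_funCM => //; exact: measurable_funCB.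
Qed.

Let Q'0 w y : 0 <= Q' w y. Proof. exact: normc_ge0. Qed.

Let Q'K w : exists2 K : R, 0 <= K & forall y y', normc y <= 1 -> normc y' <= 1 ->
  Q' w y <= Q' w y' + K * normc (y - y').
Proof.
have rn : normc (r%:C : R[i]) = r by rewrite /= expr0n/= addr0 sqrtr_sqr gtr0_norm.
have A0 : 0 <= normc (xi 0%N w) + r by rewrite addr_ge0 ?normc_ge0// ltW.
have [K K0 hK] := poly_lipschitz (random_poly xi n w)^`() A0.
exists (K * r); first by rewrite mulr_ge0// ltW.
have bd y : normc y <= 1 -> normc (xi 0%N w + r%:C * y) <= normc (xi 0%N w) + r.
  move=> y1; apply: le_trans (normc_triangle _ _) _; rewrite lerD2l Normc.normcM rn.
  by rewrite ler_piMr// ltW.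
move=> y y' y1 y'1; have := hK _ _ (bd _ y1) (bd _ y'1).
have -> : xi 0%N w + r%:C * y - (xi 0%N w + r%:C * y') = r%:C * (y - y') by ring.
rewrite Normc.normcM rn mulrA; rewrite /Q'; set a := _.[_]; set b := _.[_] => h.
have := normc_triangle (a - b) b; rewrite subrK; lra.
Qed.

(** Uniqueness is existence of a zero minus existence of two distinct zeros. Both are expressed
    through zeros of nonnegative Lipschitz functions on the unit disk, a constraint on the position
    being encoded as a penalty that vanishes exactly where it holds. *)
Lemma measurable_unique_critical_point :
  measurable [set w | exists! z, critical_point_in_disk (random_poly xi n w) (xi 0%N w) r z].
Proof.
have /choice[K hK] : forall w, exists K : R, 0 <= K /\ forall y y', normc y <= 1 -> normc y' <= 1 ->
    Q' w y <= Q' w y' + K * normc (y - y').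
  by move=> w; have [K ? ?] := Q'K w; exists K.
have K0 w : 0 <= K w by have [] := hK w.
have KL w y y' : normc y <= 1 -> normc y' <= 1 -> Q' w y <= Q' w y' + K w * normc (y - y').
  by have [_] := hK w; apply.
have rn : normc (r%:C : R[i]) = r by rewrite /= expr0n/= addr0 sqrtr_sqr gtr0_norm.
have rC : (r%:C : R[i]) != 0 by rewrite -normc_gt0 rn.
have critE w z : critical_point_in_disk (random_poly xi n w) (xi 0%N w) r z <->
    exists2 y, normc y <= 1 & Q' w y = 0 /\ z = xi 0%N w + r%:C * y.
  rewrite /critical_point_in_disk /= normcE lecR; split=> [[h /eqP hz]|[y y1 [hy ->]]].
    have zE : xi 0%N w + r%:C * ((z - xi 0%N w) / r%:C) = z by rewrite mulrC divfK// subrKC.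
    exists ((z - xi 0%N w) / r%:C); last by rewrite /Q' zE hz Normc.normc0.
    have := h; rewrite -{1}[z - _](divfK rC) Normc.normcM rn -[X in _ <= X]mul1r ler_pM2r//.
  split; first by rewrite addrAC subrr add0r Normc.normcM rn ler_piMr// ltW.
  by apply/eqP/eqP; rewrite -normc_eq0; apply/eqP.
(* Two distinct zeros are separated by a rational ball: one is within
   [1/(m+1)] of a rational point [c], the other at least [2/(m+1)] away. *)
pose near_zero (c : rat * rat) (m : nat) w y : R :=
  Q' w y + Num.max 0 (normc (y - rational_point c) - m.+1%:R^-1).
pose far_zero (c : rat * rat) (m : nat) w y : R :=
  Q' w y + Num.max 0 (2 * m.+1%:R^-1 - normc (y - rational_point c)).
pose A := [set w | exists2 y, normc y <= 1 & Q' w y = 0].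
pose B c m := [set w | exists2 y, normc y <= 1 & near_zero c m w y = 0] `&`
              [set w | exists2 y, normc y <= 1 & far_zero c m w y = 0].
have max0 (a : R) : 0 <= Num.max 0 a by rewrite le_max lexx.
have maxL (a b q : R) : 0 <= q -> a <= b + q -> Num.max 0 a <= Num.max 0 b + q.
  move=> q0 h; rewrite ge_max addr_ge0//=; apply: le_trans h _.
  by rewrite lerD2r le_max lexx orbT.
have mA : measurable A by exact: (measurable_exists_zero_disk Q'0 KL mQ').
have mdist c y : measurable_fun [set: T] (fun w : T => normc (y - rational_point c)) by exact: measurable_cst.
have mB c m : measurable (B c m).
  apply: measurableI.
    apply: (@measurable_exists_zero_disk _ _ _ _ (fun w => K w + 1)) => [w y|w y y' y1 y'1|y].
    - by rewrite addr_ge0.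
    - have t := normc_split y y' (rational_point c).
      have h1 := KL w _ _ y1 y'1.
      have h2 := maxL (normc (y - rational_point c) - m.+1%:R^-1) (normc (y' - rational_point c) - m.+1%:R^-1) (normc (y - y')) (normc_ge0 _).
      have : Num.max 0 (normc (y - rational_point c) - m.+1%:R^-1) <= Num.max 0 (normc (y' - rational_point c) - m.+1%:R^-1) + normc (y - y').
        by apply: h2; move: t; move: (normc _) (normc _) (normc _) (_^-1) => a b e i; lra.
      by rewrite /near_zero mulrDl mul1r; move: h1; lra.
    - by apply: measurable_funD => //; exact: measurable_cst.
  apply: (@measurable_exists_zero_disk _ _ _ _ (fun w => K w + 1)) => [w y|w y y' y1 y'1|y].
  - by rewrite addr_ge0.
  - have t := normc_split y' y (rational_point c).
    have h1 := KL w _ _ y1 y'1.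
    have h2 := maxL (2 * m.+1%:R^-1 - normc (y - rational_point c)) (2 * m.+1%:R^-1 - normc (y' - rational_point c)) (normc (y - y')) (normc_ge0 _).
    have : Num.max 0 (2 * m.+1%:R^-1 - normc (y - rational_point c)) <= Num.max 0 (2 * m.+1%:R^-1 - normc (y' - rational_point c)) + normc (y - y').
      by apply: h2; move: t; rewrite [normc (y' - y)]normc_distC; move: (normc _) (normc _) (normc _) (_^-1) => a b e i; lra.
    by rewrite /far_zero mulrDl mul1r; move: h1; lra.
  - by apply: measurable_funD => //; exact: measurable_cst.
have sum0 (a b : R) : 0 <= a -> a + Num.max 0 b = 0 -> a = 0 /\ b <= 0.
  move=> a0 h; have b0 := max0 b; have [E1 E2] : a = 0 /\ Num.max 0 b = 0 by split; lra.
  by split=> //; rewrite -E2 le_max lexx orbT.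
rewrite (_ : [set w | _] = A `\` \bigcup_(q in [set: (rat * rat) * nat]) B q.1 q.2).
  apply: measurableD => //; exact: countable_bigcupT_measurable.
apply/seteqP; split=> w /=.
  move=> [z [/critE[y y1 [hy ->]] uz]]; split; first by exists y.
  move=> [[c m] _ /=] [[a a1 ha] [b b1 hb]].
  have [a0 a2] := sum0 _ _ (Q'0 w a) ha; have [b0 b2] := sum0 _ _ (Q'0 w b) hb.
  have ya : xi 0%N w + r%:C * y = xi 0%N w + r%:C * a by apply: uz; apply/critE; exists a.
  have yb : xi 0%N w + r%:C * y = xi 0%N w + r%:C * b by apply: uz; apply/critE; exists b.
  have ab : a = b by apply: (mulfI rC); apply: (addrI (xi 0%N w)); rewrite -ya.
  move: a2 b2; rewrite ab; have : 0 < (m.+1%:R : R)^-1 by rewrite invr_gt0.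
  by move: (_^-1) (normc _) => i q; lra.
move=> [[y y1 hy] nB]; exists (xi 0%N w + r%:C * y); split; first by apply/critE; exists y.
move=> z /critE[y' y'1 [hy' ->]]; have [->//|yy'] := eqVneq y' y; exfalso; apply: nB.
have d0 : 0 < normc (y - y') by rewrite normc_gt0 subr_eq0 eq_sym.
have d3 : 0 < normc (y - y') / 3 by rewrite divr_gt0.
have [m] := ltr_add_invr d3; rewrite add0r => hm.
have i0 : 0 < (m.+1%:R : R)^-1 by rewrite invr_gt0.
have [c hc] := rational_point_dense y i0.
exists (c, m) => //; split=> /=.
  exists y => //; rewrite /near_zero hy add0r max_l//.
  by rewrite normc_distC subr_le0 ltW.
exists y' => //; rewrite /far_zero hy' add0r max_l//.
have := normc_split y (rational_point c) y'; rewrite [normc (y - rational_point c)]normc_distC [normc (rational_point c - y')]normc_distC.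
by move: hm hc; move: (_^-1) (normc _) (normc _) (normc _) => i a b e; lra.
Qed.

End critical_event.

(** * Central limit theorem for quadratic tails *)

Section tail_moments.
Context {d} {T : measurableType d} {R : realType} (P : probability T R).
Variables (M : T -> R) (C : R).
Hypotheses (mM : measurable_fun setT M) (M0 : forall w, 0 <= M w).
Hypothesis tail : forall rho : R, 0 < rho -> (P [set w | (M w <= rho)%R] <= (C * rho ^+ 2)%:E)%E.

Lemma measurable_bool_R (b : T -> bool) : measurable_fun setT b ->
  measurable_fun setT (fun w => (b w)%:R : R).
Proof.
move=> mb; rewrite (_ : (fun _ => _) = \1_(b @^-1` [set true])).
  by apply: measurable_indic; rewrite -[X in measurable X]setTI; exact: mb.
apply/funext => w; rewrite indicE (_ : (w \in b @^-1` [set true]) = b w)//.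
by apply/idP/idP => [/set_mem//|bw]; exact/mem_set.
Qed.

Lemma measurable_le_cst (rho : R) : measurable_fun setT (fun w => (M w <= rho)%R%:R : R).
Proof. by apply: measurable_bool_R; exact: measurable_fun_ler. Qed.

Lemma measurable_gt_cst (rho : R) : measurable_fun setT (fun w => (rho < M w)%R%:R : R).
Proof. by apply: measurable_bool_R; exact: measurable_fun_ltr. Qed.

Lemma bool_R_le1 (b : bool) : `|b%:R : R| <= 1.
Proof. by case: b; rewrite ?normr1 ?normr0. Qed.

Lemma Rintegral_le_cst (rho : R) : 0 < rho -> (\int[P]_w (M w <= rho)%R%:R)%R <= C * rho ^+ 2.
Proof.
move=> rho0; rewrite -lee_fin; apply: le_trans (tail rho0).
have mB : measurable [set w | M w <= rho].
  rewrite -[X in measurable X]setTI; apply: (measurable_fun_ler mM (@measurable_cst _ _ _ _ setT rho) measurableT (Y := [set true])) => //.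
rewrite EFin_Rintegral; last first.
  by apply: (bounded_integrable _ (M := 1)); [exact: measurable_le_cst|move=> w; exact: bool_R_le1].
have -> : P [set w | (M w <= rho)%R] = (\int[P]_w (\1_[set w | (M w <= rho)%R] w)%:E)%E.
  by rewrite integral_indic// setIT.
apply: ge0_le_integral => //.
- by apply/measurable_EFinP; exact: measurable_le_cst.
- by apply/measurable_EFinP; exact: measurable_indic.
- move=> w _; rewrite lee_fin indicE; case: (boolP (M w <= rho)) => h; last by rewrite ler0n.
  by rewrite mem_set.
Qed.

Lemma tailC_ge0 : 0 <= C.
Proof.
have := tail ltr01; rewrite expr1n mulr1 -lee_fin; exact: le_trans.
Qed.

(** Dyadic recursion: on rho < M <= 2 rho the integrand is at most rho^-3 and the mass at most 4 C
    rho^2, which adds 4 C / rho. The geometric series sums to 8 C / rho. *)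
Lemma third_moment (rho : R) : 0 < rho ->
  (\int[P]_w ((M w)^-1 ^+ 3 * (rho < M w)%R%:R))%R <= 8 * C / rho.
Proof.
have C0 := tailC_ge0.
pose e rho := (\int[P]_w ((M w)^-1 ^+ 3 * (rho < M w)%R%:R))%R.
have mf rho' : measurable_fun setT (fun w => (M w)^-1 ^+ 3 * (rho' < M w)%R%:R).
  by apply: measurable_funM; [apply: measurable_funX; exact: measurable_funinv|exact: measurable_gt_cst].
have b rho' w : 0 < rho' -> `|(M w)^-1 ^+ 3 * (rho' < M w)%R%:R| <= rho'^-1 ^+ 3.
  move=> r0; rewrite ger0_norm; last by rewrite mulr_ge0// exprn_ge0// invr_ge0.
  case: (boolP (rho' < M w)) => h; last by rewrite mulr0 exprn_ge0// invr_ge0 ltW.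
  have Mw := lt_trans r0 h.
  by rewrite mulr1 lerXn2r ?nnegrE ?invr_ge0 ?(ltW r0)// lef_pV2 ?posrE// ltW.
(* Each doubling of the threshold divides the crude bound by 8 and reproduces the second term
   exactly; the crude part then disappears as [j] grows. *)
have step j : forall rho', 0 < rho' -> e rho' <= rho'^-1 ^+ 3 / 8 ^+ j + 8 * C / rho'.
  elim: j => [|j ih] r r0.
    rewrite expr0 divr1; apply: (@le_trans _ _ (r^-1 ^+ 3)).
      apply: le_trans (ler_norm _) _.
      apply: Rintegral_bound => // w; exact: b.
    by rewrite lerDl divr_ge0 ?mulr_ge0// ltW.
  have r20 : 0 < 2 * r by rewrite mulr_gt0.
  have h : e r <= e (2 * r) + r^-1 ^+ 3 * (C * (2 * r) ^+ 2).
    have i1 := bounded_integrable P (mf r) (fun w => b r w r0).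
    have i2 := bounded_integrable P (mf (2 * r)) (fun w => b (2 * r) w r20).
    have i3 : P.-integrable setT (EFin \o (fun w => (M w <= 2 * r)%R%:R : R)).
      by apply: (bounded_integrable _ (M := 1)); [exact: measurable_le_cst|move=> w; exact: bool_R_le1].
    apply: (@le_trans _ _ (e (2 * r) + r^-1 ^+ 3 * (\int[P]_w (M w <= 2 * r)%R%:R)%R)); last first.
      by rewrite lerD2l ler_wpM2l ?exprn_ge0 ?invr_ge0 ?(ltW r0)//; exact: Rintegral_le_cst.
    have i4 := integrableZl measurableT (r^-1 ^+ 3) i3.
    rewrite -(RintegralZl _ measurableT i3) -RintegralD//.
    apply: (le_Rintegral measurableT i1 (integrableD measurableT i2 i4)) => w _.
    rewrite ltNge; case: (leP (M w) (2 * r)) => h1 /=; last first.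
      rewrite [M w <= r]leNgt (_ : r < M w) ?mulr1 ?lerDl//; last by apply: le_lt_trans h1; lra.
      by rewrite mulr0.
    rewrite mulr0 add0r mulr1; case: (leP (M w) r) => h2; first by rewrite mulr0 exprn_ge0// invr_ge0 ltW.
    by rewrite mulr1 lerXn2r ?nnegrE ?invr_ge0 ?(ltW r0)// lef_pV2 ?posrE ?ltW// (lt_trans r0).
  apply: le_trans h _; apply: le_trans (lerD (ih _ r20) (lexx _)) _.
  rewrite le_eqVlt; apply/orP; left; apply/eqP.
  by rewrite [8 ^+ j.+1]exprS; field; rewrite expf_neq0 ?gt_eqF.
move=> r0; rewrite -/(e rho).
have cv : rho^-1 ^+ 3 / 8 ^+ j + 8 * C / rho @[j --> \oo] --> 0 + 8 * C / rho.
  apply: cvgD; last exact: cvg_cst.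
  rewrite -[X in _ --> X](mulr0 (rho^-1 ^+ 3)); apply: cvgMr.
  under eq_fun do rewrite -exprVn; apply: cvg_expr.
  by rewrite ger0_norm ?invr_ge0// invf_lt1// ltr1n.
rewrite add0r in cv; rewrite -(cvg_lim _ cv)//.
apply: limr_ge; first by apply/cvg_ex; eexists; exact: cv.
by apply: nearW => j; exact: step.
Qed.

(** The same dyadic decomposition towards 0: the shell rho/2 < M <= rho adds at most (2 / rho) C
    rho^2 = 2 C rho. The lower cut keeps every integrand bounded until monotone convergence removes
    it. *)
Lemma first_moment_trunc (j : nat) : forall rho : R, 0 < rho ->
  (\int[P]_w ((M w)^-1 * ((rho / 2 ^+ j < M w) && (M w <= rho))%R%:R))%R <= 4 * C * rho.
Proof.
have C0 := tailC_ge0.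
have mf rho' r' : measurable_fun setT (fun w => (M w)^-1 * ((rho' < M w) && (M w <= r'))%R%:R).
  apply: measurable_funM; first exact: measurable_funinv.
  apply: measurable_bool_R; apply: measurable_and; [exact: measurable_fun_ltr|exact: measurable_fun_ler].
have b rho' r' w : 0 < rho' -> `|(M w)^-1 * ((rho' < M w) && (M w <= r'))%R%:R| <= rho'^-1.
  move=> r0; rewrite ger0_norm; last by rewrite mulr_ge0// invr_ge0.
  case: (boolP (rho' < M w)) => h; last by rewrite mulr0 invr_ge0 ltW.
  apply: (@le_trans _ _ (M w)^-1) => /=; first by rewrite ler_piMr ?invr_ge0// lern1 leq_b1.
  by rewrite lef_pV2 ?posrE ?ltW// (lt_trans r0).
elim: j => [|j ih] r r0.
  under eq_Rintegral => w _ do rewrite expr0 divr1 ltNge andNb mulr0.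
  by rewrite /Rintegral integral0/= mulr_ge0 ?mulr_ge0// ltW.
have r20 : 0 < r / 2 by rewrite divr_gt0.
have rj k : 0 < r / 2 ^+ k by rewrite divr_gt0// exprn_gt0.
have rj' k : 0 < r / 2 / 2 ^+ k by rewrite divr_gt0// exprn_gt0.
have i1 := bounded_integrable P (mf (r / 2 ^+ j.+1) r) (fun w => b _ r w (rj j.+1)).
have i2 := bounded_integrable P (mf (r / 2 / 2 ^+ j) (r / 2)) (fun w => b _ (r / 2) w (rj' j)).
have i3 : P.-integrable setT (EFin \o (fun w => (M w <= r)%R%:R : R)).
  by apply: (bounded_integrable _ (M := 1)); [exact: measurable_le_cst|move=> w; exact: bool_R_le1].
have i4 := integrableZl measurableT (2 / r) i3.
apply: (@le_trans _ _ (4 * C * (r / 2) + 2 / r * (C * r ^+ 2))); last first.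
  by rewrite le_eqVlt; apply/orP; left; apply/eqP; field; rewrite gt_eqF.
apply: (@le_trans _ _ ((\int[P]_w ((M w)^-1 * ((r / 2 / 2 ^+ j < M w) && (M w <= r / 2))%R%:R))%R
   + (2 / r) * (\int[P]_w (M w <= r)%R%:R)%R)); last first.
  apply: lerD; first exact: ih.
  by rewrite ler_wpM2l ?divr_ge0 ?(ltW r0)//; exact: Rintegral_le_cst.
rewrite -(RintegralZl _ measurableT i3) -RintegralD//.
apply: (le_Rintegral measurableT i1 (integrableD measurableT i2 i4)) => w _.
rewrite (_ : r / 2 ^+ j.+1 = r / 2 / 2 ^+ j); last by rewrite exprS; field; rewrite expf_neq0.
case: (ltP (r / 2 / 2 ^+ j) (M w)) => h0 /=; last first.
  by rewrite !mulr0 add0r mulr_ge0// divr_ge0// ltW.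
case: (leP (M w) r) => h1 /=; last first.
  by rewrite !mulr0 addr0 mulr_ge0 ?invr_ge0.
case: (leP (M w) (r / 2)) => h2 /=; first by rewrite lerDl mulr_ge0// divr_ge0// ltW.
rewrite mulr0 add0r !mulr1 -(invf_div r 2) lef_pV2 ?posrE ?ltW//.
by apply: lt_trans h2.
Qed.

Lemma first_moment_ereal (rho : R) : 0 < rho ->
  (\int[P]_w ((M w)^-1 * (M w <= rho)%R%:R)%:E <= (4 * C * rho)%:E)%E.
Proof.
move=> r0.
pose f j w : \bar R := ((M w)^-1 * ((rho / 2 ^+ j < M w) && (M w <= rho))%R%:R)%:E.
have rj k : 0 < rho / 2 ^+ k by rewrite divr_gt0// exprn_gt0.
have mf j : measurable_fun setT (fun w => (M w)^-1 * ((rho / 2 ^+ j < M w) && (M w <= rho))%R%:R).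
  apply: measurable_funM; first exact: measurable_funinv.
  apply: measurable_bool_R; apply: measurable_and; [exact: measurable_fun_ltr|exact: measurable_fun_ler].
have cv := @cvg_monotone_convergence _ _ _ P _ measurableT f _ _ _.
have {cv} : (\int[P]_w f j w @[j --> \oo] --> \int[P]_w ((M w)^-1 * (M w <= rho)%R%:R)%:E)%E.
  have -> : (\int[P]_w ((M w)^-1 * (M w <= rho)%R%:R)%:E = \int[P]_w (limn (f ^~ w)))%E.
    apply: eq_integral => w _; apply/esym/cvg_lim => //.
    (* At a zero of [M] both sides are 0, the inverse of 0 being 0. *)
    have [Mw|Mw] := eqVneq (M w) 0.
      by apply: cvg_near_cst; apply: nearW => j; rewrite /f Mw invr0 !mul0r.
    have {}Mw : 0 < M w by rewrite lt_def Mw M0.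
    apply: cvg_near_cst; near=> j; rewrite /f.
    suff -> : rho / 2 ^+ j < M w by [].
    near: j; have /cvgrPdist_lt/(_ _ Mw)[N _ h] : rho / 2 ^+ j @[j --> \oo] --> (0 : R).
      rewrite -[X in _ --> X](mulr0 rho); apply: cvgMr.
      under eq_fun do rewrite -exprVn; apply: cvg_expr.
      by rewrite ger0_norm ?invr_ge0// invf_lt1// ltr1n.
    by exists N => // j Nj; have := h j Nj; rewrite /= sub0r normrN gtr0_norm.
  apply: cv.
  - by move=> j; exact/measurable_EFinP.
  - by move=> j w _; rewrite lee_fin mulr_ge0// invr_ge0.
  - move=> w _ j k jk; rewrite lee_fin ler_wpM2l ?invr_ge0// ler_nat.
    case: (ltP (rho / 2 ^+ j) (M w)) => //= h.
    suff -> : rho / 2 ^+ k < M w by [].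
    apply: le_lt_trans h; rewrite ler_wpM2l ?(ltW r0)// lef_pV2 ?posrE ?exprn_gt0//.
    by rewrite ler_weXn2l// ler1n.
move=> cv; rewrite -(cvg_lim _ cv)//; apply: lime_le; first by apply/cvg_ex; eexists; exact: cv.
apply: nearW => j; rewrite /f -EFin_Rintegral ?lee_fin; first exact: first_moment_trunc.
apply: (bounded_integrable _ (M := (rho / 2 ^+ j)^-1)) => // w.
rewrite ger0_norm; last by rewrite mulr_ge0// invr_ge0.
case: (ltP (rho / 2 ^+ j) (M w)) => h /=; last by rewrite mulr0 invr_ge0 ltW.
apply: (@le_trans _ _ (M w)^-1); first by rewrite ler_piMr ?invr_ge0// lern1 leq_b1.
by rewrite lef_pV2 ?posrE ?ltW// (lt_trans (rj j)).
Unshelve. all: by end_near.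
Qed.

Lemma first_moment_integrable (rho : R) : 0 < rho ->
  P.-integrable setT (EFin \o (fun w => (M w)^-1 * (M w <= rho)%R%:R)).
Proof.
move=> r0; apply/integrableP; split.
  apply/measurable_EFinP; apply: measurable_funM; first exact: measurable_funinv.
  exact: measurable_le_cst.
under eq_integral => w _ do rewrite /= ger0_norm ?mulr_ge0 ?invr_ge0//.
by apply: le_lt_trans (first_moment_ereal r0) _; rewrite ltry.
Qed.

Lemma first_moment (rho : R) : 0 < rho ->
  (\int[P]_w ((M w)^-1 * (M w <= rho)%R%:R))%R <= 4 * C * rho.
Proof.
move=> r0; rewrite -lee_fin EFin_Rintegral; first exact: first_moment_ereal.
exact: first_moment_integrable.
Qed.

Lemma inverse_integrable : P.-integrable setT (EFin \o (fun w => (M w)^-1)).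
Proof.
pose f1 w : R := (M w)^-1 * (M w <= 1)%R%:R.
pose f2 w : R := (M w)^-1 * (1 < M w)%R%:R.
rewrite (_ : _ \o _ = (fun w => (f1 w)%:E + (f2 w)%:E)%E).
  apply: integrableD => //; first exact: first_moment_integrable.
  apply: (bounded_integrable _ (M := 1)).
    by apply: measurable_funM; [exact: measurable_funinv|exact: measurable_gt_cst].
  move=> w; rewrite /f2 ger0_norm ?mulr_ge0 ?invr_ge0//.
  case: (ltP 1 (M w)) => h; last by rewrite mulr0.
  by rewrite mulr1 invf_le1 ?(lt_trans ltr01 h)// ltW.
apply/funext => w; rewrite /f1 /f2 /= -EFinD -mulrDr; congr (_ %:E).
by case: (leP (M w) 1) => h /=; rewrite ?addr0 ?add0r mulr1.
Qed.

End tail_moments.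

(** * Taylor bounds of order three for sine and cosine *)

Section trigonometric_bounds.
Context {R : realType}.
Implicit Types x : R.

Lemma ge0_of_derive (f f' : R -> R) :
  (forall x : R, is_derive x (1 : R) f (f' x)) -> (forall x, 0 <= x -> 0 <= f' x) ->
  0 <= f 0 -> forall x, 0 <= x -> 0 <= f x.
Proof.
move=> df f'0 f0 x; rewrite le_eqVlt => /predU1P[<-//|x0].
have cf : {within `[0, x], continuous f}.
  apply: continuous_subspaceT => y; apply: differentiable_continuous.
  by apply/derivable1_diffP; have [] := df y.
have [c] := MVT x0 (fun y _ => df y) cf.
rewrite in_itv/= subr0 => /andP[c0 _] h.
by rewrite -(subrK (f 0) (f x)) h addr_ge0// mulr_ge0 ?f'0// ltW.
Qed.

Lemma sin_le_id x : 0 <= x -> sin x <= x.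
Proof.
have df (y : R) : is_derive y (1 : R) (fun x => x - sin x) (1 - cos y) by apply: is_derive_eq.
move=> x0; rewrite -subr_ge0; apply: (ge0_of_derive df) x0.
  by move=> y _; rewrite subr_ge0 cos_le1.
by rewrite sin0 subrr.
Qed.

Lemma cos_ge2 x : 0 <= x -> 0 <= cos x - 1 + x ^+ 2 / 2.
Proof.
have df (y : R) : is_derive y (1 : R) (fun x => cos x - 1 + x ^+ 2 / 2) (y - sin y).
  by apply: is_derive_eq; rewrite /GRing.scale/=; field.
apply: (ge0_of_derive df); first by move=> y y0; rewrite subr_ge0 sin_le_id.
by rewrite cos0 expr0n/= mul0r subrr addr0.
Qed.

Lemma sin_ge3 x : 0 <= x -> 0 <= sin x - x + x ^+ 3 / 6.
Proof.
have df (y : R) : is_derive y (1 : R) (fun x => sin x - x + x ^+ 3 / 6) (cos y - 1 + y ^+ 2 / 2).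
  by apply: is_derive_eq; rewrite /GRing.scale/=; field.
apply: (ge0_of_derive df); first by move=> y y0; exact: cos_ge2.
by rewrite sin0 expr0n/= mul0r subrr addr0.
Qed.

Lemma cos_le3 x : 0 <= x -> 0 <= x ^+ 3 / 6 - (cos x - 1 + x ^+ 2 / 2).
Proof.
have d1 (y : R) : is_derive y (1 : R) (fun x => x ^+ 3 / 6 - (cos x - 1 + x ^+ 2 / 2))
    (y ^+ 2 / 2 - y + sin y).
  by apply: is_derive_eq; rewrite /GRing.scale/=; field.
have d2 (y : R) : is_derive y (1 : R) (fun x => x ^+ 2 / 2 - x + sin x) (cos y - 1 + y).
  by apply: is_derive_eq; rewrite /GRing.scale/=; field.
have d3 (y : R) : is_derive y (1 : R) (fun x => cos x - 1 + x) (1 - sin y).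
  by apply: is_derive_eq; ring.
apply: (ge0_of_derive d1); last by rewrite cos0 !expr0n/=; lra.
apply: (ge0_of_derive d2); last by rewrite sin0 expr0n/=; lra.
apply: (ge0_of_derive d3); last by rewrite cos0; lra.
by move=> y _; rewrite subr_ge0 sin_le1.
Qed.

Lemma sin_taylor x : `|sin x - x| <= `|x| ^+ 3.
Proof.
have P (y : R) : 0 <= y -> `|sin y - y| <= y ^+ 3.
  move=> y0; have := sin_le_id y0; have := sin_ge3 y0.
  have : 0 <= y ^+ 3 by rewrite exprn_ge0.
  by rewrite ler_norml; lra.
have [x0|x0] := leP 0 x; first by rewrite (ger0_norm x0) P.
rewrite (ltr0_norm x0) (_ : sin x - x = - (sin (- x) - (- x))); last by rewrite sinN; ring.
by rewrite normrN P// oppr_ge0 ltW.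
Qed.

Lemma cos_taylor x : `|cos x - 1 + x ^+ 2 / 2| <= `|x| ^+ 3.
Proof.
have P (y : R) : 0 <= y -> `|cos y - 1 + y ^+ 2 / 2| <= y ^+ 3.
  move=> y0; have := cos_ge2 y0; have := cos_le3 y0.
  have : 0 <= y ^+ 3 by rewrite exprn_ge0.
  by rewrite ler_norml; lra.
have [x0|x0] := leP 0 x; first by rewrite (ger0_norm x0) P.
by rewrite (ltr0_norm x0) -cosN -sqrrN P// oppr_ge0 ltW.
Qed.

Lemma cos_le1_norm x : `|cos x| <= 1.
Proof. by rewrite ler_norml cos_geN1 cos_le1. Qed.

Lemma sin_le1_norm x : `|sin x| <= 1.
Proof. by rewrite ler_norml sin_geN1 sin_le1. Qed.

End trigonometric_bounds.

(** * Characteristic function of one centred and rescaled term *)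

Section one_step.
Context {d} {T : measurableType d} {R : realType} (P : probability T R).
Variables (M X : T -> R) (C k : R).
Hypotheses (mM : measurable_fun setT M) (M0 : forall w, 0 <= M w).
Hypothesis tail : forall rho : R, 0 < rho -> (P [set w | (M w <= rho)%R] <= (C * rho ^+ 2)%:E)%E.
Hypotheses (mX : measurable_fun setT X) (k0 : 0 <= k).
Hypothesis XM : forall w, `|X w| <= k * (M w)^-1.
Let m := (\int[P]_w X w)%R.

Lemma dominated_integrable_X : P.-integrable setT (EFin \o X).
Proof.
apply: (le_integrable _ _ _ (integrableZl measurableT k (inverse_integrable mM M0 tail))) => //.
  exact/measurable_EFinP.
by move=> w _ /=; rewrite lee_fin (le_trans (XM w))// ler_norm.
Qed.

(** Where M > 1/a a cubic Taylor bound is used together with [third_moment]; elsewhere cosine and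
    sine are bounded by 1, and the mass and first moment of that region are small. Every
    contribution is O(a^-2). *)
Lemma one_step_char : exists K : R, forall a : R, 1 <= a ->
  `|(\int[P]_w cos ((X w - m) / a))%R -
     (1 - (\int[P]_w (X w ^+ 2 * (a^-1 < M w)%R%:R))%R / a ^+ 2 / 2)| <= K / a ^+ 2 /\
  `|(\int[P]_w sin ((X w - m) / a))%R| <= K / a ^+ 2.
Proof.
have C0 := tailC_ge0 tail.
pose EX := (\int[P]_w `|X w|)%R.
(* In order: the third moment, the cube of the centring m/a, the mass where M <= 1/a, and the first
   moment there. *)
pose K1 := 32 * k ^+ 3 * C + 4 * `|m| ^+ 3 + (2 + `|m|) * C + 4 * k * C.
have EX0 : 0 <= EX by apply: Rintegral_ge0.
have iX := dominated_integrable_X.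
(* The two additional terms pay for replacing (X - m)^2 by X^2 in the truncated variance. *)
exists (K1 + `|m| * EX + m ^+ 2 / 2) => a a1.
have a0 : 0 < a by lra.
have ai0 : 0 < a^-1 by rewrite invr_gt0.
pose G w : R := (a^-1 < M w)%R%:R.
pose B w : R := (M w <= a^-1)%R%:R.
pose c := m / a.
pose h w := (X w - m) / a.
have mh : measurable_fun setT h by apply: measurable_funM => //; exact: measurable_funB.
have mG : measurable_fun setT G by exact: measurable_gt_cst.
have mB : measurable_fun setT B by exact: measurable_le_cst.
have G1 w : `|G w| <= 1 by exact: bool_R_le1.
have B1 w : `|B w| <= 1 by exact: bool_R_le1.
have iG : P.-integrable setT (EFin \o G) by exact: (bounded_integrable P mG G1).
have iB : P.-integrable setT (EFin \o B) by exact: (bounded_integrable P mB B1).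
pose V3 w := (M w)^-1 ^+ 3 * G w.
pose V1 w := (M w)^-1 * B w.
have XG w : `|X w| * G w <= k * a.
  rewrite /G; case: (ltP a^-1 (M w)) => hM; last by rewrite mulr0 mulr_ge0// ltW.
  rewrite mulr1 (le_trans (XM w))// ler_wpM2l// -[leRHS]invrK lef_pV2 ?posrE// ?ltW//.
  exact: lt_trans hM.
have V3b w : `|V3 w| <= a ^+ 3.
  rewrite /V3 /G; case: (ltP a^-1 (M w)) => hM; last by rewrite mulr0 normr0 exprn_ge0// ltW.
  have Mw := lt_trans ai0 hM.
  rewrite mulr1 ger0_norm ?exprn_ge0 ?invr_ge0//.
  by rewrite lerXn2r ?nnegrE ?invr_ge0 ?(ltW a0)// -[leRHS]invrK lef_pV2 ?posrE// ltW.
have mV3 : measurable_fun setT V3.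
  by apply: measurable_funM => //; apply: measurable_funX; exact: measurable_funinv.
have iV3 := bounded_integrable P mV3 V3b.
have iV1 : P.-integrable setT (EFin \o V1) by exact: (first_moment_integrable mM M0 tail ai0).
have I3 : (\int[P]_w V3 w)%R <= 8 * C * a.
  by have := third_moment mM M0 tail ai0; rewrite invrK.
have I1 : (\int[P]_w V1 w)%R <= 4 * C * a^-1 by exact: first_moment.
have IB : (\int[P]_w B w)%R <= C * a^-1 ^+ 2 by exact: Rintegral_le_cst.
(* One majorant for both Taylor remainders; the factors 4 come from (x + y)^3 <= 4 (x^3 + y^3). *)
pose D w := 4 * (k ^+ 3 / a ^+ 3) * V3 w + (2 + `|c|) * B w + k / a * V1 w + 4 * `|c| ^+ 3.
have c0 := normr_ge0 c.
have icst (x : R) : P.-integrable setT (EFin \o (fun=> x)).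
  by apply: (bounded_integrable _ (M := `|x|)).
have j1 := integrableZl measurableT (4 * (k ^+ 3 / a ^+ 3)) iV3.
have j2 := integrableZl measurableT (2 + `|c|) iB.
have j3 := integrableZl measurableT (k / a) iV1.
have j12 := integrableD measurableT j1 j2.
have j123 := integrableD measurableT j12 j3.
have iD := integrableD measurableT j123 (icst (4 * `|c| ^+ 3)).
have ID : (\int[P]_w D w)%R <= K1 / a ^+ 2.
  rewrite /D RintegralD// RintegralD// RintegralD// !RintegralZl// Rintegral_cst_prob.
  have ca : `|c| <= `|m| / a by rewrite /c normrM (gtr0_norm ai0).
  have cm : `|c| <= `|m|.
    by rewrite (le_trans ca)// ler_piMr// invf_le1.
  have ai1 : a^-1 <= 1 by rewrite invf_le1.
  have c3 : `|c| ^+ 3 <= `|m| ^+ 3 / a ^+ 2.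
    apply: (@le_trans _ _ ((`|m| / a) ^+ 3)); first by rewrite lerXn2r ?nnegrE// mulr_ge0// ltW.
    rewrite expr_div_n ler_wpM2l ?exprn_ge0// lef_pV2 ?posrE ?exprn_gt0//.
    by rewrite ler_weXn2l.
  have t1 : 4 * (k ^+ 3 / a ^+ 3) * (\int[P]_w V3 w)%R <= 32 * k ^+ 3 * C / a ^+ 2.
    apply: (@le_trans _ _ (4 * (k ^+ 3 / a ^+ 3) * (8 * C * a))).
      by rewrite ler_wpM2l// !mulr_ge0 ?exprn_ge0 ?invr_ge0 ?exprn_ge0 ?(ltW a0).
    by rewrite le_eqVlt; apply/orP; left; apply/eqP; field; rewrite gt_eqF.
  have t2 : (2 + `|c|) * (\int[P]_w B w)%R <= (2 + `|m|) * C / a ^+ 2.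
    rewrite -mulrA; apply: ler_pM.
    - by rewrite addr_ge0.
    - by apply: Rintegral_ge0 => w _; rewrite /B ler0n.
    - by rewrite lerD2l.
    - by rewrite -exprVn.
  have t3 : k / a * (\int[P]_w V1 w)%R <= 4 * k * C / a ^+ 2.
    apply: (@le_trans _ _ (k / a * (4 * C * a^-1))).
      by rewrite ler_wpM2l// mulr_ge0// ltW.
    by rewrite le_eqVlt; apply/orP; left; apply/eqP; field; rewrite gt_eqF.
  have -> : K1 / a ^+ 2 = 32 * k ^+ 3 * C / a ^+ 2 + (2 + `|m|) * C / a ^+ 2 +
      4 * k * C / a ^+ 2 + 4 * (`|m| ^+ 3 / a ^+ 2).
    by rewrite /K1; field; rewrite gt_eqF.
  by apply: lerD; [apply: lerD; [apply: lerD|]|rewrite ler_wpM2l].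
have cube (x y : R) : 0 <= x -> 0 <= y -> (x + y) ^+ 3 <= 4 * (x ^+ 3 + y ^+ 3).
  move=> x0 y0; rewrite -subr_ge0 (_ : _ - _ = 3 * (x + y) * (x - y) ^+ 2); last by ring.
  by apply: mulr_ge0; [rewrite mulr_ge0// addr_ge0|exact: sqr_ge0].
have hle w : `|h w| <= `|X w| / a + `|c|.
  rewrite /h /c mulrBl; apply: le_trans (ler_normB _ _) _.
  by rewrite normrM (gtr0_norm ai0).
have hcube w : G w = 1 -> `|h w| ^+ 3 <= D w.
  move=> Gw; have Bw : B w = 0.
    by move: Gw; rewrite /G /B; case: (ltP a^-1 (M w)) => //=.
  rewrite /D /V1 /V3 Bw Gw !mulr0 !addr0 mulr1.
  apply: (@le_trans _ _ ((`|X w| / a + `|c|) ^+ 3)).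
    by rewrite lerXn2r ?nnegrE// addr_ge0// divr_ge0// ltW.
  apply: le_trans (cube _ _ _ _) _ => //; first by rewrite divr_ge0// ltW.
  rewrite mulrDr lerD2r -mulrA ler_wpM2l//.
  rewrite (_ : k ^+ 3 / a ^+ 3 * _ = (k * (M w)^-1 / a) ^+ 3); last first.
    by rewrite -[(a ^+ 3)^-1]exprVn; ring.
  have q0 : 0 <= k * (M w)^-1 by rewrite mulr_ge0 ?invr_ge0.
  by rewrite lerXn2r ?nnegrE ?divr_ge0 ?(ltW a0)// ler_wpM2r// ltW.
have hB w : G w = 0 -> 2 + `|h w| <= D w.
  move=> Gw; have Bw : B w = 1.
    by move: Gw; rewrite /G /B; case: (ltP a^-1 (M w)) => //=.
  rewrite /D /V1 /V3 Bw Gw !mulr0 !mulr1 add0r.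
  have h1 := hle w.
  have h2 : `|X w| / a <= k / a * (M w)^-1 by rewrite mulrAC ler_wpM2r ?(ltW ai0).
  have h3 : 0 <= `|c| ^+ 3 by rewrite exprn_ge0.
  apply: ler_wpDr; first by rewrite mulr_ge0.
  by rewrite -[leRHS]addrA lerD2l addrC; apply: le_trans h1 _; rewrite lerD2r.
have Gcase w : G w = 1 \/ G w = 0 by rewrite /G; case: (_ < _); [left|right].
have D1 w : `|cos (h w) - 1 + h w ^+ 2 / 2 * G w| <= D w.
  case: (Gcase w) => Gw; rewrite Gw ?mulr1.
    exact: le_trans (cos_taylor _) (hcube _ Gw).
  rewrite mulr0 addr0; apply: le_trans (hB _ Gw).
  apply: le_trans (ler_normB _ _) _; rewrite normr1.
  apply: (@le_trans _ _ (1 + 1)); first by rewrite lerD2r cos_le1_norm.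
  by rewrite -[1 + 1]/(2 : R) lerDl.
have D2 w : `|sin (h w) - h w| <= D w.
  case: (Gcase w) => Gw.
    exact: le_trans (sin_taylor _) (hcube _ Gw).
  apply: le_trans (hB _ Gw); apply: le_trans (ler_normB _ _) _.
  by rewrite lerD2r (le_trans (sin_le1_norm _))// ler1n.
have mcos : measurable_fun setT (fun w => cos (h w)).
  exact: (measurableT_comp (continuous_measurable_fun (@continuous_cos R))).
have msin : measurable_fun setT (fun w => sin (h w)).
  exact: (measurableT_comp (continuous_measurable_fun (@continuous_sin R))).
have dom (f : T -> R) : measurable_fun setT f -> (forall w, `|f w| <= D w) ->
    P.-integrable setT (EFin \o f) /\ `|(\int[P]_w f w)%R| <= K1 / a ^+ 2.
  move=> mf fD.
  have ifi : P.-integrable setT (EFin \o f).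
    apply: (le_integrable _ _ _ iD) => //; first exact/measurable_EFinP.
    by move=> w _; apply: le_trans (_ : (`|f w|%:E <= (D w)%:E)%E) _ => //=;
      rewrite ?lee_fin// ler_norm.
  split => //; apply: le_trans (le_normr_Rintegral measurableT ifi) _.
  apply: le_trans ID.
  by apply: (le_Rintegral measurableT (integrable_norm ifi) iD) => w _; exact: fD.
have ih : P.-integrable setT (EFin \o h).
  exact: (integrableZr measurableT a^-1 (integrableB measurableT iX (icst m))).
(* Centring removes the linear term, so the integral of sin h is that of sin h - h. *)
have Eh : (\int[P]_w h w)%R = 0.
  rewrite /h RintegralZr//; last exact: (integrableB measurableT iX (icst m)).
  by rewrite RintegralB// Rintegral_cst_prob subrr mul0r.
have K1le : K1 / a ^+ 2 <= (K1 + `|m| * EX + m ^+ 2 / 2) / a ^+ 2.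
  rewrite ler_wpM2r ?invr_ge0 ?exprn_ge0 ?(ltW a0)//.
  by rewrite -addrA lerDl addr_ge0 ?divr_ge0 ?sqr_ge0// mulr_ge0.
split; last first.
  have [i1 i2] := dom _ (measurable_funB msin mh) D2.
  apply: le_trans K1le; apply: le_trans i2.
  rewrite -{1}(subr0 (\int[P]_w _)%R) -Eh -RintegralB//.
  by apply: (bounded_integrable _ (M := 1)) => // w; exact: sin_le1_norm.
pose XXG w := X w ^+ 2 * G w.
pose XGf w := X w * G w.
have iXXG : P.-integrable setT (EFin \o XXG).
  apply: (bounded_integrable _ (M := (k * a) ^+ 2)).
    by apply: measurable_funM => //; exact: measurable_funX.
  move=> w; rewrite /XXG (_ : _ * _ = (X w * G w) ^+ 2); last first.
    by case: (Gcase w) => ->; rewrite ?mulr1 ?mulr0 ?expr0n.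
  have GG : `|G w| = G w by rewrite ger0_norm// /G ler0n.
  rewrite normrX lerXn2r ?nnegrE ?mulr_ge0 ?(ltW a0)//.
  by rewrite normrM GG.
have iXG : P.-integrable setT (EFin \o XGf).
  apply: (bounded_integrable _ (M := k * a)); first exact: measurable_funM.
  have GG w : `|G w| = G w by rewrite ger0_norm// /G ler0n.
  by move=> w; rewrite normrM GG.
have mq : measurable_fun setT (fun w => cos (h w) - 1 + h w ^+ 2 / 2 * G w).
  apply: measurable_funD; first exact: measurable_funB.
  by apply: measurable_funM => //; apply: measurable_funM => //; exact: measurable_funX.
have [i1 i2] := dom _ mq D1.
have icos : P.-integrable setT (EFin \o (fun w => cos (h w))).
  by apply: (bounded_integrable _ (M := 1)) => // w; exact: cos_le1_norm.
pose A := (\int[P]_w XXG w)%R; pose Bb := (\int[P]_w XGf w)%R; pose Gg := (\int[P]_w G w)%R.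
have E1 : (\int[P]_w (cos (h w) - 1 + h w ^+ 2 / 2 * G w))%R =
   (\int[P]_w cos (h w))%R - 1 + (a ^+ 2 * 2)^-1 * A - c / a * Bb + c ^+ 2 / 2 * Gg.
  transitivity (\int[P]_w (cos (h w) - 1 + (a ^+ 2 * 2)^-1 * XXG w - c / a * XGf w + c ^+ 2 / 2 * G w))%R.
    apply: eq_Rintegral => w _; rewrite /h /c /XXG /XGf; field; rewrite gt_eqF//.
  have l1 := integrableB measurableT icos (icst 1).
  have l2 := integrableD measurableT l1 (integrableZl measurableT (a ^+ 2 * 2)^-1 iXXG).
  have l3 := integrableB measurableT l2 (integrableZl measurableT (c / a) iXG).
  have l4 := integrableZl measurableT (c ^+ 2 / 2) iG.
  rewrite RintegralD// RintegralB//; last exact: (integrableZl measurableT (c / a) iXG).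
  rewrite RintegralD//; last exact: (integrableZl measurableT (a ^+ 2 * 2)^-1 iXXG).
  by rewrite RintegralB// !RintegralZl// Rintegral_cst_prob.
have Bb_le : `|Bb| <= EX.
  apply: le_trans (le_normr_Rintegral measurableT iXG) _.
  apply: (le_Rintegral measurableT (integrable_norm iXG) (integrable_norm iX)) => w _.
  by rewrite /XGf /= normrM ler_piMr.
have Gg_le : `|Gg| <= 1 by exact: Rintegral_bound.
rewrite (_ : _ - _ = (\int[P]_w (cos (h w) - 1 + h w ^+ 2 / 2 * G w))%R + (c / a * Bb - c ^+ 2 / 2 * Gg)); last first.
  by rewrite E1 -/(XXG) -/A /h; field; rewrite gt_eqF.
apply: le_trans (ler_normD _ _) _.
rewrite -addrA mulrDl; apply: lerD => //.
apply: le_trans (ler_normB _ _) _; rewrite mulrDl; apply: lerD.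
  rewrite (_ : c / a * Bb = m * Bb / a ^+ 2); last by rewrite /c; field; rewrite gt_eqF.
  rewrite normrM [X in _ * X]ger0_norm ?invr_ge0 ?sqr_ge0// ler_wpM2r ?invr_ge0 ?sqr_ge0//.
  by rewrite normrM ler_wpM2l.
rewrite normrM [X in X * _]ger0_norm; last by rewrite mulr_ge0 ?sqr_ge0.
rewrite (_ : m ^+ 2 / 2 / a ^+ 2 = c ^+ 2 / 2); last by rewrite /c; field; rewrite gt_eqF.
by rewrite ler_piMr// mulr_ge0 ?sqr_ge0.
Qed.

End one_step.

(** * Sums of independent terms, one index at a time *)

Section telescoping.
Context {d : measure_display} {T : measurableType d} {R : realType}.
Variables (P : probability T R) (xi : nat -> {RV P >-> R[i]}).
Hypothesis xi_indep : mutually_independent xi.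

Lemma Rintegral_indep i (Psi : R[i] * others xi i -> R) (B : R) :
  measurable_fun setT Psi -> (forall x, `|Psi x| <= B) ->
  (\int[P]_w Psi (xi i w, w) =
   \int[distribution P (xi i)]_x \int[P]_w Psi (x, w))%R.
Proof.
move=> mPsi bPsi.
(* Adding the bound [B] makes the function nonnegative, as [integral_indep] requires; the constant
   is removed at the end. *)
have Psi0 x : 0 <= Psi x + B by have := bPsi x; rewrite ler_norml => /andP[? _]; lra.
have mT1 : measurable_fun [set: T] (fun w => Psi (xi i w, w)).
  have mpair : measurable_fun [set: T] (fun w : T => (xi i w, w : others xi i)).
    by apply: measurable_fun_pair => //; exact: measurable_to_others.
  exact: (measurableT_comp mPsi mpair).
have mT2 x : measurable_fun [set: T] (fun w => Psi (x, w)).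
  apply: (@measurable_others _ _ _ _ _ i _ _ (fun w : others xi i => Psi (x, w))).
  exact: measurableT_comp.
have c1 : measurable_fun setT (fun x => (Psi x + B)%:E).
  by apply/measurable_EFinP; exact: measurable_funD.
have c2 x : (0 <= (Psi x + B)%:E)%E by rewrite lee_fin.
have h := integral_indep xi_indep c1 c2.
have i1 : P.-integrable setT (EFin \o (fun w => Psi (xi i w, w))).
  by apply: (bounded_integrable _ (M := B)).
have i2 x : P.-integrable setT (EFin \o (fun w => Psi (x, w))).
  by apply: (bounded_integrable _ (M := B)).
have iB : P.-integrable setT (EFin \o (fun=> B)).
  by apply: (bounded_integrable _ (M := `|B|)).
have e1 : (\int[P]_w (Psi (xi i w, w) + B)%:E = ((\int[P]_w Psi (xi i w, w))%R + B)%:E)%E.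
  rewrite -EFin_Rintegral; last exact: (integrableD measurableT i1 iB).
  by rewrite RintegralD// Rintegral_cst_prob.
have mH : measurable_fun [set: R[i]] (fun x => \int[P]_w Psi (x, w))%R.
  pose idm : {mfun T >-> others xi i} := mfun_Sub (mem_set (@measurable_to_others _ _ _ P xi i)).
  rewrite (_ : (fun _ => _) = (fun x => \int[distribution P idm]_z Psi (x, z))%R); last first.
    apply/funext => x; rewrite /Rintegral integral_distribution//.
      by apply/measurable_EFinP; exact: measurableT_comp.
    exact: i2.
  apply: (@mixture_measurable_l _ (others xi i) R _ R[i] (distribution P (xi i))
    (distribution P idm) Psi (fun=> B) mPsi) => //.
  by apply: (bounded_integrable _ (M := `|B|)).
have iH : (distribution P (xi i)).-integrable setT (EFin \o (fun x => \int[P]_w Psi (x, w))%R).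
  apply: (bounded_integrable _ (M := B)) => // x; exact: Rintegral_bound.
have iB' : (distribution P (xi i)).-integrable setT (EFin \o (fun=> B)).
  by apply: (bounded_integrable _ (M := `|B|)).
have e2 : (\int[distribution P (xi i)]_x \int[P]_w (Psi (x, w) + B)%:E =
    ((\int[distribution P (xi i)]_x \int[P]_w Psi (x, w))%R + B)%:E)%E.
  transitivity (\int[distribution P (xi i)]_x ((\int[P]_w Psi (x, w))%R + B)%:E)%E.
    apply: eq_integral => x _.
    rewrite -EFin_Rintegral; last exact: (integrableD measurableT (i2 x) iB).
    by rewrite RintegralD// Rintegral_cst_prob.
  rewrite -EFin_Rintegral; last exact: (integrableD measurableT iH iB').
  by rewrite RintegralD// Rintegral_cst_prob.
rewrite e1 e2 in h.
by case: h => /addIr.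
Qed.

Variables (mu : probability R[i] R) (F : R[i] -> R).
Hypothesis xi_mu : forall k, (0 < k)%N -> forall B, measurable B -> distribution P (xi k) B = mu B.
Hypothesis mF : measurable_fun setT F.
Variables (m a : R).

Let Y k w := (F (xi k w) - m) / a.
Definition scaled_sum j w := \sum_(1 <= k < j.+1) Y k w.
Let Ec := (\int[mu]_x cos ((F x - m) / a))%R.
Let Es := (\int[mu]_x sin ((F x - m) / a))%R.

Let mFa : measurable_fun setT (fun x => (F x - m) / a).
Proof. by apply: measurable_funM => //; exact: measurable_funB. Qed.

Let mscos d' (S : measurableType d') (f : S -> R) : measurable_fun setT f ->
  measurable_fun setT (fun x => cos (f x)).
Proof. by move=> mf; exact: (measurableT_comp (continuous_measurable_fun (@continuous_cos R))). Qed.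

Let mssin d' (S : measurableType d') (f : S -> R) : measurable_fun setT f ->
  measurable_fun setT (fun x => sin (f x)).
Proof. by move=> mf; exact: (measurableT_comp (continuous_measurable_fun (@continuous_sin R))). Qed.

Lemma measurable_scaled_sum_others j : measurable_fun [set: others xi j.+1] (scaled_sum j).
Proof.
suff H l : (l <= j)%N -> measurable_fun [set: others xi j.+1] (scaled_sum l) by exact: H.
elim: l => [_|l ih lj].
  rewrite (_ : scaled_sum 0 = cst 0); first exact: measurable_cst.
  by apply/funext => w; rewrite /scaled_sum big_geq.
rewrite (_ : scaled_sum l.+1 = (fun w => scaled_sum l w + Y l.+1 w)); last first.
  by apply/funext => w; rewrite /scaled_sum big_nat_recr.
apply: measurable_funD; first by apply: ih; exact: ltnW.
apply: (measurableT_comp mFa); apply: measurable_xi_others.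
by rewrite gtn_eqF.
Qed.

Lemma measurable_scaled_sum j : measurable_fun [set: T] (scaled_sum j).
Proof.
move=> mT B mB; apply: (@others_measurable _ _ _ P xi j.+1).
exact: (measurable_scaled_sum_others measurableT mB).
Qed.

(** Addition formula for the cosine: the new term is independent of the partial sum, so each product
    integrates to a product. *)
Lemma scaled_sum_step j th :
  (\int[P]_w cos (th + scaled_sum j.+1 w))%R =
  (\int[P]_w cos (th + scaled_sum j w))%R * Ec - (\int[P]_w sin (th + scaled_sum j w))%R * Es.
Proof.
have mS := @measurable_scaled_sum_others j.
have mS' := @measurable_scaled_sum j.
pose Psi (xw : R[i] * others xi j.+1) := cos (th + scaled_sum j xw.2 + (F xw.1 - m) / a).
have mPsi : measurable_fun setT Psi.
  apply: mscos; apply: measurable_funD.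
    by apply: measurable_funD => //; apply: (measurableT_comp mS); exact: measurable_snd.
  by apply: (measurableT_comp mFa); exact: measurable_fst.
have ic : P.-integrable setT (EFin \o (fun w => cos (th + scaled_sum j w))).
  apply: (bounded_integrable _ (M := 1)); last by move=> w; exact: cos_le1_norm.
  by apply: mscos; exact: measurable_funD.
have is' : P.-integrable setT (EFin \o (fun w => sin (th + scaled_sum j w))).
  apply: (bounded_integrable _ (M := 1)); last by move=> w; exact: sin_le1_norm.
  by apply: mssin; exact: measurable_funD.
transitivity (\int[P]_w Psi (xi j.+1 w, w))%R.
  by apply: eq_Rintegral => w _; rewrite /Psi /= /scaled_sum big_nat_recr//= addrA.
rewrite (Rintegral_indep mPsi (B := 1)); last by move=> x; exact: cos_le1_norm.
set A := (X in X * Ec); set B := (X in X * Es).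
transitivity (\int[distribution P (xi j.+1)]_x (A * cos ((F x - m) / a) - B * sin ((F x - m) / a)))%R.
  apply: eq_Rintegral => x _; rewrite /Psi/=.
  under eq_Rintegral => w _ do rewrite cosD.
  rewrite RintegralB//; last 2 first.
  - exact: (integrableZr measurableT _ ic).
  - exact: (integrableZr measurableT _ is').
  by rewrite !RintegralZr.
transitivity (\int[mu]_x (A * cos ((F x - m) / a) - B * sin ((F x - m) / a)))%R.
  by congr fine; apply: eq_measure_integral => D mD _; exact: xi_mu.
have jc : mu.-integrable setT (EFin \o (fun x => cos ((F x - m) / a))).
  by apply: (bounded_integrable _ (M := 1)); [exact: mscos|move=> w; exact: cos_le1_norm].
have js : mu.-integrable setT (EFin \o (fun x => sin ((F x - m) / a))).
  by apply: (bounded_integrable _ (M := 1)); [exact: mssin|move=> w; exact: sin_le1_norm].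
rewrite RintegralB//; last 2 first.
- exact: (integrableZl measurableT A jc).
- exact: (integrableZl measurableT B js).
by rewrite !RintegralZl.
Qed.

(** One step multiplies the integral by [r] up to |Ec - r| + |Es|, since integrals of cosine and
    sine are at most 1 in modulus; as r <= 1, earlier errors are not amplified. Treating the sine
    part as an error keeps the induction real. *)
Lemma char_telescoping (r : R) j th : 0 <= r <= 1 ->
  `|(\int[P]_w cos (th + scaled_sum j w))%R - r ^+ j * cos th| <=
    j%:R * (`|Ec - r| + `|Es|).
Proof.
move=> /andP[r0 r1].
elim: j th => [|j ih] th.
  under eq_Rintegral => w _ do rewrite /scaled_sum big_geq// addr0.
  by rewrite Rintegral_cst_prob expr0 mul1r subrr normr0 mul0r.
rewrite scaled_sum_step.
set A := (X in X * Ec); set B := (X in X * Es).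
have mS := @measurable_scaled_sum j.
have A1 : `|A| <= 1.
  apply: Rintegral_bound => [|w]; last exact: cos_le1_norm.
  by apply: mscos; exact: measurable_funD.
have B1 : `|B| <= 1.
  apply: Rintegral_bound => [|w]; last exact: sin_le1_norm.
  by apply: mssin; exact: measurable_funD.
rewrite (_ : _ - _ = A * (Ec - r) - B * Es + r * (A - r ^+ j * cos th)); last first.
  by rewrite exprS; ring.
have h1 : `|A * (Ec - r)| <= `|Ec - r| by rewrite normrM ler_piMl.
have h2 : `|B * Es| <= `|Es| by rewrite normrM ler_piMl.
have h3 : `|r * (A - r ^+ j * cos th)| <= j%:R * (`|Ec - r| + `|Es|).
  rewrite normrM (ger0_norm r0); apply: le_trans (ih th).
  by rewrite ler_piMl.
apply: le_trans (ler_normD _ _) _; apply: le_trans (lerD (ler_normB _ _) (lexx _)) _.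
rewrite -natr1 mulrDl mul1r; lra.
Qed.

End telescoping.

(** * The scale sqrt (n ln n) *)

Section logarithmic_scale.
Context {R : realType}.

Definition clt_scale (n : nat) : R := Num.sqrt (n%:R * ln n%:R).

Lemma near_ln_ge (A : R) : \forall n \near \oo, A <= ln (n%:R : R).
Proof.
exists (Num.truncn (expR A)).+1 => // n /= hn.
have h : expR A <= n%:R by apply: le_trans (ltW (truncnS_gt _)) _; rewrite ler_nat.
by rewrite -[leLHS]expRK ler_ln ?posrE ?expR_gt0// (lt_le_trans (expR_gt0 A)).
Qed.

Lemma cvg_invln : (ln (n%:R : R))^-1 @[n --> \oo] --> (0 : R).
Proof.
apply/cvgrPdist_le => e e0; near=> n.
have h : e^-1 <= ln (n%:R : R) by near: n; exact: near_ln_ge.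
have ei0 : 0 < e^-1 by rewrite invr_gt0.
rewrite sub0r normrN ger0_norm ?invr_ge0 ?(le_trans (ltW ei0))//.
by rewrite -[leRHS]invrK lef_pV2 ?posrE// (lt_le_trans ei0).
Unshelve. all: by end_near.
Qed.

Lemma cvg_invsqrtln : (Num.sqrt (ln (n%:R : R)))^-1 @[n --> \oo] --> (0 : R).
Proof.
apply/cvgrPdist_le => e e0; near=> n.
have h : e^-1 ^+ 2 <= ln (n%:R : R) by near: n; exact: near_ln_ge.
have ei0 : 0 < e^-1 by rewrite invr_gt0.
have h2 : e^-1 <= Num.sqrt (ln (n%:R : R)).
  by rewrite -[leLHS]gtr0_norm// -sqrtr_sqr ler_wsqrtr.
rewrite sub0r normrN ger0_norm ?invr_ge0 ?sqrtr_ge0//.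
by rewrite -[leRHS]invrK lef_pV2 ?posrE// (lt_le_trans ei0).
Unshelve. all: by end_near.
Qed.

(** With L = ln n, ln L = 2 ln (sqrt L) <= 2 sqrt L. *)
Lemma cvg_lnln : ln (ln (n%:R : R)) / ln (n%:R : R) @[n --> \oo] --> (0 : R).
Proof.
apply: (@squeeze_cvgr _ _ _ _ (fun=> 0) (fun n => 2 * (Num.sqrt (ln (n%:R : R)))^-1)).
- near=> n.
  have L1 : 1 <= ln (n%:R : R) by near: n; exact: near_ln_ge.
  set L := ln (n%:R : R) in L1 *.
  have L0 : 0 < L by lra.
  have s0 : 0 < Num.sqrt L by rewrite sqrtr_gt0.
  have sE : Num.sqrt L ^+ 2 = L by rewrite sqr_sqrtr// ltW.
  apply/andP; split; first by rewrite divr_ge0 ?(ltW L0)// ln_ge0.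
  rewrite -[in ln L]sE lnXn//.
  have h : ln (Num.sqrt L) <= Num.sqrt L by exact/ltW/ln_sublinear.
  apply: (@le_trans _ _ (Num.sqrt L *+ 2 / L)).
    by rewrite ler_wpM2r ?invr_ge0 ?(ltW L0)// lerMn2r.
  by rewrite -{2}sE le_eqVlt; apply/orP; left; apply/eqP; field; rewrite gt_eqF.
- exact: cvg_cst.
- rewrite -[X in _ --> X](mulr0 (2 : R)); apply: cvgMr; exact: cvg_invsqrtln.
Unshelve. all: by end_near.
Qed.

Lemma clt_scale_sqr n : (0 < n)%N -> clt_scale n ^+ 2 = n%:R * ln n%:R.
Proof. by move=> n0; rewrite sqr_sqrtr// mulr_ge0// ln_ge0// ler1n. Qed.

(** Twice the logarithm of the scale is ln n + ln ln n. *)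
Lemma cvg_ln_clt_scale : ln (clt_scale n) / ln (n%:R : R) @[n --> \oo] --> (2^-1 : R).
Proof.
have h : 2^-1 + 2^-1 * (ln (ln (n%:R : R)) / ln (n%:R : R)) @[n --> \oo] --> (2^-1 + 2^-1 * 0 : R).
  by apply: cvgD; [exact: cvg_cst|apply: cvgMr; exact: cvg_lnln].
rewrite mulr0 addr0 in h; apply: cvg_trans h; apply: near_eq_cvg; near=> n.
have L1 : 1 <= ln (n%:R : R) by near: n; exact: near_ln_ge.
have n0 : (0 < n)%N by near: n; exists 1%N.
have n0' : 0 < (n%:R : R) by rewrite ltr0n.
have L0 : 0 < ln (n%:R : R) by lra.
have a0 : 0 < clt_scale n by rewrite sqrtr_gt0 mulr_gt0.
have : ln (clt_scale n ^+ 2) = ln (n%:R : R) + ln (ln (n%:R : R)).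
  by rewrite clt_scale_sqr// lnM.
rewrite lnXn// mulr2n => h2.
have -> : ln (clt_scale n) = (ln (n%:R : R) + ln (ln (n%:R : R))) / 2 by lra.
by field; rewrite gt_eqF.
Unshelve. all: by end_near.
Qed.

Lemma near_clt_scale_ge (A : R) : \forall n \near \oo, A <= clt_scale n.
Proof.
near=> n.
have L1 : 1 <= ln (n%:R : R) by near: n; exact: near_ln_ge.
have h : (Num.max 1 A) ^+ 2 <= ln (n%:R : R) by near: n; exact: near_ln_ge.
have n1 : 1 <= (n%:R : R) by rewrite ler1n; near: n; exists 1%N.
have h2 : (Num.max 1 A) ^+ 2 <= n%:R * ln (n%:R : R).
  by apply: le_trans h _; rewrite ler_peMl//; lra.
have m0 : 0 <= Num.max 1 A by rewrite le_max ler01.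
apply: (@le_trans _ _ (Num.max 1 A)); first by rewrite le_max lexx orbT.
by rewrite -[leLHS]ger0_norm// -sqrtr_sqr ler_wsqrtr.
Unshelve. all: by end_near.
Qed.

(** From 1 - x <= exp (- x) <= 1 / (1 + x) <= 1 - x + x^2. *)
Lemma expRN_taylor (x : R) : 0 <= x -> `|1 - expR (- x) - x| <= x ^+ 2.
Proof.
move=> x0; have h1 : 1 - x <= expR (- x) by exact: expR_ge1Dx.
have h2 : expR (- x) <= (1 + x)^-1.
  by rewrite expRN lef_pV2 ?posrE ?expR_gt0 ?expR_ge1Dx//; lra.
have h3 : (1 + x)^-1 <= 1 - x + x ^+ 2.
  rewrite -subr_ge0 (_ : _ - _ = x ^+ 3 / (1 + x)); last by field; rewrite gt_eqF//; lra.
  by rewrite divr_ge0 ?exprn_ge0//; lra.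
by rewrite ler_norml; have := sqr_ge0 x; lra.
Qed.

End logarithmic_scale.

(** * Limit of the characteristic functions of the normalized sums *)

Section characteristic_functions_limit.
Context {d : measure_display} {T : measurableType d} {R : realType}.
Variables (P : probability T R) (xi : nat -> {RV P >-> R[i]}).
Hypothesis xi_indep : mutually_independent xi.
Variables (mu : probability R[i] R) (M F : R[i] -> R) (C k s2 : R).
Hypothesis xi_mu : forall k, (0 < k)%N -> forall B, measurable B -> distribution P (xi k) B = mu B.
Hypotheses (mM : measurable_fun setT M) (M0 : forall w, 0 <= M w).
Hypothesis tail : forall rho : R, 0 < rho -> (mu [set w | (M w <= rho)%R] <= (C * rho ^+ 2)%:E)%E.
Hypotheses (mF : measurable_fun setT F) (k0 : 0 <= k) (s20 : 0 <= s2).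
Hypothesis FM : forall z, `|F z| <= k * (M z)^-1.
Let m := (\int[mu]_z F z)%R.
Let q rho := (\int[mu]_z (F z ^+ 2 * (rho < M z)%R%:R))%R.
Hypothesis variance : forall e : R, 0 < e -> exists2 r0 : R, 0 < r0 & forall rho, 0 < rho -> rho <= r0 ->
  `|q rho - s2 * ln rho^-1| <= e * ln rho^-1.

(** The variance truncated at 1/a_n is about s2 ln a_n, and ln a_n is half of ln n
    asymptotically. *)
Lemma cvg_truncated_variance :
  q (clt_scale n)^-1 / ln (n%:R : R) @[n --> \oo] --> (s2 / 2 : R).
Proof.
have h : q (clt_scale n)^-1 / ln (clt_scale n) @[n --> \oo] --> (s2 : R).
  apply/cvgrPdist_le => e e0; have [r0 r00 hr] := variance e0.
  near=> n.
  have a1 : (2 : R) <= clt_scale n by near: n; exact: near_clt_scale_ge.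
  have a0 : (0 : R) < clt_scale n by lra.
  have a2 : r0^-1 <= clt_scale n by near: n; exact: near_clt_scale_ge.
  have lna : (0 : R) < ln (clt_scale n) by rewrite ln_gt0//; lra.
  have := hr (clt_scale n)^-1; rewrite invr_gt0 => /(_ a0).
  rewrite invrK -[X in _ <= X]invrK lef_pV2 ?posrE ?invr_gt0// => /(_ a2) h.
  rewrite (_ : s2 - _ = - (q (clt_scale n)^-1 - s2 * ln (clt_scale n)) / ln (clt_scale n)); last first.
    by field; rewrite gt_eqF.
  by rewrite normrM normrN (gtr0_norm (x := _^-1)) ?invr_gt0// ler_pdivrMr.
have h2 : q (clt_scale n)^-1 / ln (clt_scale n) * (ln (clt_scale n) / ln (n%:R : R)) @[n --> \oo]
    --> (s2 / 2 : R) by apply: cvgM => //; exact: cvg_ln_clt_scale.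
apply: cvg_trans h2; apply: near_eq_cvg; near=> n.
have a1 : (2 : R) <= clt_scale n by near: n; exact: near_clt_scale_ge.
have lna : (0 : R) < ln (clt_scale n) by rewrite ln_gt0//; lra.
by rewrite mulrA divfK// gt_eqF.
Unshelve. all: by end_near.
Qed.

Lemma cvg_char th :
  (\int[P]_w cos (th + scaled_sum xi F m (clt_scale n) n w))%R @[n --> \oo] -->
  (expR (- (s2 / 4)) * cos th).
Proof.
have [K hK] := one_step_char mM M0 tail mF k0 FM.
(* One factor 1/2 comes from the truncated variance, the other from the Taylor expansion of the
   cosine. *)
pose la := s2 / 4.
pose u n : R := 2 * K * (ln (n%:R : R))^-1 + la ^+ 2 * (ln (n%:R : R))^-1 +
   `|la - q (clt_scale n)^-1 / ln (n%:R : R) / 2|.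
have u0 : u n @[n --> \oo] --> (0 : R).
  rewrite [X in _ --> X](_ : 0 = 2 * K * 0 + la ^+ 2 * 0 + `|la - s2 / 2 / 2|); last first.
    rewrite /la (_ : s2 / 4 - s2 / 2 / 2 = 0); first by rewrite !mulr0 normr0 !addr0.
    by field.
  apply: cvgD; first apply: cvgD.
  - by apply: cvgMr; exact: cvg_invln.
  - by apply: cvgMr; exact: cvg_invln.
  - apply: cvg_norm; apply: cvgB; first exact: cvg_cst.
    by apply: cvgMl; exact: cvg_truncated_variance.
apply/cvgrPdist_le => e e0; near=> n.
have un : u n <= e.
  near: n; have /cvgrPdist_le/(_ _ e0)[N _ h] := u0; exists N => // n Nn.
  by have := h n Nn; rewrite sub0r normrN; apply: le_trans; exact: ler_norm.
have a1 : (1 : R) <= clt_scale n by near: n; exact: near_clt_scale_ge.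
have L1 : 1 <= ln (n%:R : R) by near: n; exact: near_ln_ge.
have n0 : (0 < n)%N by near: n; exists 1%N.
have n0' : 0 < (n%:R : R) by rewrite ltr0n.
have [c1 c2] := hK _ a1.
(* Chosen so that its n-th power is exactly the limit; the telescoping then compares each step with
   [r]. *)
pose r := expR (- (la / n%:R)).
have la0 : 0 <= la by rewrite divr_ge0.
have r01 : 0 <= r <= 1.
  by rewrite expR_ge0/= -expR0 ler_expR oppr_le0 divr_ge0.
have := char_telescoping xi_indep xi_mu mF m (clt_scale n) n th r01.
have -> : r ^+ n = expR (- (s2 / 4)).
  by rewrite /r -expRM_natr; congr expR; rewrite /la; field; rewrite gt_eqF.
rewrite distrC => /le_trans; apply; apply: le_trans un.
rewrite /u.
set Ec := (\int[mu]_x cos _)%R; set Es := (\int[mu]_x sin _)%R.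
have a2 := clt_scale_sqr n0.
set a := clt_scale n in a1 c1 c2 a2 *.
have h1 : `|Ec - r| <= K / a ^+ 2 + `|1 - q a^-1 / a ^+ 2 / 2 - r|.
  rewrite (_ : Ec - r = (Ec - (1 - q a^-1 / a ^+ 2 / 2)) + (1 - q a^-1 / a ^+ 2 / 2 - r)); last by ring.
  by apply: le_trans (ler_normD _ _) _; rewrite lerD2r.
(* As a^2 = n ln n, the difference splits into the second-order error of exp (- la / n) and the
   error in the limit of the truncated variance; ln n <= n then puts the first on the scale 1 / ln
   n. *)
have h2 : n%:R * `|1 - q a^-1 / a ^+ 2 / 2 - r| <= la ^+ 2 * (ln (n%:R : R))^-1 + `|la - q a^-1 / ln (n%:R : R) / 2|.
  rewrite -{1}(ger0_norm (ltW n0')) -normrM.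
  rewrite (_ : n%:R * _ = n%:R * (1 - r - la / n%:R) + (la - q a^-1 / ln (n%:R : R) / 2)); last first.
    by rewrite a2; field; rewrite !gt_eqF//; lra.
  apply: le_trans (ler_normD _ _) _; rewrite lerD2r normrM ger0_norm//.
  have x0 : 0 <= la / n%:R by rewrite divr_ge0.
  apply: le_trans (ler_wpM2l (ltW n0') (expRN_taylor x0)) _.
  rewrite (_ : n%:R * _ = la ^+ 2 / n%:R); last by field; rewrite gt_eqF.
  rewrite ler_wpM2l ?sqr_ge0// lef_pV2 ?posrE//; last by lra.
  exact/ltW/ln_sublinear.
have h3 : n%:R * (K / a ^+ 2) = K * (ln (n%:R : R))^-1.
  by rewrite a2; field; rewrite !gt_eqF//; lra.
apply: (@le_trans _ _ (n%:R * (K / a ^+ 2 + `|1 - q a^-1 / a ^+ 2 / 2 - r| + K / a ^+ 2))).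
  by rewrite ler_wpM2l ?(ltW n0')// lerD.
rewrite !mulrDr h3; lra.
Unshelve. all: by end_near.
Qed.

End characteristic_functions_limit.

(** * Moments of the Cauchy kernel at a continuity point of the density *)

Section planar_integral.
Context {R : realType}.
Notation leb := (@lebesgue_measure R).

Lemma lebesgue_measure_reflect (c : R) (A : set R) : measurable A ->
  pushforward leb (fun x : measurableTypeR R => (c - x)%R : measurableTypeR R) A = leb A.
Proof.
move=> mA; apply/esym/lebesgue_measure_unique => //=; first exact: measurable_funB.
move=> mr _ [[a b]] _ <-.
rewrite /pushforward.
rewrite (_ : _ @^-1` _ = `[(c - b)%R, (c - a)%R[%classic); last first.
  by apply/seteqP; split=> x /=; rewrite !in_itv/= => /andP[? ?]; apply/andP; split; lra.
rewrite !lebesgue_measure_itv/= !lte_fin ltrD2l ltrN2.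
by case: ifPn => // _; rewrite -!EFinD; congr (_%:E); ring.
Qed.

Lemma ge0_integral_reflect (c : R) (f : R -> \bar R) : measurable_fun setT f ->
  (forall x, 0 <= f x)%E -> (\int[leb]_x f (c - x)%R = \int[leb]_x f x)%E.
Proof.
move=> mf f0.
have mr : measurable_fun setT (fun x : measurableTypeR R => (c - x)%R : measurableTypeR R).
  by apply: measurable_funB.
have := @ge0_integral_pushforward _ _ _ _ R _ mr leb setT f measurableT mf (fun x _ => f0 x).
rewrite preimage_setT => <-.
by apply: eq_measure_integral => //= A mA _; rewrite -(lebesgue_measure_reflect c mA).
Qed.

(** Inner integral over a section |y| <= |x| of the double cone at abscissa [x], of either sign; the
    integrand is the square of a linear form in the two parts of 1/z. *)
Lemma integral_quadratic (a x al be : R) : (0 < a)%R -> (x ^+ 2 = a ^+ 2)%R ->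
  (\int[leb]_(y in `[(- a)%R, a]) (((al * x - be * y) / (x ^+ 2 + y ^+ 2)) ^+ 2)%:E =
  ((al ^+ 2 * (pi + 2) + be ^+ 2 * (pi - 2)) / (4 * a))%:E)%E.
Proof.
move=> a0 xa.
have pos (y : R) : (0 < a ^+ 2 + y ^+ 2)%R by rewrite ltr_wpDr ?sqr_ge0// exprn_gt0.
(* An antiderivative. At y = a and y = -a the arctangents are pi/4 and -pi/4, and the term in
   [al * be], even in y, cancels. *)
pose G (y : R) : R := (al ^+ 2 * (y / (2 * (a ^+ 2 + y ^+ 2)) + atan (y / a) / (2 * a))
  + be ^+ 2 * (- y / (2 * (a ^+ 2 + y ^+ 2)) + atan (y / a) / (2 * a))
  + al * be * x / (a ^+ 2 + y ^+ 2))%R.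
have dG (y : R) : is_derive y (1 : R) G (((al * x - be * y) / (x ^+ 2 + y ^+ 2)) ^+ 2)%R.
  have n1 : (a ^+ 2 + y ^+ 2 != 0)%R by rewrite gt_eqF.
  have n2 : (2 * (a ^+ 2 + y ^+ 2) != 0)%R by rewrite mulf_neq0.
  apply: is_derive_eq; rewrite /GRing.scale/= xa.
  have n3 : (1 + (y / a) ^+ 2 != 0)%R by rewrite gt_eqF// ltr_wpDr ?sqr_ge0.
  have n4 : (a != 0)%R by rewrite gt_eqF.
  transitivity ((al ^+ 2 * a ^+ 2 - 2 * al * be * x * y + be ^+ 2 * y ^+ 2) / (a ^+ 2 + y ^+ 2) ^+ 2).
    by field; rewrite n4 n1.
  by rewrite expr_div_n; congr (_ / _); rewrite -xa; ring.
have cf : {within `[(- a)%R, a], continuous (fun y => (((al * x - be * y) / (x ^+ 2 + y ^+ 2)) ^+ 2)%R)}.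
  apply: continuous_subspaceT => y.
  have n1 : (x ^+ 2 + y ^+ 2 != 0)%R by rewrite xa gt_eqF.
  apply: differentiable_continuous; apply/derivable1_diffP.
  exact: ex_derive.
rewrite (@continuous_FTC2 _ _ G).
- rewrite -EFinB; congr (_%:E).
  have e1 : atan (a / a) = pi / 4 :> R by rewrite divff ?gt_eqF// atan1.
  have e2 : atan (- a / a) = - (pi / 4) :> R by rewrite mulNr atanN e1.
  rewrite /G e1 e2 sqrrN; field; rewrite (gt_eqF a0) gt_eqF// addr_gt0// exprn_gt0.
- by rewrite gtrN.
- exact: cf.
- have cG : continuous G.
    by move=> y; apply: differentiable_continuous; apply/derivable1_diffP; have [] := dG y.
  split => [y _||]; [by have [] := dG y|exact/cvg_at_right_filter/cG|exact/cvg_at_left_filter/cG].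
- by move=> y _; rewrite derive1E; apply: derive_val.
Qed.

Lemma integral_inv_norm (r dl c : R) : 0 < r -> r < dl -> 0 <= c ->
  (\int[leb]_x (c / `|x| * ((r < `|x|) && (`|x| <= dl))%R%:R)%:E = (2 * c * ln (dl / r))%:E)%E.
Proof.
move=> r0 rdl c0.
pose f (x : R) : R := c / `|x| * ((r < `|x|) && (`|x| <= dl))%R%:R.
have mabs : measurable_fun setT (fun x : R => `|x|) by exact: normr_measurable.
have mf : measurable_fun setT f.
  apply: measurable_funM; first by apply: measurable_funM => //; exact: measurable_funinv.
  by apply: measurable_bool_R; apply: measurable_and; [exact: measurable_fun_ltr|exact: measurable_fun_ler].
have f0 x : 0 <= f x by rewrite /f !mulr_ge0 ?invr_ge0.
have mEf : measurable_fun setT (EFin \o f) by exact/measurable_EFinP.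
have half : (\int[leb]_(x in `[0%R, +oo[) (f x)%:E = (c * ln (dl / r))%:E)%E.
  rewrite integral_mkcond.
  transitivity (\int[leb]_(x in `]r, dl]) (c / x)%:E)%E.
    rewrite [RHS]integral_mkcond; apply: eq_integral => x _ /=; rewrite !patchE.
    rewrite !mem_setE /= !in_itv/= /f andbT.
    case: (leP 0 x) => x0; last by rewrite [r < x]ltNge (ltW (lt_trans x0 r0)).
    rewrite ger0_norm//; case: ifPn => /= _; first by rewrite mulr1.
    by rewrite mulr0.
  rewrite integral_itv_obnd_cbnd; last first.
    apply/measurable_EFinP/measurable_funTS; apply: measurable_funM => //; exact: measurable_funinv.
  have dG (y : R) : 0 < y -> is_derive y (1 : R) (fun y => c * ln y) (c / y).
    by move=> y0; have dln := is_derive1_ln y0; apply: is_derive_eq; rewrite /GRing.scale/=; ring.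
  have cG (y : R) : 0 < y -> {for y, continuous (fun y : R => c * ln y)}.
    move=> y0; apply: differentiable_continuous; apply/derivable1_diffP.
    by have [] := dG y y0.
  rewrite (@continuous_FTC2 _ _ (fun y => c * ln y))//.
  - by rewrite -EFinB -mulrBr ln_div// ?posrE// (lt_trans r0).
  - apply: continuous_in_subspaceT => y; rewrite inE/= in_itv/= => /andP[ry _].
    have y0 : 0 < y by exact: lt_le_trans ry.
    by apply: cvgM; [exact: cvg_cst|apply: inv_continuous; rewrite gt_eqF].
  - split.
    + by move=> y; rewrite in_itv/= => /andP[ry _]; have [] := dG y (lt_trans r0 ry).
    + exact/cvg_at_right_filter/cG.
    + by apply/cvg_at_left_filter/cG; exact: lt_trans rdl.
  - move=> y; rewrite in_itv/= => /andP[ry _]; have yd := dG y (lt_trans r0 ry).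
    by rewrite derive1E; apply: derive_val.
have neg : (\int[leb]_(x in `]-oo, 0%R[) (f x)%:E = (c * ln (dl / r))%:E)%E.
  rewrite integral_itv_bndo_bndc; last exact: measurable_funTS.
  rewrite -half [RHS](ge0_integration_by_substitution0 mEf)/=; last by move=> x; rewrite lee_fin.
  by apply: eq_integral => x _; rewrite /f normrN.
rewrite -[LHS]/(\int[leb]_x (f x)%:E)%E (_ : setT = `]-oo, 0%R[%classic `|` `[0%R, +oo[%classic); last first.
  by rewrite -setCitvr setUC setUv.
rewrite ge0_integral_setU//=.
- by rewrite neg half -EFinD; congr (_%:E); ring.
- exact: measurable_funTS.
- by move=> x _; rewrite lee_fin.
- rewrite disj_set2E; apply/eqP/seteqP; split=> x //= [].
  by rewrite !in_itv/= andbT => ? ?; lra.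
Qed.

End planar_integral.

(** * Integrals of the squared kernel over square annuli *)

Section planar_region.
Context {R : realType}.
Notation leb := (@lebesgue_measure R).

Section coordinates.
Variables s t r dl : R.
Hypotheses (r0 : 0 < r) (rdl : r < dl).

Let Q (x y : R) : R := ((s * x - t * y) / (x ^+ 2 + y ^+ 2)) ^+ 2.
(** The square annulus is cut along the diagonals: the sup norm is |x| on the part carried by [H1]
    and |y| on that of [H2]. The diagonal belongs to [H1] only. *)
Let H1 (x y : R) : R := Q x y * (`|y| <= `|x|)%R%:R * ((r < `|x|) && (`|x| <= dl))%R%:R.
Let H2 (x y : R) : R := Q x y * (`|x| < `|y|)%R%:R * ((r < `|y|) && (`|y| <= dl))%R%:R.

Let Q0 x y : 0 <= Q x y. Proof. exact: sqr_ge0. Qed.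
Let H10 x y : 0 <= H1 x y. Proof. by apply: mulr_ge0 => //; apply: mulr_ge0. Qed.
Let H20 x y : 0 <= H2 x y. Proof. by apply: mulr_ge0 => //; apply: mulr_ge0. Qed.

Let mabs d (S : measurableType d) (f : S -> R) : measurable_fun setT f ->
  measurable_fun setT (fun x => `|f x|).
Proof. by move=> mf; apply: measurableT_comp mf; exact: normr_measurable. Qed.

Let mQ : measurable_fun [set: R * R] (fun p => Q p.1 p.2).
Proof.
apply: measurable_funX; apply: measurable_funM.
  by apply: measurable_funB; exact: measurable_funM.
by apply: measurable_funinv; apply: measurable_funD; exact: measurable_funX.
Qed.

Let mH1 : measurable_fun [set: R * R] (fun p => H1 p.1 p.2).
Proof.
apply: measurable_funM; first apply: measurable_funM => //.
  by apply: measurable_bool_R; apply: measurable_fun_ler; exact: mabs.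
apply: measurable_bool_R; apply: measurable_and.
  by apply: measurable_fun_ltr => //; exact: mabs.
by apply: measurable_fun_ler => //; exact: mabs.
Qed.

Let mH2 : measurable_fun [set: R * R] (fun p => H2 p.1 p.2).
Proof.
apply: measurable_funM; first apply: measurable_funM => //.
  by apply: measurable_bool_R; apply: measurable_fun_ltr; exact: mabs.
apply: measurable_bool_R; apply: measurable_and.
  by apply: measurable_fun_ltr => //; exact: mabs.
by apply: measurable_fun_ler => //; exact: mabs.
Qed.

Let c (a b : R) : R := (a ^+ 2 * (pi + 2) + b ^+ 2 * (pi - 2)) / 4.

Let c0 a b : 0 <= c a b.
Proof.
have p2 := @pi_ge2 R.
rewrite /c divr_ge0// addr_ge0// mulr_ge0 ?sqr_ge0//; lra.
Qed.

Let I1 : (\int[leb]_x \int[leb]_y (H1 x y)%:E = (2 * c s t * ln (dl / r))%:E)%E.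
Proof.
rewrite -integral_inv_norm//; apply: eq_integral => x _.
case: (boolP ((r < `|x|) && (`|x| <= dl))) => hx; last first.
  rewrite mulr0; apply: integral0_eq => y _.
  by rewrite /H1 (negbTE hx) mulr0.
have x0 : 0 < `|x| by move/andP: hx => [h _]; exact: lt_trans r0 h.
rewrite mulr1.
have -> : c s t / `|x| = (s ^+ 2 * (pi + 2) + t ^+ 2 * (pi - 2)) / (4 * `|x|).
  by rewrite /c invfM mulrA.
rewrite -(integral_quadratic _ _ x0 (x := x)); last by rewrite real_normK// num_real.
rewrite [RHS]integral_mkcond; apply: eq_integral => y _ /=.
rewrite /H1 hx mulr1 patchE mem_setE in_itv/= -ler_norml.
by case: (leP `|y| `|x|) => _; rewrite ?mulr1 ?mulr0.
Qed.

Let I2 : (\int[leb]_x \int[leb]_y (H2 x y)%:E = (2 * c t s * ln (dl / r))%:E)%E.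
Proof.
rewrite (@fubini_tonelli _ _ _ _ _ leb leb (fun p => (H2 p.1 p.2)%:E))/=; last 2 first.
- exact/measurable_EFinP.
- by move=> p; rewrite lee_fin.
rewrite -integral_inv_norm//; apply: eq_integral => y _.
case: (boolP ((r < `|y|) && (`|y| <= dl))) => hy; last first.
  rewrite mulr0; apply: integral0_eq => x _.
  by rewrite /H2 (negbTE hy) mulr0.
have y0 : 0 < `|y| by move/andP: hy => [h _]; exact: lt_trans r0 h.
rewrite mulr1.
have -> : c t s / `|y| = (t ^+ 2 * (pi + 2) + s ^+ 2 * (pi - 2)) / (4 * `|y|).
  by rewrite /c invfM mulrA.
rewrite -(integral_quadratic _ _ y0 (x := y)); last by rewrite real_normK// num_real.
have mE : measurable_fun setT (fun x : R => (((t * y - s * x) / (y ^+ 2 + x ^+ 2)) ^+ 2)%:E).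
  apply/measurable_EFinP; apply: measurable_funX; apply: measurable_funM.
    by apply: measurable_funB => //; exact: measurable_funM.
  by apply: measurable_funinv; apply: measurable_funD => //; exact: measurable_funX.
rewrite -integral_itv_bndo_bndc; last exact: measurable_funTS.
rewrite -integral_itv_obnd_cbnd; last exact: measurable_funTS.
rewrite [RHS]integral_mkcond; apply: eq_integral => x _ /=.
rewrite /H2 hy mulr1 patchE mem_setE in_itv/= -ltr_norml.
have -> : Q x y = ((t * y - s * x) / (y ^+ 2 + x ^+ 2)) ^+ 2.
  by rewrite /Q -(sqrrN (_ / _)) -mulNr opprB [x ^+ 2 + _]addrC.
by case: (ltP `|x| `|y|) => _; rewrite ?mulr1 ?mulr0.
Qed.

(** The two cones contribute the coefficients pi + 2 and pi - 2 in exchanged roles, so the sum is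
    isotropic, with the same value pi (s^2 + t^2) ln (dl / r) as for round annuli. *)
Lemma integral_planar_region :
  (\int[leb]_x \int[leb]_y (((s * x - t * y) / (x ^+ 2 + y ^+ 2)) ^+ 2 *
      ((r < Num.max `|x| `|y|) && (Num.max `|x| `|y| <= dl))%R%:R)%:E =
  (pi * (s ^+ 2 + t ^+ 2) * ln (dl / r))%:E)%E.
Proof.
have -> : pi * (s ^+ 2 + t ^+ 2) * ln (dl / r) = 2 * c s t * ln (dl / r) + 2 * c t s * ln (dl / r).
  by rewrite /c; field.
rewrite EFinD -I1 -I2.
have mE1 : measurable_fun setT (fun p : R * R => (H1 p.1 p.2)%:E) by exact/measurable_EFinP.
have mE2 : measurable_fun setT (fun p : R * R => (H2 p.1 p.2)%:E) by exact/measurable_EFinP.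
rewrite -ge0_integralD//; last 4 first.
- by move=> x _; apply: integral_ge0 => y _; rewrite lee_fin.
- by apply: (@measurable_fun_fubini_tonelli_F _ _ _ _ _ leb (fun p => (H1 p.1 p.2)%:E)) => // p; rewrite lee_fin.
- by move=> x _; apply: integral_ge0 => y _; rewrite lee_fin.
- by apply: (@measurable_fun_fubini_tonelli_F _ _ _ _ _ leb (fun p => (H2 p.1 p.2)%:E)) => // p; rewrite lee_fin.
apply: eq_integral => x _; rewrite -ge0_integralD//; last 4 first.
- by move=> y _; rewrite lee_fin.
- exact: (measurableT_comp mE1 (pair1_measurable x)).
- by move=> y _; rewrite lee_fin.
- exact: (measurableT_comp mE2 (pair1_measurable x)).
apply: eq_integral => y _; rewrite -EFinD; congr (_%:E); rewrite /H1 /H2 -/(Q x y).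
by case: (ltP `|x| `|y|) => _; rewrite ?mulr1 ?mulr0 ?mul0r ?add0r ?addr0.
Qed.

End coordinates.

Lemma ge0_integral_complex_lebesgue (h : R[i] -> \bar R) : measurable_fun setT h ->
  (forall z, 0 <= h z)%E ->
  (\int[complex_lebesgue]_z h z = \int[leb]_x \int[leb]_y h (x +i* y))%E.
Proof.
move=> mh h0; rewrite /complex_lebesgue.
transitivity (\int[pushforward (leb \x leb)%E (@complex_of_pair R)]_z h z)%E; first by [].
have mc := @measurable_complex_of_pair R.
rewrite (ge0_integral_pushforward mc)//.
rewrite preimage_setT fubini_tonelli1//.
  by apply: measurableT_comp.
by move=> x /=; exact: h0.
Qed.

(* Squares instead of disks: the truncated integrals are then iterated
   one-dimensional ones and no polar coordinates are needed. *)
Definition supnorm (z : R[i]) : R := Num.max `|Re z| `|Im z|.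

Lemma measurable_supnorm : measurable_fun setT supnorm.
Proof.
apply: measurable_maxr.
  by apply: (measurableT_comp (@normr_measurable R setT)); exact: measurable_Re.
by apply: (measurableT_comp (@normr_measurable R setT)); exact: measurable_Im.
Qed.

Lemma supnorm_ge0 z : 0 <= supnorm z.
Proof. by rewrite /supnorm le_max normr_ge0. Qed.

End planar_region.

(** * Tail and truncated variance at a continuity point of the density *)

Section local_density.
Context {R : realType}.
Variables (mu : probability R[i] R) (p : R[i] -> R) (u : R[i]).
Hypotheses (mp : measurable_fun setT p) (p0 : forall z, 0 <= p z).
Hypothesis muE : forall B, measurable B -> mu B = (\int[complex_lebesgue]_(z in B) (p z)%:E)%E.
Hypothesis cu : {for u, continuous p}.
Notation leb := (@lebesgue_measure R).
Notation CL := (@complex_lebesgue R).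

Let msub : measurable_fun setT (fun z : R[i] => u - z).
Proof. by apply: measurable_funCB. Qed.

(** Reflection and translation of both coordinates put the singularity at the origin and move the
    dependence on [u] into the density. *)
Lemma ge0_integral_translate (k : R[i] -> R) : measurable_fun setT k -> (forall z, 0 <= k z) ->
  (\int[mu]_z (k (u - z))%:E = \int[CL]_z (k z * p (u - z))%:E)%E.
Proof.
move=> mk k0.
have mkp : measurable_fun setT (fun z => k z * p (u - z)).
  by apply: measurable_funM => //; exact: (measurableT_comp mp msub).
pose phi (x y : R) := (k (x +i* y) * p (u - (x +i* y)))%:E.
have mphi : measurable_fun setT (fun q : R * R => phi q.1 q.2).
  have /measurable_EFinP mE := mkp.
  exact: (measurableT_comp mE (@measurable_complex_of_pair R)).
have phi0 x y : (0 <= phi x y)%E by rewrite lee_fin mulr_ge0.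
have mku : measurable_fun setT (fun z : R[i] => (k (u - z))%:E).
  by apply/measurable_EFinP; exact: (measurableT_comp mk msub).
rewrite (ge0_integral_density mp p0 muE mku); last by move=> z; rewrite lee_fin.
rewrite (@ge0_integral_complex_lebesgue R (fun z => (k (u - z))%:E * (p z)%:E)%E); last 2 first.
- by apply: emeasurable_funM => //; exact/measurable_EFinP.
- by move=> z; rewrite -EFinM lee_fin mulr_ge0.
rewrite (@ge0_integral_complex_lebesgue R (fun z => (k z * p (u - z))%:E)); last 2 first.
- exact/measurable_EFinP.
- by move=> z; rewrite lee_fin mulr_ge0.
transitivity (\int[leb]_x \int[leb]_y phi (Re u - x)%R (Im u - y)%R)%E.
  apply: eq_integral => x _; apply: eq_integral => y _; rewrite /phi -EFinM.
  have -> : ((Re u - x) +i* (Im u - y))%R = u - (x +i* y) :> R[i] by case: (u).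
  by rewrite subKr.
under eq_integral => x _.
  rewrite (@ge0_integral_reflect R (Im u) (phi (Re u - x)))//; last first.
    exact: (measurableT_comp mphi (pair1_measurable (Re u - x))).
  over.
rewrite (@ge0_integral_reflect R (Re u) (fun x => \int[leb]_y phi x y)%E)//.
- exact: (@measurable_fun_fubini_tonelli_F _ _ _ _ _ leb (fun q => phi q.1 q.2)).
- by move=> x; exact: integral_ge0.
Qed.

Let near_u (e : R) : 0 < e ->
  exists2 dl : R, 0 < dl & forall z, supnorm z <= dl -> `|p (u - z) - p u| <= e.
Proof.
move=> e0; move: cu => /cvg_complexP /(_ _ e0)[dl dl0 h].
exists (dl / 2); first by rewrite divr_gt0.
move=> z; rewrite /supnorm ge_max => /andP[z1 z2].
apply/ltW/h; rewrite ?ReB ?ImB addrAC subrr add0r normrN.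
  by apply: le_lt_trans z1 _; rewrite ltr_pdivrMr// ltr_pMr// ltr1n.
by apply: le_lt_trans z2 _; rewrite ltr_pdivrMr// ltr_pMr// ltr1n.
Qed.

Let mbox (rho : R) : measurable_fun setT (fun z : R[i] => (supnorm z <= rho)%R%:R : R).
Proof. exact: (measurable_le_cst (@measurable_supnorm R)). Qed.

Lemma integral_square (rho : R) : 0 < rho ->
  (\int[CL]_z ((supnorm z <= rho)%R%:R)%:E = (4 * rho ^+ 2)%:E)%E.
Proof.
move=> r0; rewrite ge0_integral_complex_lebesgue; last 2 first.
- exact/measurable_EFinP.
- by move=> z; rewrite lee_fin.
have I : (\int[leb]_x (`|x| <= rho)%R%:R%:E = (2 * rho)%:E)%E.
  transitivity (leb `[- rho, rho]).
    rewrite -[RHS](congr1 leb (setIT _)) -integral_indic//.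
    by apply: eq_integral => x _; rewrite indicE mem_setE in_itv/= -ler_norml.
  rewrite lebesgue_measure_itv/= lte_fin ifT; last by lra.
  by rewrite -EFinB; congr EFin; ring.
transitivity (\int[leb]_x (2 * rho * (`|x| <= rho)%R%:R)%:E)%E.
  apply: eq_integral => x _; case: (boolP (`|x| <= rho)%R) => hx.
    rewrite mulr1 -I; apply: eq_integral => y _.
    by rewrite /supnorm/= ge_max hx.
  by rewrite mulr0; apply: integral0_eq => y _; rewrite /supnorm/= ge_max (negbTE hx).
under eq_integral => x _ do rewrite EFinM.
rewrite ge0_integralZl_EFin//.
- by rewrite I -EFinM; congr (_%:E); ring.
- apply/measurable_EFinP; apply: measurable_bool_R; apply: measurable_fun_ler => //.
- by rewrite mulr_ge0// ltW.
Qed.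

Lemma density_tail : exists C : R, forall rho : R, 0 < rho ->
  (mu [set z | (supnorm (u - z) <= rho)%R] <= (C * rho ^+ 2)%:E)%E.
Proof.
have [dl dl0 hd] := near_u ltr01.
(* For rho <= dl the density is at most p u + 1 on a square of area 4 rho^2; for rho > dl the
   trivial bound 1 is below rho^2 / dl^2. *)
exists ((p u + 1) * 4 + dl ^- 2) => rho r0.
have pu0 := p0 u.
case: (leP rho dl) => rd; last first.
  apply: le_trans (probability_le1 _ _) _ => //.
    have := measurableT_comp (@measurable_supnorm R) msub.
    move=> ms; rewrite -[X in measurable X]setTI.
    exact: (measurable_fun_ler ms (@measurable_cst _ _ _ _ setT rho) measurableT (Y := [set true])).
  rewrite lee_fin mulrDl; apply: ler_wpDl; first by apply: mulr_ge0; rewrite ?sqr_ge0//; lra.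
  rewrite -exprVn -exprMn mulrC -[leLHS](expr1n _ 2) lerXn2r// ?nnegrE ?divr_ge0 ?ltW//.
  by rewrite ltr_pdivlMr// mul1r.
have mB : measurable [set z | (supnorm (u - z) <= rho)%R].
  have := measurableT_comp (@measurable_supnorm R) msub.
  move=> ms; rewrite -[X in measurable X]setTI.
  exact: (measurable_fun_ler ms (@measurable_cst _ _ _ _ setT rho) measurableT (Y := [set true])).
have -> : mu [set z | (supnorm (u - z) <= rho)%R] =
    (\int[mu]_z ((supnorm (u - z) <= rho)%R%:R)%:E)%E.
  rewrite -[LHS](congr1 mu (setIT _)) -integral_indic//; apply: eq_integral => z _.
  by rewrite indicE; congr ((nat_of_bool _)%:R%:E); apply/idP/idP => [/set_mem//|h]; exact/mem_set.
rewrite (@ge0_integral_translate (fun z => (supnorm z <= rho)%R%:R))//.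
have I := integral_square r0.
apply: (@le_trans _ _ (\int[CL]_z ((p u + 1) * (supnorm z <= rho)%R%:R)%:E)%E).
  apply: ge0_le_integral => //.
  - by move=> z _; rewrite lee_fin mulr_ge0.
  - apply/measurable_EFinP/measurable_funM => //; exact: (measurableT_comp mp msub).
  - by apply/measurable_EFinP/measurable_funM.
  - move=> z _; rewrite lee_fin; case: (boolP (_ <= rho)%R) => hz; last by rewrite mul0r mulr0.
    rewrite mul1r mulr1; have := hd z (le_trans hz rd); rewrite ler_norml; lra.
under eq_integral => x _ do rewrite EFinM.
rewrite ge0_integralZl_EFin//; last 2 first.
- exact/measurable_EFinP.
- by lra.
rewrite I -EFinM lee_fin mulrA [leRHS]mulrDl lerDl mulr_ge0 ?sqr_ge0//.
by rewrite invr_ge0 sqr_ge0.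
Qed.

Variables s t : R.
Let G (z : R[i]) : R := s * Re (z^-1 : R[i]) + t * Im (z^-1 : R[i]).
Let k := `|s| + `|t|.

(** Each part of 1/z is at most 1/|z|, and |z| dominates the sup norm; at z = 0 both sides are 0. *)
Lemma linear_inverse_le (z : R[i]) : `|G z| <= k * (supnorm z)^-1.
Proof.
have k0 : 0 <= k by rewrite addr_ge0.
have [z0|z0] := eqVneq (supnorm z) 0.
  have : (supnorm z <= 0)%R by rewrite z0.
  rewrite /supnorm ge_max !normr_le0 => /andP[/eqP a /eqP b].
  by rewrite /G ReV ImV a b oppr0 !mul0r !mulr0 addr0 normr0 mulr_ge0// invr_ge0 supnorm_ge0.
have s0 : 0 < supnorm z by rewrite lt_def z0 supnorm_ge0.
have D : supnorm z ^+ 2 <= Re z ^+ 2 + Im z ^+ 2.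
  rewrite /supnorm; case: (leP `|Re z| `|Im z|) => _; rewrite real_normK ?num_real//.
    by rewrite lerDr sqr_ge0.
  by rewrite lerDl sqr_ge0.
have D0 : 0 < Re z ^+ 2 + Im z ^+ 2 by apply: lt_le_trans D; rewrite exprn_gt0.
have B (a : R) : `|a| <= supnorm z -> `|a / (Re z ^+ 2 + Im z ^+ 2)| <= (supnorm z)^-1.
  move=> ha; rewrite normrM normfV (gtr0_norm D0) ler_pdivrMr// mulrC ler_pdivlMr//.
  by apply: le_trans D; rewrite expr2 ler_wpM2r// ltW.
rewrite /G /k mulrDl ReV ImV; apply: le_trans (ler_normD _ _) _.
rewrite !normrM; apply: lerD; apply: ler_wpM2l => //; rewrite -?normrM -?normfV -?normrM; apply: B.
  by rewrite /supnorm le_max lexx.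
by rewrite normrN /supnorm le_max lexx orbT.
Qed.

Let mG : measurable_fun setT G.
Proof.
by apply: measurable_funD; apply: measurable_funM => //; [apply: (measurableT_comp (@measurable_Re R))|apply: (measurableT_comp (@measurable_Im R))]; exact: measurable_funCV.
Qed.

Let c := pi * (s ^+ 2 + t ^+ 2).
Let ann (r dl : R) (z : R[i]) : R := G z ^+ 2 * ((r < supnorm z) && (supnorm z <= dl))%R%:R.

Let mann r dl : measurable_fun setT (ann r dl).
Proof.
apply: measurable_funM; first exact: measurable_funX.
apply: measurable_bool_R; apply: measurable_and; [apply: measurable_fun_ltr|apply: measurable_fun_ler] => //; exact: measurable_supnorm.
Qed.

Let ann0 r dl z : 0 <= ann r dl z.
Proof. by apply: mulr_ge0 => //; exact: sqr_ge0. Qed.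

Let integral_ann r dl : 0 < r -> r < dl -> (\int[CL]_z (ann r dl z)%:E = (c * ln (dl / r))%:E)%E.
Proof.
move=> r0 rd; rewrite ge0_integral_complex_lebesgue; last 2 first.
- exact/measurable_EFinP.
- by move=> z; rewrite lee_fin.
rewrite -(integral_planar_region s t r0 rd); apply: eq_integral => x _; apply: eq_integral => y _.
congr (_%:E); rewrite /ann /G ReV ImV /supnorm/=; congr (_ ^+ 2 * _).
by rewrite mulNr mulrN mulrBl !mulrA.
Qed.

Let integral_ann_mu (e r dl : R) : 0 < e -> 0 < r -> r < dl ->
  (forall z, supnorm z <= dl -> `|p (u - z) - p u| <= e) ->
  `| (\int[mu]_z (ann r dl (u - z)))%R - p u * c * ln (dl / r)| <= e * c * ln (dl / r).
Proof.
move=> e0 r0 rd hd.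
have IA := integral_ann r0 rd.
have pu0 := p0 u.
have up : (\int[mu]_z (ann r dl (u - z))%:E <= ((p u + e) * (c * ln (dl / r)))%:E)%E.
  rewrite ge0_integral_translate// EFinM -IA -ge0_integralZl_EFin//; last 3 first.
  - by move=> x _; rewrite lee_fin.
  - exact/measurable_EFinP.
  - by lra.
  apply: ge0_le_integral => //.
  - by move=> z _; rewrite lee_fin mulr_ge0.
  - apply/measurable_EFinP/measurable_funM => //; exact: (measurableT_comp mp msub).
  - apply/measurable_EFinP; exact: measurable_funM.
  - move=> z _; rewrite -EFinM lee_fin mulrC /ann.
    case: (boolP (_ && _)) => [/andP[_ hz]|_]; last by rewrite !mulr0.
    rewrite mulr1; apply: ler_wpM2r; first exact: sqr_ge0.
    have := hd z hz; rewrite ler_norml; lra.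
have lo : (((p u - e) * (c * ln (dl / r)))%:E <= \int[mu]_z (ann r dl (u - z))%:E)%E.
  rewrite ge0_integral_translate//.
  case: (leP 0 (p u - e)) => pe; last first.
    apply: (@le_trans _ _ 0%E); last by apply: integral_ge0 => z _; rewrite lee_fin mulr_ge0.
    rewrite lee_fin nmulr_rle0// -lee_fin -IA.
    by apply: integral_ge0 => z _; rewrite lee_fin.
  rewrite EFinM -IA -ge0_integralZl_EFin//; last 2 first.
  - by move=> x _; rewrite lee_fin.
  - exact/measurable_EFinP.
  apply: ge0_le_integral => //.
  - by move=> z _; rewrite lee_fin mulr_ge0.
  - apply/measurable_EFinP; exact: measurable_funM.
  - apply/measurable_EFinP/measurable_funM => //; exact: (measurableT_comp mp msub).
  - move=> z _; rewrite -EFinM lee_fin mulrC /ann.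
    case: (boolP (_ && _)) => [/andP[_ hz]|_]; last by rewrite !(mulr0, mul0r).
    rewrite mulr1; apply: ler_wpM2l; first exact: sqr_ge0.
    have := hd z hz; rewrite ler_norml; lra.
have fin : (\int[mu]_z (ann r dl (u - z))%:E \is a fin_num)%E.
  rewrite ge0_fin_numE; first by apply: le_lt_trans up _; rewrite ltry.
  by apply: integral_ge0 => z _; rewrite lee_fin.
move: up lo; rewrite -(fineK fin) !lee_fin -/(Rintegral mu setT (fun z => ann r dl (u - z))).
by move=> h1 h2; rewrite ler_norml; apply/andP; split; lra.
Qed.

(** On the annulus between rho and a fixed [dl] the density is nearly p u, which gives p u c ln (dl
    / rho); all that remains is bounded, hence absorbed by ln (1 / rho). *)
Lemma density_variance (e : R) : 0 < e ->
  exists2 r0 : R, 0 < r0 & forall rho, 0 < rho -> rho <= r0 ->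
  `|(\int[mu]_z (G (u - z) ^+ 2 * (rho < supnorm (u - z))%R%:R))%R - p u * c * ln rho^-1|
    <= e * ln rho^-1.
Proof.
move=> e0.
have c0 : 0 <= c by rewrite mulr_ge0 ?pi_ge0// addr_ge0 ?sqr_ge0.
have pu0 := p0 u.
pose eta := e / (2 * (c + 1)).
have eta0 : 0 < eta by rewrite divr_gt0//; lra.
have etac : eta * c <= e / 2.
  rewrite /eta mulrAC ler_pdivrMr; [nra|lra].
have [dl dl0 hd] := near_u eta0.
pose K := (p u * c + eta * c) * `|ln dl| + k ^+ 2 / dl ^+ 2.
have K0 : 0 <= K.
  by rewrite addr_ge0 ?divr_ge0 ?sqr_ge0// mulr_ge0// addr_ge0// mulr_ge0// ltW.
(* [K] gathers the bounded terms: below this threshold [K] is at most (e / 2) ln (1 / rho), and the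
   other half of [e] pays for the oscillation of [p]. *)
exists (Num.min (dl / 2) (expR (- (2 * K / e)))).
  by rewrite lt_min expR_gt0 divr_gt0.
move=> rho r0; rewrite le_min => /andP[rd rK].
have rdl : rho < dl by apply: le_lt_trans rd _; rewrite ltr_pdivrMr// ltr_pMr// ltr1n.
have lr : 2 * K / e <= ln rho^-1.
  by rewrite lnV ?posrE// -[leLHS]opprK lerN2 -[leRHS]expRK ler_ln ?posrE// expR_gt0.
pose far (z : R[i]) : R := G z ^+ 2 * (dl < supnorm z)%R%:R.
have mfar : measurable_fun setT far.
  apply: measurable_funM; first exact: measurable_funX.
  exact: (measurable_gt_cst (@measurable_supnorm R)).
have bnd (r : R) (b : bool) z : 0 < r -> (b -> r < supnorm z) -> `|G z ^+ 2 * b%:R| <= k ^+ 2 / r ^+ 2.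
  move=> rp hb; case: b hb => [/(_ isT) hz|_]; last by rewrite mulr0 normr0 divr_ge0 ?sqr_ge0.
  have k0 : 0 <= k by rewrite addr_ge0.
  rewrite mulr1 normrX -exprVn -exprMn lerXn2r// ?nnegrE ?mulr_ge0 ?invr_ge0 ?(ltW rp)//.
  apply: le_trans (linear_inverse_le z) _; apply: ler_wpM2l => //.
  by rewrite lef_pV2 ?posrE// ?(lt_trans rp)// ltW.
have i1 : mu.-integrable setT (EFin \o (fun z => ann rho dl (u - z))).
  apply: (bounded_integrable _ (M := k ^+ 2 / rho ^+ 2)).
    exact: (measurableT_comp (@mann rho dl) msub).
  by move=> z; apply: bnd => // /andP[].
have i2 : mu.-integrable setT (EFin \o (fun z => far (u - z))).
  apply: (bounded_integrable _ (M := k ^+ 2 / dl ^+ 2)).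
    exact: (measurableT_comp mfar msub).
  by move=> z; apply: bnd.
have -> : (\int[mu]_z (G (u - z) ^+ 2 * (rho < supnorm (u - z))%R%:R))%R =
   (\int[mu]_z (ann rho dl (u - z)))%R + (\int[mu]_z (far (u - z)))%R.
  rewrite -RintegralD//; apply: eq_Rintegral => z _; rewrite /ann /far.
  case: (leP (supnorm (u - z)) dl) => h; first by rewrite andbT mulr0 addr0.
  by rewrite andbF mulr0 add0r (lt_trans rdl h).
have A := integral_ann_mu eta0 r0 rdl hd.
have B : `|(\int[mu]_z (far (u - z)))%R| <= k ^+ 2 / dl ^+ 2.
  apply: Rintegral_bound; first exact: (measurableT_comp mfar msub).
  by move=> z; apply: bnd.
have ld : ln (dl / rho) = ln dl + ln rho^-1.
  by rewrite lnM ?posrE ?invr_gt0.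
rewrite ld in A.
have L0 : 0 <= ln rho^-1 by apply: le_trans lr; apply: divr_ge0; [exact: mulr_ge0|exact: ltW].
set X := (\int[mu]_z ann _ _ _)%R in A *; set Y := (\int[mu]_z far _)%R in B *.
set L := ln rho^-1 in A lr L0 *.
have K2 : K <= e / 2 * L.
  by move: lr; rewrite ler_pdivrMr//; lra.
have -> : X + Y - p u * c * L = (X - p u * c * (ln dl + L)) + p u * c * ln dl + Y by ring.
have T1 := ler_normD (X - p u * c * (ln dl + L) + p u * c * ln dl) Y.
have T2 := ler_normD (X - p u * c * (ln dl + L)) (p u * c * ln dl).
have h1 : `|p u * c * ln dl| <= p u * c * `|ln dl| by rewrite normrM (@ger0_norm _ (p u * c))// mulr_ge0.
have h2 : eta * c * (ln dl + L) <= eta * c * `|ln dl| + e / 2 * L.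
  rewrite mulrDr; apply: lerD; last by apply: ler_wpM2r.
  by apply: ler_wpM2l; [rewrite mulr_ge0// ltW|exact: ler_norm].
move: K2; rewrite /K; lra.
Qed.

End local_density.

(** * The sum of inverses at a fixed point *)

Section complex_normal.
Context {R : realType}.
Notation N := (@normal_prob R 0 (Num.sqrt 2^-1)).

Lemma Rintegral_distribution d (T : measurableType d) d' (S : measurableType d')
    (P : probability T R) (X : {RV P >-> S}) (h : S -> R) (M : R) :
  measurable_fun setT h -> (forall z, `|h z| <= M) ->
  (\int[distribution P X]_z h z = \int[P]_w h (X w))%R.
Proof.
move=> mh hM; rewrite /Rintegral integral_distribution//; first exact/measurable_EFinP.
by apply: (bounded_integrable _ (M := M)) => //; exact: measurableT_comp.
Qed.

Lemma Rintegral_complex_std_normal (h : R[i] -> R) (M : R) :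
  measurable_fun setT h -> (forall z, `|h z| <= M) ->
  (\int[complex_std_normal]_z h z = \int[N]_x \int[N]_y h (x +i* y))%R.
Proof.
move=> mh hM.
have mH : measurable_fun setT (fun q : R * R => h (q.1 +i* q.2)).
  exact: (measurableT_comp mh (@measurable_complex_of_pair R)).
have iM : N.-integrable setT (EFin \o (fun=> M)) by apply: (bounded_integrable _ (M := `|M|)).
have iH : (N \x N)%E.-integrable setT (EFin \o (fun q : R * R => h (q.1 +i* q.2))).
  exact: (@mixture_integrable _ _ R _ _ N N _ (fun=> M) mH (fun a z => hM _) iM).
rewrite /Rintegral; congr fine.
transitivity (\int[pushforward (N \x N)%E (@complex_of_pair R)]_z (h z)%:E)%E; first by [].
rewrite (integral_pushforward (@measurable_complex_of_pair R))//; last exact/measurable_EFinP.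
rewrite preimage_setT -(integral12_prod_meas1 iH); apply: eq_integral => x _.
rewrite -[RHS]/((\int[N]_y h (x +i* y))%R%:E) EFin_Rintegral//.
apply: (bounded_integrable _ (M := M)) => //.
exact: (measurableT_comp mH (pair1_measurable x)).
Qed.

(** The Gaussian formula is applied to one coordinate after the other, the second entering through
    the phase; variance 1/2 per coordinate yields the denominator 4. *)
Lemma complex_std_normal_cos (s t th : R) :
  (\int[complex_std_normal]_z cos (s * Re z + t * Im z + th) =
   expR (- ((s ^+ 2 + t ^+ 2) / 4)) * cos th)%R.
Proof.
have s0 : 0 < Num.sqrt (2^-1 : R) by rewrite sqrtr_gt0 invr_gt0.
have ss : Num.sqrt (2^-1 : R) ^+ 2 = 2^-1 by rewrite sqr_sqrtr.
rewrite (Rintegral_complex_std_normal (M := 1)); last 2 first.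
- apply: measurable_cosf; apply: measurable_funD => //; apply: measurable_funD.
    by apply: measurable_funM => //; exact: measurable_Re.
  by apply: measurable_funM => //; exact: measurable_Im.
- by move=> z; exact: cos_le1_norm.
transitivity (\int[N]_x (expR (- (t ^+ 2 / 4)) * cos (s * x + th)))%R.
  apply: eq_Rintegral => x _ /=.
  under eq_Rintegral => y _ do rewrite addrAC [_ + t * y]addrC.
  by rewrite gauss_cosD// ss; congr (expR _ * _); field.
rewrite RintegralZl//; last first.
  apply: (bounded_integrable _ (M := 1)) => [|x]; last exact: cos_le1_norm.
  by apply: measurable_cosf; apply: measurable_funD => //; exact: measurable_funM.
rewrite gauss_cosD// mulrA -expRD ss; congr (expR _ * _); field.
by [].
Qed.
End complex_normal.

Section central_limit.
Context {d : measure_display} {T : measurableType d} {R : realType}.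
Variables (P : probability T R) (xi : nat -> {RV P >-> R[i]}).
Hypothesis xi_indep : mutually_independent xi.
Variables (mu : probability R[i] R) (p : R[i] -> R) (u : R[i]).
Hypothesis xi_mu : forall k, (0 < k)%N -> forall B, measurable B -> distribution P (xi k) B = mu B.
Hypotheses (mp : measurable_fun setT p) (p0 : forall z, 0 <= p z).
Hypothesis muE : forall B, measurable B -> mu B = (\int[complex_lebesgue]_(z in B) (p z)%:E)%E.
Hypotheses (cu : {for u, continuous p}) (pu0 : 0 < p u).

(** The Cauchy-Stieltjes transform at [u], written as an integral against the common law [mu]
    instead of an expectation. *)
Definition mean_inverse : R[i] :=
  (\int[mu]_z Re (u - z)^-1)%R +i* (\int[mu]_z Im (u - z)^-1)%R.

Definition normalized_sum (n : nat) (w : T) : R[i] :=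
  (\sum_(1 <= k < n.+1) (u - xi k w)^-1 - n%:R * mean_inverse) /
    (Num.sqrt (pi * p u) * clt_scale n)%:C.

Lemma measurable_inverse_sub k : measurable_fun setT (fun w => (u - xi k w)^-1).
Proof. by apply: measurable_funCV; apply: measurable_funCB => //; exact: measurable_funPT. Qed.

Lemma measurable_normalized_sum n : measurable_fun setT (normalized_sum n).
Proof.
apply: measurable_funCM => //; apply: measurable_funCB => //.
by apply: measurable_funC_sum => k; exact: measurable_inverse_sub.
Qed.

Lemma measurable_supnorm_sub : measurable_fun setT (fun z : R[i] => supnorm (u - z)).
Proof. by apply: (measurableT_comp (@measurable_supnorm R)); exact: measurable_funCB. Qed.

Lemma inverse_sub_integrable (s t : R) : mu.-integrable setT
  (EFin \o (fun z => s * Re (u - z)^-1 + t * Im (u - z)^-1)).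
Proof.
have [C tail] := density_tail mp p0 muE cu.
have mM := measurable_supnorm_sub.
have iM := inverse_integrable mM (fun z => supnorm_ge0 (u - z)) tail.
apply: le_integrable (integrableZl measurableT (`|s| + `|t|) iM) => //.
  have /measurable_funCP[h1 h2] : measurable_fun setT (fun z : R[i] => (u - z)^-1).
    by apply: measurable_funCV; exact: measurable_funCB.
  by apply/measurable_EFinP; apply: measurable_funD; apply: measurable_funM.
move=> z _ /=; rewrite lee_fin; apply: le_trans (linear_inverse_le s t (u - z)) _.
exact: ler_norm.
Qed.

(** Cramer-Wold device: a real linear form in the normalized sum is a scaled sum of the real
    variables [F], to which [cvg_char] applies. *)
Lemma normalized_sum_char (s t th : R) :
  (\int[P]_w cos (s * Re (normalized_sum n w) + t * Im (normalized_sum n w) + th))%R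
    @[n --> \oo] --> expR (- ((s ^+ 2 + t ^+ 2) / 4)) * cos th.
Proof.
pose ka := Num.sqrt (pi * p u).
have pp : 0 < pi * p u by rewrite mulr_gt0 ?pi_gt0.
have ka0 : 0 < ka by rewrite sqrtr_gt0.
pose s' := s / ka; pose t' := t / ka.
pose F z := s' * Re (u - z)^-1 + t' * Im (u - z)^-1.
have [C tail] := density_tail mp p0 muE cu.
have mM := measurable_supnorm_sub.
have mF : measurable_fun setT F.
  by have /measurable_int/measurable_EFinP := inverse_sub_integrable s' t'.
(* The factor sqrt (pi p u) is exactly what normalizes the coefficient of the logarithm in
   [density_variance] to s^2 + t^2. *)
have s2E : s ^+ 2 + t ^+ 2 = p u * (pi * (s' ^+ 2 + t' ^+ 2)).
  rewrite /s' /t' !exprMn !exprVn (_ : ka ^+ 2 = pi * p u); last by rewrite sqr_sqrtr// ltW.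
  by move: (pi : R) (@pi_gt0 R) => q q0; field; rewrite !gt_eqF.
have s20 : 0 <= s ^+ 2 + t ^+ 2 by rewrite addr_ge0 ?sqr_ge0.
have V : forall e : R, 0 < e -> exists2 r0 : R, 0 < r0 & forall rho, 0 < rho -> rho <= r0 ->
    `|(\int[mu]_z (F z ^+ 2 * (rho < supnorm (u - z))%R%:R))%R - (s ^+ 2 + t ^+ 2) * ln rho^-1| <= e * ln rho^-1.
  by rewrite s2E; exact: (density_variance mp p0 muE cu s' t').
have := cvg_char xi_indep xi_mu mM (fun z => supnorm_ge0 (u - z)) tail mF
  (addr_ge0 (normr_ge0 s') (normr_ge0 t')) s20 (fun z => linear_inverse_le s' t' (u - z)) V (th := th).
apply: cvg_trans; apply: near_eq_cvg; near=> n; apply: eq_Rintegral => w _.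
congr cos; rewrite addrC; congr (_ + _).
have mE : (\int[mu]_z F z)%R = s' * Re mean_inverse + t' * Im mean_inverse.
  have i1 : mu.-integrable setT (EFin \o (fun z => Re (u - z)^-1)).
    have := inverse_sub_integrable 1 0; apply: eq_integrable => // z _ /=.
    by rewrite mul1r mul0r addr0.
  have i2 : mu.-integrable setT (EFin \o (fun z => Im (u - z)^-1)).
    have := inverse_sub_integrable 0 1; apply: eq_integrable => // z _ /=.
    by rewrite mul1r mul0r add0r.
  rewrite /F RintegralD//=; last 2 first.
  - exact: (integrableZl measurableT s' i1).
  - exact: (integrableZl measurableT t' i2).
  by rewrite !RintegralZl.
rewrite /scaled_sum mE.
set S := \sum_(1 <= k < n.+1) (u - xi k w)^-1.
have ReS : Re S = \sum_(1 <= k < n.+1) Re (u - xi k w)^-1 by apply: big_morph => //; exact: ReD.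
have ImS : Im S = \sum_(1 <= k < n.+1) Im (u - xi k w)^-1 by apply: big_morph => //; exact: ImD.
have nC : (n%:R : R[i]) = (n%:R : R)%:C by rewrite rmorph_nat.
rewrite -mulr_suml sumrB sumr_const_nat subn1/= -[_ *+ n]mulr_natl big_split/= -!mulr_sumr.
rewrite -ReS -ImS /normalized_sum -/S -/ka -fmorphV ReM ImM ReB ImB nC ReM ImM/= invfM /s' /t'.
ring.
Unshelve. all: by end_near.
Qed.

End central_limit.

Lemma cvg_invn {R : realType} : (n%:R : R)^-1 @[n --> \oo] --> (0 : R).
Proof.
apply/cvgrPdist_le => e e0; near=> n.
have n0 : (0 < n)%N by near: n; exact: nbhs_infty_gt.
rewrite sub0r normrN ger0_norm ?invr_ge0// invf_ple ?posrE ?ltr0n//.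
by near: n; exact: nbhs_infty_ger.
Unshelve. all: by end_near.
Qed.

(** * The event on which the contraction argument applies *)

Section good_event.
Context {d : measure_display} {T : measurableType d} {R : realType}.
Variables (P : probability T R) (xi : nat -> {RV P >-> R[i]}).
Hypothesis xi_indep : mutually_independent xi.
Variables (mu : probability R[i] R) (p : R[i] -> R) (u : R[i]).
Hypothesis xi_mu : forall k, (0 < k)%N -> forall B, measurable B -> distribution P (xi k) B = mu B.

Lemma Rintegral_iid_sum (f : R[i] -> R) (B : R) n : measurable_fun setT f ->
  (forall z, `|f z| <= B) ->
  (\int[P]_w \sum_(1 <= k < n.+1) f (xi k w))%R = n%:R * (\int[mu]_z f z)%R.
Proof.
move=> mf fB.
have mk k : measurable_fun setT (fun w => f (xi k w)).
  by apply: (measurableT_comp mf); exact: measurable_funPT.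
have ik k : P.-integrable setT (EFin \o (fun w => f (xi k w))).
  by apply: (bounded_integrable _ (M := B)).
elim: n => [|n ih].
  by rewrite mul0r; under eq_Rintegral do rewrite big_geq//; rewrite Rintegral_cst_prob.
under eq_Rintegral do rewrite big_nat_recr//=.
rewrite RintegralD//; last first.
  apply: (bounded_integrable _ (M := \sum_(1 <= k < n.+1) B)).
    by apply: measurable_sum.
  by move=> w; apply: le_trans (ler_norm_sum _ _ _) _; exact: ler_sum.
rewrite ih -(Rintegral_distribution (xi n.+1) mf fB) -natr1 mulrDl mul1r; congr (_ + _).
rewrite /Rintegral; congr fine; apply: eq_measure_integral => A mA _.
exact: xi_mu.
Qed.

Hypotheses (mp : measurable_fun setT p) (p0 : forall z, 0 <= p z).
Hypothesis muE : forall B, measurable B -> mu B = (\int[complex_lebesgue]_(z in B) (p z)%:E)%E.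
Hypotheses (cu : {for u, continuous p}) (pu0 : 0 < p u).

Let Z := normalized_sum xi mu p u.

Let mZ n : measurable_fun setT (Z n).
Proof. exact: measurable_normalized_sum. Qed.

Lemma normalized_sum_clt (g : R[i] -> R) (M : R) : continuous g -> (forall z, `|g z| <= M) ->
  (\int[P]_w g (Z n w))%R @[n --> \oo] --> (\int[complex_std_normal]_z g z)%R.
Proof.
move=> cg gM; have mg := continuousC_measurable cg.
pose Zn n : {RV P >-> R[i]} := mfun_Sub (mem_set (mZ n)).
have := @levy_continuity R (fun n => distribution P (Zn n)) complex_std_normal _ g M cg gM.
rewrite /weak_conv; under eq_fun do rewrite (Rintegral_distribution _ mg gM).
apply=> s t th.
have mc : measurable_fun setT (fun z => cos (s * Re z + t * Im z + th)).
  apply: measurable_cosf; apply: measurable_funD => //; apply: measurable_funD.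
    by apply: measurable_funM => //; exact: measurable_Re.
  by apply: measurable_funM => //; exact: measurable_Im.
rewrite /weak_conv; under eq_fun do rewrite (Rintegral_distribution _ mc (fun z => cos_le1_norm _)).
rewrite complex_std_normal_cos.
exact: (normalized_sum_char xi_indep xi_mu mp p0 muE cu pu0).
Qed.

Let mgt n (a : R) : measurable_fun setT (fun w => (a < supnorm (Z n w))%R%:R : R).
Proof. by apply: measurable_gt_cst; apply: (measurableT_comp (@measurable_supnorm R)). Qed.

(** A cutoff almost of full mass under the normal limit keeps almost full mass along the sequence,
    and ln n eventually leaves its support. *)
Lemma normalized_sum_tight :
  (\int[P]_w (ln (n%:R : R) < supnorm (Z n w))%R%:R)%R @[n --> \oo] --> (0 : R).
Proof.
apply/cvgrPdist_le => e e0.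
have e2 : 0 < e / 2 by rewrite divr_gt0.
have h1 : (\int[complex_std_normal]_z (cutoff m z : R))%R @[m --> \oo] --> (1 : R).
  have := @bounded_cvg_Rintegral _ _ R complex_std_normal (@cutoff R) (fun=> 1) 1.
  rewrite Rintegral_cst_prob; apply => //.
  - by move=> m; exact: measurable_cutoff.
  - by move=> m z; exact: cutoff_le1.
  - by apply: aeW => z; exact: cvg_cutoff.
have [m hm] : exists m, 1 - e / 2 <= (\int[complex_std_normal]_z (cutoff m z : R))%R.
  move/cvgrPdist_le: h1 => /(_ _ e2)[m _ /(_ m (leqnn m))] hm; exists m.
  by move: hm; rewrite /= ler_norml => /andP[_]; lra.
have /cvgrPdist_le/(_ _ e2) h2 := normalized_sum_clt (@continuous_cutoff R m) (@cutoff_le1 R m).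
near=> n.
have hn : `|(\int[complex_std_normal]_z cutoff m z)%R - (\int[P]_w cutoff m (Z n w))%R| <= e / 2 by near: n.
have ln_m : m.+1%:R <= ln (n%:R : R) by near: n; exact: near_ln_ge.
have mcZ : measurable_fun setT (fun w => cutoff m (Z n w)).
  by apply: measurableT_comp (mZ n); exact: measurable_cutoff.
have i1 : P.-integrable setT (EFin \o (fun w => cutoff m (Z n w))).
  by apply: (bounded_integrable _ (M := 1)) => // w; exact: cutoff_le1.
have i2 : P.-integrable setT (EFin \o (fun w => (ln (n%:R : R) < supnorm (Z n w))%R%:R)).
  by apply: (bounded_integrable _ (M := 1)) => // w; exact: bool_R_le1.
have ic : P.-integrable setT (EFin \o (fun=> 1 : R)).
  by apply: (bounded_integrable _ (M := 1)) => // w; rewrite normr1.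
have le : (\int[P]_w (ln (n%:R : R) < supnorm (Z n w))%R%:R)%R <= 1 - (\int[P]_w cutoff m (Z n w))%R.
  rewrite -[X in X - _](Rintegral_cst_prob P) -RintegralB//.
  apply: (le_Rintegral measurableT i2 (integrableB measurableT ic i1)) => w _.
  have /andP[c0 c1] := cutoff_01 m (Z n w).
  case: (boolP (_ < supnorm _)) => [h|_]; last by rewrite subr_ge0.
  rewrite cutoff_0 ?subr0//; move: (le_lt_trans ln_m h).
  by rewrite /supnorm lt_max => /orP.
rewrite sub0r normrN ger0_norm; last by apply: Rintegral_ge0.
apply: le_trans le _; move: hm hn; rewrite ler_norml; clear -e0.
move: (Rintegral P _ _) (Rintegral _ _ _) => x y h /andP[? ?]; lra.
Unshelve. all: by end_near.
Qed.

(** Counted as a real number so that its expectation follows by linearity; a value at most 1/2 means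
    that there is no such point. *)
Definition close_count (rho : R) n w : R := \sum_(1 <= k < n.+1) (supnorm (u - xi k w) <= rho)%R%:R.
Definition inverse_square_sum n w : R := \sum_(1 <= k < n.+1) normc (u - xi k w)^-1 ^+ 2.
(** These conditions supply the separation, the size of the sum at [u] and the bound on [W] for the
    contraction. The powers of ln n leave room for tightness and for Markov's inequality, and are
    negligible against sqrt n. *)
Definition good_event (r : R) n w : bool :=
  [&& close_count (2 * r) n w <= 2^-1, supnorm (Z n w) <= ln (n%:R : R) &
      inverse_square_sum n w <= n%:R * ln n%:R ^+ 2].

Let mM := @measurable_supnorm_sub R u.

Let mle (rho : R) : measurable_fun setT (fun z : R[i] => (supnorm (u - z) <= rho)%R%:R : R).
Proof. exact: measurable_le_cst. Qed.

Let V (z : R[i]) : R := normc (u - z)^-1 ^+ 2.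

Let mV : measurable_fun setT V.
Proof.
by apply: measurable_funX; apply: measurable_normc; apply: measurable_funCV; exact: measurable_funCB.
Qed.

Lemma measurable_good_event r n : measurable_fun setT (fun w => good_event r n w).
Proof.
have mx k : measurable_fun setT (xi k) by exact: measurable_funPT.
apply: measurable_and.
  apply: measurable_fun_ler => //; apply: measurable_sum => k.
  exact: (measurableT_comp (@mle (2 * r)) (mx k)).
apply: measurable_and.
  by apply: measurable_fun_ler => //; exact: (measurableT_comp (@measurable_supnorm R) (mZ n)).
apply: measurable_fun_ler => //; apply: measurable_sum => k.
exact: (measurableT_comp mV (mx k)).
Qed.

Let tV (rho : R) z := V z * (rho < supnorm (u - z))%R%:R.

Let V_le rho z : 0 < rho -> `|tV rho z| <= 2 / rho ^+ 2.
Proof.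
move=> r0; rewrite /tV; case: (ltP rho) => h; last first.
  by rewrite mulr0 normr0 divr_ge0 ?sqr_ge0.
have h0 : 0 < supnorm (u - z) by exact: lt_trans h.
have hi : (supnorm (u - z))^-1 <= rho^-1 by rewrite lef_pV2 ?posrE// ltW.
rewrite mulr1 /V normc_sqr.
have a1 := linear_inverse_le 1 0 (u - z); have a2 := linear_inverse_le 0 1 (u - z).
move: a1 a2; rewrite !(mul1r, mul0r, addr0, add0r, normr1, normr0) => a1 a2.
have b (x : R) : `|x| <= (supnorm (u - z))^-1 -> x ^+ 2 <= rho ^- 2.
  move=> hx; rewrite -exprVn -(real_normK (num_real x)) lerXn2r ?nnegrE ?invr_ge0 ?(ltW r0)//.
  exact: le_trans hx hi.
have := b _ a1; have := b _ a2; set x := Re _; set y := Im _ => hy hx.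
rewrite ger0_norm; first by lra.
by rewrite addr_ge0 ?sqr_ge0.
Qed.

Let mtV rho : measurable_fun setT (tV rho).
Proof. by apply: measurable_funM => //; exact: measurable_gt_cst. Qed.

(** The squared modulus is the sum of the squares of the two parts, hence [density_variance] for the
    directions (1, 0) and (0, 1), with tolerance 1. The truncation at 1/n costs little, as n
    variables come that close with probability O(1/n). *)
Let truncated_square : exists2 K : R, 0 <= K &
  \forall n \near \oo, (\int[mu]_z tV (n%:R^-1) z)%R <= K * ln (n%:R : R).
Proof.
have [r1 r10 h1] := density_variance mp p0 muE cu 1 0 ltr01.
have [r2 r20 h2] := density_variance mp p0 muE cu 0 1 ltr01.
have pi0 := @pi_ge0 R; have pu := p0 u.
exists (2 * (p u * pi + 1)); first by rewrite mulr_ge0// addr_ge0// mulr_ge0.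
near=> n.
have n0 : (0 < n)%N by near: n; exact: nbhs_infty_gt.
have ni0 : 0 < (n%:R : R)^-1 by rewrite invr_gt0 ltr0n.
have nr1 : (n%:R : R)^-1 <= r1.
  rewrite invf_ple ?posrE ?ltr0n//; near: n; exact: nbhs_infty_ger.
have nr2 : (n%:R : R)^-1 <= r2.
  rewrite invf_ple ?posrE ?ltr0n//; near: n; exact: nbhs_infty_ger.
have := h1 _ ni0 nr1; have := h2 _ ni0 nr2; rewrite invrK.
have bnd (f : R[i] -> R) : measurable_fun setT f -> (forall z, f z ^+ 2 <= V z) ->
  mu.-integrable setT (EFin \o (fun z => f z ^+ 2 * (n%:R^-1 < supnorm (u - z))%R%:R)).
  move=> mf fV; apply: (bounded_integrable _ (M := 2 / n%:R^-1 ^+ 2)).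
    by apply: measurable_funM; [exact: measurable_funX|exact: measurable_gt_cst].
  move=> z; apply: le_trans (V_le z ni0); rewrite /tV normrM [leRHS]normrM; apply: ler_wpM2r => //.
  have V0 : 0 <= V z by exact: sqr_ge0.
  by rewrite ger0_norm ?sqr_ge0//; apply: le_trans (fV z) _; exact: ler_norm.
have /measurable_funCP[mRe mIm] : measurable_fun setT (fun z : R[i] => (u - z)^-1).
  by apply: measurable_funCV; exact: measurable_funCB.
have iRe := bnd (fun z => Re (u - z)^-1) mRe _.
have iIm := bnd (fun z => Im (u - z)^-1) mIm _.
have -> : (\int[mu]_z tV n%:R^-1 z)%R =
   (\int[mu]_z (Re (u - z)^-1 ^+ 2 * (n%:R^-1 < supnorm (u - z))%R%:R))%R +
   (\int[mu]_z (Im (u - z)^-1 ^+ 2 * (n%:R^-1 < supnorm (u - z))%R%:R))%R.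
  rewrite -RintegralD//.
  - by apply: eq_Rintegral => z _; rewrite /tV /V normc_sqr mulrDl.
  - by apply: iRe => z; rewrite /V normc_sqr lerDl sqr_ge0.
  - by apply: iIm => z; rewrite /V normc_sqr lerDr sqr_ge0.
under eq_Rintegral => z _ do rewrite mul0r mul1r add0r.
under [X in _ -> `|X - _| <= _ -> _]eq_Rintegral => z _ do rewrite mul0r mul1r addr0.
rewrite expr1n expr0n/= add0r addr0 mulr1 !ler_norml => /andP[_ ?] /andP[_ ?].
lra.
Unshelve. all: by end_near.
Qed.

Lemma good_event_prob (r : nat -> R) : (forall n, (0 < n)%N -> 0 < r n) ->
  (Num.sqrt n%:R * r n) @[n --> \oo] --> 0 ->
  (\int[P]_w (good_event (r n) n w)%:R)%R @[n --> \oo] --> (1 : R).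
Proof.
move=> r0 rcvg.
have [C tail] := density_tail mp p0 muE cu.
have C0 := tailC_ge0 tail.
have [K K0 hK] := truncated_square.
pose tt n := (\int[P]_w (ln (n%:R : R) < supnorm (Z n w))%R%:R)%R.
(* Failure probabilities: a point within 2 r_n; a large normalized sum; a point within 1/n; Markov's
   inequality for the truncated inverse squares. The first tends to 0 because sqrt n r_n does. *)
pose b n : R := 8 * C * (Num.sqrt n%:R * r n) ^+ 2 + tt n + 2 * C * n%:R^-1 + K / ln (n%:R : R).
have b0 : b n @[n --> \oo] --> (0 : R).
  rewrite [X in _ --> X](_ : 0 = 8 * C * 0 ^+ 2 + 0 + 2 * C * 0 + K * 0); last by rewrite expr2 !(mulr0, mul0r) !addr0.
  apply: cvgD; first apply: cvgD; first apply: cvgD.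
  - apply: cvgM; first exact: cvg_cst.
    by rewrite expr2; under eq_fun do rewrite expr2; exact: cvgM.
  - exact: normalized_sum_tight.
  - by apply: cvgM; [exact: cvg_cst|exact: cvg_invn].
  - by apply: cvgM; [exact: cvg_cst|exact: cvg_invln].
have mx k : measurable_fun setT (xi k) by exact: measurable_funPT.
apply/cvgrPdist_le => e e0; move/cvgrPdist_le: b0 => /(_ _ e0) b0.
near=> n.
have n0 : (0 < n)%N by near: n; exact: nbhs_infty_gt.
have nR0 : (0 : R) < n%:R by rewrite ltr0n.
have ln1 : 1 <= ln (n%:R : R) by near: n; exact: near_ln_ge.
have ln0 : 0 < ln (n%:R : R) by lra.
have bn : `|0 - b n| <= e by near: n; exact: b0.
have Kn : (\int[mu]_z tV (n%:R^-1) z)%R <= K * ln (n%:R : R) by near: n.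
have rn0 : 0 < r n by exact: r0.
pose Wt w : R := \sum_(1 <= k < n.+1) tV n%:R^-1 (xi k w).
have ic (f : T -> R) : measurable_fun setT f -> (forall w, 0 <= f w <= 1) -> P.-integrable setT (EFin \o f).
  by move=> mf hf; apply: (bounded_integrable _ (M := 1)) => // w; have /andP[? ?] := hf w; rewrite ger0_norm.
have isum (f : R[i] -> R) B : measurable_fun setT f -> (forall z : R[i], `|f z| <= B) ->
    P.-integrable setT (EFin \o (fun w => \sum_(1 <= k < n.+1) f (xi k w))).
  move=> mf fB; apply: (bounded_integrable _ (M := \sum_(1 <= k < n.+1) B)).
    by apply: measurable_sum => k; exact: (measurableT_comp mf (mx k)).
  by move=> w; apply: le_trans (ler_norm_sum _ _ _) _; exact: ler_sum.
have b1 (rho : R) z : `|(supnorm (u - z) <= rho)%R%:R : R| <= 1 by exact: bool_R_le1.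
have ig : P.-integrable setT (EFin \o (fun w => (good_event (r n) n w)%:R)).
  apply: (bounded_integrable _ (M := 1)) => [|w]; last exact: bool_R_le1.
  exact: measurable_bool_R (measurable_good_event _ _).
have i1 : P.-integrable setT (EFin \o (fun=> 1 : R)) by apply: ic => // w; rewrite ler01 lexx.
have it : P.-integrable setT (EFin \o (fun w => (ln (n%:R : R) < supnorm (Z n w))%R%:R)).
  by apply: (bounded_integrable _ (M := 1)) => // w; exact: bool_R_le1.
have iN rho : P.-integrable setT (EFin \o (fun w => close_count rho n w)).
  exact: (isum _ 1 (@mle rho) (b1 rho)).
have iW : P.-integrable setT (EFin \o Wt).
  apply: (isum _ _ (@mtV n%:R^-1)) => z; apply: V_le; by rewrite invr_gt0.
pose bnd w := 2 * close_count (2 * r n) n w + (ln (n%:R : R) < supnorm (Z n w))%R%:R +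
  2 * close_count n%:R^-1 n w + (n%:R * ln n%:R ^+ 2)^-1 * Wt w.
have tV0 rho z : 0 <= tV rho z by rewrite /tV; apply: mulr_ge0 => //; exact: sqr_ge0.
have Wt0 w : 0 <= Wt w by apply: sumr_ge0 => k _.
have cc0 rho w : 0 <= close_count rho n w by apply: sumr_ge0 => k _.
have nl0 : 0 < n%:R * ln (n%:R : R) ^+ 2 by rewrite mulr_gt0// exprn_gt0.
have pw w : 1 - (good_event (r n) n w)%:R <= bnd w.
  have q1 rho : 0 <= 2 * close_count rho n w by rewrite mulr_ge0.
  have q3 : 0 <= (n%:R * ln (n%:R : R) ^+ 2)^-1 * Wt w by rewrite mulr_ge0// invr_ge0 ltW.
  have q4 : 0 <= (ln (n%:R : R) < supnorm (Z n w))%R%:R :> R by [].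
  rewrite /bnd /good_event.
  case: (leP (close_count (2 * r n) n w) 2^-1) => c1 /=; last first.
    rewrite subr0; do 3 apply: ler_wpDr => //.
    by rewrite -ler_pdivrMl// mulr1 ltW.
  case: (ltP (ln (n%:R : R)) (supnorm (Z n w))) => c2 /=.
    by rewrite subr0; do 2 apply: ler_wpDr => //; rewrite lerDr.
  case: (ltP (n%:R * ln (n%:R : R) ^+ 2) (inverse_square_sum n w)) => c3 /=; last by rewrite subrr addr0 !addr_ge0.
  rewrite subr0 addr0.
  (* If no point lies within 1/n of [u], the truncated sum of inverse squares is the full one. *)
  case: (leP 1 (close_count n%:R^-1 n w)) => c4.
    apply: ler_wpDr => //; apply: ler_wpDl => //.
    by apply: le_trans c4 _; rewrite ler_peMl// ler1n.
  have WE : inverse_square_sum n w = Wt w.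
    rewrite /inverse_square_sum /Wt !big_nat; apply: eq_bigr => k kn.
    rewrite /tV /V; case: (ltP n%:R^-1) => [_|h]; first by rewrite mulr1.
    exfalso; move: c4; rewrite ltNge => /negP; apply.
    rewrite /close_count (bigD1_seq k) ?mem_index_iota ?iota_uniq//= h lerDl.
    exact: sumr_ge0.
  have : 1 <= (n%:R * ln (n%:R : R) ^+ 2)^-1 * Wt w.
    by rewrite mulrC ler_pdivlMr// mul1r -WE ltW.
  by apply: ler_wpDl; rewrite addr_ge0.
have int_bnd : (\int[P]_w bnd w)%R <= b n.
  have N_le rho : 0 < rho -> (\int[P]_w close_count rho n w)%R <= n%:R * (C * rho ^+ 2).
    move=> rho0; rewrite (Rintegral_iid_sum n (@mle rho) (b1 rho)); apply: ler_wpM2l => //.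
    exact: (Rintegral_le_cst mM tail rho0).
  have WtE : (\int[P]_w Wt w)%R = n%:R * (\int[mu]_z tV (n%:R^-1) z)%R.
    by apply: (Rintegral_iid_sum n (@mtV n%:R^-1) (B := 2 / n%:R^-1 ^+ 2)) => z; apply: V_le; rewrite invr_gt0.
  have j1 := integrableZl measurableT 2 (iN (2 * r n)).
  have j2 := integrableZl measurableT 2 (iN n%:R^-1).
  have j3 := integrableZl measurableT (n%:R * ln (n%:R : R) ^+ 2)^-1 iW.
  rewrite /bnd (RintegralD measurableT (integrableD measurableT (integrableD measurableT j1 it) j2) j3).
  rewrite (RintegralD measurableT (integrableD measurableT j1 it) j2).
  rewrite (RintegralD measurableT j1 it).
  rewrite (RintegralZl 2 measurableT (iN (2 * r n))) (RintegralZl 2 measurableT (iN n%:R^-1)).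
  rewrite (RintegralZl _ measurableT iW) -/(tt n) WtE /b.
  apply: lerD; first apply: lerD; first apply: lerD => //.
  - rewrite exprMn sqr_sqrtr ?ler0n//.
    have r20 : 0 < 2 * r n by rewrite mulr_gt0.
    have -> : 8 * C * (n%:R * r n ^+ 2) = 2 * (n%:R * (C * (2 * r n) ^+ 2)) by ring.
    by apply: ler_wpM2l => //; exact: N_le.
  - have ni0 : 0 < (n%:R : R)^-1 by rewrite invr_gt0.
    rewrite -mulrA; apply: ler_wpM2l => //; apply: le_trans (N_le _ ni0) _.
    by rewrite mulrCA expr2 (mulrA n%:R) divff ?gt_eqF// mul1r.
  - rewrite mulrC ler_pdivrMr//.
    have -> : K / ln (n%:R : R) * (n%:R * ln n%:R ^+ 2) = n%:R * (K * ln n%:R).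
      by move: (ln _) ln0 => l l0; field; rewrite gt_eqF.
    exact: ler_wpM2l.
rewrite ger0_norm; last first.
  rewrite subr_ge0 -[leRHS](Rintegral_cst_prob P).
  by apply: (le_Rintegral measurableT ig i1) => w _; case: good_event.
rewrite -[X in X - _](Rintegral_cst_prob P) -RintegralB//.
have ib : P.-integrable setT (EFin \o bnd).
  exact: (integrableD measurableT (integrableD measurableT (integrableD measurableT
   (integrableZl measurableT 2 (iN (2 * r n))) it) (integrableZl measurableT 2 (iN n%:R^-1)))
   (integrableZl measurableT _ iW)).
apply: le_trans (le_Rintegral measurableT (integrableB measurableT i1 ig) ib (fun w _ => pw w)) _.
apply: le_trans int_bnd _; apply: le_trans bn; rewrite sub0r normrN; exact: ler_norm.
Unshelve. all: by end_near.
Qed.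

End good_event.

(** * The random point *)

Section on_good_event.
Context {d : measure_display} {T : measurableType d} {R : realType}.
Variables (P : probability T R) (xi : nat -> {RV P >-> R[i]}).
Variables (mu : probability R[i] R) (p : R[i] -> R) (u : R[i]).
Let f := mean_inverse mu u.
Let F : R := normc f.
Let ka : R := Num.sqrt (pi * p u).
Let l n : R := ln (n%:R : R).
Let a n : R := clt_scale n.

(** [del] bounds the normalized variation of the inverse sum between [u] and the critical point, and
    [eta] the total distance between the rescaled critical point and the normalized sum. *)
Let del n : R := 4 * l n ^+ 2 / (F * ka * a n).
Let eta n : R := del n + ka * a n * (2 * l n + del n) ^+ 2 / (n%:R * F / 2).

(* Everything that must hold for [n] large, as an explicit measurable condition
   on [u]: no threshold depending measurably on [u] has to be chosen. *)
Definition regular (e r : R) (n : nat) : bool :=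
  [&& (0 < n)%N, 0 < F, 0 < ka, 0 < l n,
      2 * r * (n%:R * l n ^+ 2) + 2 * (ka * a n * l n) <= n%:R * F / 2,
      (n%:R * F / 2)^-1 <= r, 8 * (n%:R * l n ^+ 2) <= (n%:R * F / 2) ^+ 2 & eta n <= e].

(** Small quantity common to all the conditions: apart from those on [r], each inequality in
    [regular] follows from a constant multiple of it being at most 1. *)
Let c n : R := l n ^+ 3 / Num.sqrt n%:R.

Let cvg_c : c n @[n --> \oo] --> (0 : R).
Proof.
apply/cvgrPdist_le => e e0; near=> n.
have n0 : (0 < n)%N by near: n; exact: nbhs_infty_gt.
have l1 : 1 <= l n by near: n; exact: near_ln_ge.
have le : 8 ^+ 4 / e <= l n by near: n; exact: near_ln_ge.
(* Then exp v >= v bounds sqrt n below by (ln n / 8)^4, one power more than the numerator. *)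
have sE : Num.sqrt (n%:R : R) = expR (l n / 8) ^+ 4.
  have -> : (n%:R : R) = (expR (l n / 8) ^+ 4) ^+ 2.
    by rewrite -exprM -expRM_natl -[LHS]lnK ?posrE ?ltr0n//; congr expR; rewrite -/(l n); field.
  by rewrite sqrtr_sqr ger0_norm// exprn_ge0// expR_ge0.
have x0 : 0 < l n / 8 by lra.
have h : (l n / 8) ^+ 4 <= Num.sqrt (n%:R : R).
  rewrite sE lerXn2r ?nnegrE ?expR_ge0 ?(ltW x0)//; have := expR_ge1Dx (l n / 8); lra.
have h0 : 0 < (l n / 8) ^+ 4 by rewrite exprn_gt0.
have s0 : 0 < Num.sqrt (n%:R : R) by exact: lt_le_trans h.
have l0 : 0 < l n by lra.
rewrite sub0r normrN ger0_norm; last by rewrite divr_ge0 ?exprn_ge0// ltW.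
rewrite ler_pdivrMr//; apply: (@le_trans _ _ (e * (l n / 8) ^+ 4)); last by apply: ler_wpM2l => //; exact: ltW.
move: le; rewrite ler_pdivrMr// => le.
have -> : e * (l n / 8) ^+ 4 = l n * e / 8 ^+ 4 * l n ^+ 3 by field.
rewrite -[leLHS]mul1r; apply: ler_wpM2r; first by rewrite exprn_ge0// ltW.
by rewrite ler_pdivlMr ?exprn_gt0// mul1r.
Unshelve. all: by end_near.
Qed.

Let le_sum4 (x y z t : R) : 0 <= x -> 0 <= y -> 0 <= z -> 0 <= t ->
  [/\ x <= x + y + z + t, y <= x + y + z + t, z <= x + y + z + t & t <= x + y + z + t].
Proof. by move=> x0 y0 z0 t0; split; lra. Qed.

Let arith1 (n k A L l2 C F' q : R) : n * ((2 + 2 * k) * C) <= n * F' -> n * (q * l2) <= n * C ->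
  k * (A * L) <= k * (n * C) -> 2 * q * (n * l2) + 2 * (k * A * L) <= n * F'.
Proof. lra. Qed.

Let arith2 (n C l2 F2 : R) : n * l2 <= n * (n * C) -> n * n * (32 * C) <= n * n * F2 ->
  8 * (n * l2) <= n * n * F2 / 4.
Proof. lra. Qed.

Let arith3 (L x : R) : 1 <= L -> 0 <= x -> x <= 1 -> 0 <= 2 * L + x /\ 2 * L + x <= 3 * L.
Proof. by move=> *; split; lra. Qed.

Let arith4 (n K s q L : R) : K * q <= K * (2 * L) -> n <= s + K * q -> n <= s + 2 * (K * L).
Proof. lra. Qed.

Let arith5 (b x y M n s : R) : x + b <= M -> M + M = n -> n <= s + b -> y <= x -> M + y <= s.
Proof. lra. Qed.

Lemma regular_near (e : R) (r : nat -> R) : 0 < e -> f != 0 -> 0 < p u ->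
  (n%:R * r n) @[n --> \oo] --> +oo ->
  (Num.sqrt n%:R * r n) @[n --> \oo] --> 0 ->
  \forall n \near \oo, regular e (r n) n.
Proof.
move=> e0 f0 pu0 rinf r0.
have F0 : 0 < F by rewrite /F normc_gt0.
have ka0 : 0 < ka by rewrite sqrtr_gt0 mulr_gt0 ?pi_gt0.
(* [K1] serves the lower bound on the sum, [K2] the contraction constant, [K3] the bound del <= 1,
   and [K4] / e the bound eta <= e. *)
pose K1 := (2 + 2 * ka) / (F / 2); pose K2 := 32 / F ^+ 2.
pose K3 := 4 / (F * ka); pose K4 := K3 + 18 * ka / F.
pose K := K1 + K2 + K3 + K4 / e.
have K10 : 0 <= K1 by rewrite divr_ge0//; lra.
have K20 : 0 <= K2 by rewrite divr_ge0// sqr_ge0.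
have K30 : 0 <= K3 by rewrite divr_ge0// mulr_ge0// ltW.
have K40 : 0 <= K4 by rewrite addr_ge0//; apply: divr_ge0; [apply: mulr_ge0 => //|]; exact: ltW.
have K40e : 0 <= K4 / e by rewrite divr_ge0// ltW.
have [KK1 KK2 KK3 KK4] := le_sum4 K10 K20 K30 K40e; rewrite -/K in KK1 KK2 KK3 KK4.
have cK : c n * K @[n --> \oo] --> (0 : R).
  by rewrite -[0](mul0r K); apply: cvgM; [exact: cvg_c|exact: cvg_cst].
move/cvgrPdist_le: cK => /(_ _ ltr01) cK; move/cvgrPdist_le: r0 => /(_ _ ltr01) r0.
near=> n.
have n0 : (0 < n)%N by near: n; exact: nbhs_infty_gt.
have nR0 : (0 : R) < n%:R by rewrite ltr0n.
have l1 : 1 <= l n by near: n; exact: near_ln_ge.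
have l0 : 0 < l n by exact: lt_le_trans l1.
have cn : `|0 - c n * K| <= 1 by near: n; exact: cK.
have rn : `|0 - Num.sqrt n%:R * r n| <= 1 by near: n; exact: r0.
(* Here n r_n must tend to infinity: the critical point is at distance about 1 / (n F) from [u] and
   has to lie in the disk. *)
have rF : 2 / F <= n%:R * r n by near: n; move/cvgryPge: rinf; exact.
have s0 : 0 < Num.sqrt (n%:R : R) by rewrite sqrtr_gt0.
have ss : Num.sqrt (n%:R : R) * Num.sqrt n%:R = n%:R by rewrite -expr2 sqr_sqrtr ?ler0n.
have c0 : 0 <= c n by rewrite divr_ge0 ?exprn_ge0// ltW.
have {}cn : c n * K <= 1 by apply: le_trans cn; rewrite sub0r normrN ler_norm.
have {}rn : r n <= (Num.sqrt n%:R)^-1.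
  rewrite -[leRHS]mul1r ler_pdivlMr// mulrC; apply: le_trans rn; rewrite sub0r normrN; exact: ler_norm.
have rpos : 0 <= r n.
  have : 0 < n%:R * r n by apply: lt_le_trans rF; rewrite divr_gt0.
  by rewrite pmulr_rgt0// => /ltW.
have cb (q : R) : 0 <= q -> q <= K -> q * c n <= 1.
  by move=> q0 qK; apply: le_trans cn; rewrite mulrC ler_wpM2l.
have lS j : (j <= 3)%N -> l n ^+ j / Num.sqrt n%:R <= c n.
  by move=> j3; rewrite /c ler_wpM2r ?invr_ge0 ?(ltW s0)// ler_weXn2l.
have aE : a n = Num.sqrt n%:R * Num.sqrt (l n) by rewrite /a /clt_scale sqrtrM ?ler0n.
have sl1 : 1 <= Num.sqrt (l n) by rewrite -[leLHS]sqrtr1; apply: ler_wsqrtr.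
have sll : Num.sqrt (l n) <= l n.
  by rewrite -[leRHS](sqr_sqrtr (ltW l0)) expr2 ler_peMl// ltW// (lt_le_trans ltr01).
have a_ge : Num.sqrt n%:R <= a n by rewrite aE ler_peMr// ltW.
have a_le : a n <= Num.sqrt n%:R * l n by rewrite aE ler_wpM2l// ltW.
have a0 : 0 < a n by exact: lt_le_trans a_ge.
have del_le : del n <= K3 * c n.
  have -> : del n = K3 * (l n ^+ 2 / a n) by rewrite /del /K3; field; rewrite !gt_eqF.
  apply: ler_wpM2l => //.
  apply: le_trans (lS 2%N _) => //; apply: ler_wpM2l; first exact: sqr_ge0.
  by rewrite lef_pV2 ?posrE.
have D0 : 0 < F * ka * a n by rewrite !mulr_gt0.
have del0 : 0 <= del n by apply: divr_ge0; [apply: mulr_ge0 => //; exact: sqr_ge0|exact: ltW].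
have ncE : n%:R * c n = Num.sqrt n%:R * l n ^+ 3.
  by rewrite /c -{1}ss -mulrA; congr (_ * _); rewrite mulrCA divff ?mulr1// gt_eqF.
have s1 : 1 <= Num.sqrt (n%:R : R) by rewrite -[leLHS]sqrtr1; apply: ler_wsqrtr; rewrite ler1n.
have sn : Num.sqrt (n%:R : R) <= n%:R by rewrite -[leRHS]ss ler_peMl// ltW.
have c2 : l n ^+ 2 / Num.sqrt n%:R <= c n by exact: lS.
have del1 : del n <= 1 by apply: le_trans del_le _; exact: cb.
apply/and5P; split => //; apply/and4P; split => //.
- have -> : n%:R * F / 2 = n%:R * (F / 2) by rewrite mulrA.
  have h1 : K1 * c n <= 1 by exact: cb.
  have : (2 + 2 * ka) * c n <= F / 2.
    by move: h1; rewrite /K1 mulrAC ler_pdivrMr ?divr_gt0// mul1r.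
  move/(ler_wpM2l (ltW nR0)) => hF.
  have A : r n * l n ^+ 2 <= c n.
    by apply: le_trans c2; rewrite mulrC; apply: ler_wpM2l => //; exact: sqr_ge0.
  have B : a n * l n <= n%:R * c n.
    rewrite ncE exprS mulrA; apply: ler_pM => //; [exact: ltW|exact: ltW|].
    by rewrite expr2 ler_peMl// ltW.
  have A' := ler_wpM2l (ltW nR0) A; have B' := ler_wpM2l (ltW ka0) B.
  exact: arith1 hF A' B'.
- have -> : (n%:R * F / 2)^-1 = 2 / F / n%:R by field; rewrite !gt_eqF.
  by rewrite ler_pdivrMr// [leRHS]mulrC.
- have h1 : K2 * c n <= 1 by exact: cb.
  have h2 : 32 * c n <= F ^+ 2 by move: h1; rewrite /K2 mulrAC ler_pdivrMr ?exprn_gt0// mul1r.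
  have h3 : l n ^+ 2 <= n%:R * c n.
    move: c2; rewrite ler_pdivrMr// => c2; apply: le_trans c2 _.
    by rewrite mulrC ler_wpM2r.
  have h4 := ler_wpM2l (ltW nR0) h3; have h5 := ler_wpM2l (sqr_ge0 n%:R) h2.
  have -> : (n%:R * F / 2) ^+ 2 = n%:R ^+ 2 * F ^+ 2 / 4 by field.
  by move: h5; rewrite expr2; exact: arith2.
- have h1 : K4 / e * c n <= 1 by exact: cb.
  have h2 : K4 * c n <= e by move: h1; rewrite mulrAC ler_pdivrMr// mul1r.
  apply: le_trans h2; rewrite /eta /K4 [leRHS]mulrDl; apply: lerD => //.
  have z9 : (2 * l n + del n) ^+ 2 <= 9 * l n ^+ 2.
    have -> : 9 * l n ^+ 2 = (3 * l n) ^+ 2 by ring.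
    have [z0 z3] : 0 <= 2 * l n + del n /\ 2 * l n + del n <= 3 * l n.
      exact: arith3.
    by rewrite lerXn2r ?nnegrE// (le_trans z0).
  have hh : a n * (2 * l n + del n) ^+ 2 <= 9 * (n%:R * c n).
    rewrite ncE; apply: le_trans (ler_pM (ltW a0) (sqr_ge0 _) a_le z9) _.
    by rewrite le_eqVlt; apply/orP; left; apply/eqP; ring.
  have nF0 : 0 < n%:R * F / 2 by rewrite divr_gt0// mulr_gt0.
  rewrite ler_pdivrMr//.
  have -> : 18 * ka / F * c n * (n%:R * F / 2) = ka * (9 * (n%:R * c n)) by field; rewrite gt_eqF.
  by rewrite -mulrA ler_wpM2l// ltW.
Unshelve. all: by end_near.
Qed.

(** Deterministic core: for one sample point the two conditions give the hypotheses of the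
    contraction, with m = n F / 2, and the fixed point equation is then expanded around n f. *)
Lemma good_critical e r n w : 0 < r -> xi 0%N w = u -> regular e r n -> good_event xi mu p u r n w ->
  let crit := critical_point_in_disk (random_poly xi n w) u r in
  (exists! z, crit z) /\ forall z, crit z ->
    normc (f ^+ 2 / ka%:C * (Num.sqrt (n%:R / ln n%:R))%:C * (n%:R * (z - u) + f^-1)
      - normalized_sum xi mu p u n w) <= e.
Proof.
move=> r0 xu /and5P[n0 F0 ka0 l0 /and4P[c1 c2 c3 c4]] /and3P[g1 g2 g3] crit.
have nR0 : (0 : R) < n%:R by rewrite ltr0n.
set Z := normalized_sum xi mu p u n w in g2 *.
pose x k := xi k w; pose S := inverse_sum x n u.
have a0 : 0 < a n by rewrite sqrtr_gt0 mulr_gt0.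
have kan0 : 0 < ka * a n by rewrite mulr_gt0.
have kC : ((ka * a n)%:C : R[i]) != 0 by rewrite -normc_gt0 /= expr0n/= addr0 sqrtr_sqr normr_gt0 gt_eqF.
have SE : S = n%:R * f + (ka * a n)%:C * Z.
  by rewrite /Z /normalized_sum [(ka * a n)%:C * _]mulrC divfK// addrC subrK.
have nC (q : R) : 0 <= q -> normc (q%:C : R[i]) = q.
  by move=> q0; rewrite /= expr0n/= addr0 sqrtr_sqr ger0_norm.
have nkC : normc ((ka * a n)%:C : R[i]) = ka * a n by apply: nC; exact: ltW.
have nn : normc (n%:R : R[i]) = n%:R by rewrite -(rmorph_nat (real_complex R)) nC// ler0n.
have nZ : normc Z <= 2 * l n.
  apply: le_trans (normc_le_ReIm _) _; move: g2; rewrite /supnorm ge_max -/(l n) => /andP[? ?]; lra.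
pose m := n%:R * F / 2.
have m0 : 0 < m by rewrite divr_gt0// mulr_gt0.
(* A single point this close would make the count at least 1, and the modulus dominates the sup
   norm. *)
have far k : (1 <= k < n.+1)%N -> 2 * r < normc (u - x k).
  move=> hk; have : ~~ (supnorm (u - xi k w) <= 2 * r).
    apply/negP => h; move: g1; rewrite /close_count (bigD1_seq k) ?mem_index_iota ?iota_uniq//= h.
    set q := \sum_(_ <- _ | _) _; have : 0 <= q by apply: sumr_ge0.
    move: q => q q0; rewrite /=; lra.
  rewrite -ltNge => /lt_le_trans; apply; rewrite /supnorm ge_max normc_Re normc_Im//.
pose W : R := \sum_(1 <= k < n.+1) normc (u - x k)^-1 ^+ 2.
have W1 : W <= n%:R * l n ^+ 2 by exact: g3.
have W0 : 0 <= W by apply: sumr_ge0 => k _; exact: sqr_ge0.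
have mS : m + 2 * r * W <= normc S.
  have h1 : n%:R * F <= normc S + 2 * (ka * a n * l n).
    have := normc_triangle S (- ((ka * a n)%:C * Z)); rewrite {1}SE addrK normc_opp (Normc.normcM n%:R f) (Normc.normcM _ Z) nn -/F nkC.
    exact: arith4 (ler_wpM2l (ltW kan0) nZ).
  have h2 : 2 * r * W <= 2 * r * (n%:R * l n ^+ 2) by apply: ler_wpM2l => //; rewrite mulr_ge0// ltW.
  by apply: arith5 c1 _ h1 h2; rewrite /m; field.
have mW : 8 * W <= m ^+ 2 by apply: le_trans c3; apply: ler_wpM2l.
have disk_neq z k : normc (z - u) <= r -> (1 <= k < n.+1)%N -> z - x k != 0.
  move=> dz hk; rewrite -normc_gt0; have := normc_split u z (x k); rewrite [normc (u - z)]normc_distC.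
  by have := far k hk; lra.
have critE z : crit z <-> normc (z - u) <= r /\ z - u = - (inverse_sum x n z)^-1.
  rewrite /crit /critical_point_in_disk /= normcE lecR.
  split=> [[dz]|[dz hz]]; last split=> //; rewrite root_deriv_random_poly ?xu; last first; try by move=> k; exact: disk_neq.
    have hm := inverse_sum_ge r0 far mS dz.
    have h0 : inverse_sum x n z != 0 by rewrite -normc_gt0 (lt_le_trans m0).
    by rewrite hz mulNr mulVf// subrr.
  move=> /eqP hz; split=> //.
  have hm := inverse_sum_ge r0 far mS dz.
  have h0 : inverse_sum x n z != 0 by rewrite -normc_gt0 (lt_le_trans m0).
  by apply: (mulIf h0); rewrite mulNr mulVf//; apply/eqP; rewrite -addr_eq0 addrC hz.
split.
  have [z dz hz] := fixed_point r0 m0 far mS c2 mW.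
  exists z; split; first by apply/critE.
  move=> z' /critE[dz' hz']; exact: (fixed_point_unique r0 m0 far mS mW dz dz' hz hz').
move=> z /critE[dz hz].
have hm := inverse_sum_ge r0 far mS dz.
set h := inverse_sum x n z in hz hm.
have h0 : h != 0 by rewrite -normc_gt0 (lt_le_trans m0).
have f0 : f != 0 by rewrite -normc_gt0.
have hS := inverse_sum_center r0 far dz.
have ninv (v : R[i]) : v != 0 -> normc v^-1 = (normc v)^-1.
  move=> v0; apply: (mulIf (_ : normc v != 0)); first by rewrite normc_eq0.
  by rewrite -Normc.normcM !mulVf// ?normc_eq0//; exact: Normc.normc1.
(* The fixed point equation gives |z - u| = 1/|h| <= 1/m, which replaces the radius [r] in the
   Lipschitz bound. *)
have dh : normc (h - S) <= 4 * l n ^+ 2 / F.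
  apply: le_trans hS _; rewrite hz normc_opp ninv//.
  have i1 : (normc h)^-1 <= m^-1 by rewrite lef_pV2 ?posrE// (lt_le_trans m0).
  have -> : 4 * l n ^+ 2 / F = 2 * (n%:R * l n ^+ 2) * m^-1.
    by rewrite /m; field; rewrite !gt_eqF.
  apply: ler_pM => //; [by rewrite mulr_ge0|by rewrite invr_ge0 normc_ge0|].
  by apply: ler_wpM2l.
pose D := (h - S) / (ka * a n)%:C.
have nD : normc D <= del n.
  rewrite /D Normc.normcM ninv// nkC.
  have -> : del n = 4 * l n ^+ 2 / F * (ka * a n)^-1.
    by rewrite /del; field; rewrite !gt_eqF.
  by apply: ler_wpM2r => //; rewrite invr_ge0 ltW.
(* With h = n f + ka a (Z + D), z - u = -1/h and sqrt (n / ln n) a = n, the rescaled quantity is n f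
   (Z + D) / h; writing n f as h - ka a (Z + D) gives the identity. *)
have XE : f ^+ 2 / ka%:C * (Num.sqrt (n%:R / ln n%:R))%:C * (n%:R * (z - u) + f^-1) - Z =
    D - (ka * a n)%:C * (Z + D) ^+ 2 / h.
  pose b : R := Num.sqrt (n%:R / l n).
  have ba : (b%:C * (a n)%:C : R[i]) = n%:R.
    rewrite -(rmorph_nat (real_complex R)) -rmorphM/=; congr (_%:C).
    rewrite /b /a /clt_scale -/(l n) -sqrtrM; last by rewrite divr_ge0 ?ler0n ?ltW.
    rewrite mulrACA mulVf ?gt_eqF// mulr1 -expr2 sqrtr_sqr ger0_norm//.
  have kC0 : (ka%:C : R[i]) != 0 by rewrite -normc_gt0 nC// ltW.
  have hE : h = b%:C * (a n)%:C * f + ka%:C * (a n)%:C * (Z + D).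
    rewrite ba mulrDr addrA -rmorphM/= -SE /D [_ * (_ / _)]mulrC divfK// addrCA subrr addr0//.
  have DE : D = Z + D - Z by rewrite addrAC subrr add0r.
  rewrite hz -/(l n) -/b -ba rmorphM/= [X in _ = X - _]DE.
  move: (Z + D) hE => Y hE.
  rewrite hE in h0 *; field; rewrite h0 f0 kC0//.
rewrite XE; apply: le_trans c4; rewrite /eta.
have t := normc_triangle D (- ((ka * a n)%:C * (Z + D) ^+ 2 / h)).
apply: le_trans t _; rewrite normc_opp; apply: lerD => //.
have nZD : normc (Z + D) <= 2 * l n + del n.
  by apply: le_trans (normc_triangle _ _) _; apply: lerD.
rewrite !Normc.normcM ninv// nkC.
apply: ler_pM.
- by rewrite !mulr_ge0 ?normc_ge0// ltW.
- by rewrite invr_ge0 normc_ge0.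
- by apply: ler_wpM2l; [exact: ltW|rewrite expr2; apply: ler_pM; rewrite ?normc_ge0].
- by rewrite lef_pV2 ?posrE// (lt_le_trans m0).
Qed.

End on_good_event.

(** * Joint measurability in the centre and the sample point *)

Section parametrized_integrals.
Context {d d' : measure_display} {S : measurableType d} {S' : measurableType d'} {R : realType}.

(** No integrability is assumed: [mean_inverse] must be measurable on the whole plane, whereas the
    kernel is shown integrable only at continuity points of the density. Positive and negative parts
    are treated separately. *)
Lemma measurable_Rintegral_param (mu : probability S' R) (h : S * S' -> R) :
  measurable_fun setT h -> measurable_fun setT (fun x => \int[mu]_z h (x, z))%R.
Proof.
move=> mh; have mE : measurable_fun setT (EFin \o h) by exact/measurable_EFinP.
rewrite (_ : (fun _ => _) = fine \o (fun x => \int[mu]_z ((EFin \o h)^\+ (x, z)) -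
    \int[mu]_z ((EFin \o h)^\- (x, z)))%E); last first.
  apply/funext => x /=; rewrite /Rintegral integralE; congr (fine (_ - _)%E).
    by apply: eq_integral => z _; rewrite !funeposE.
  by apply: eq_integral => z _; rewrite !funenegE.
apply: (measurableT_comp (@fine_measurable R setT measurableT)).
apply: emeasurable_funB.
  apply: (@measurable_fun_fubini_tonelli_F _ _ _ _ _ mu ((EFin \o h)^\+)%E) => //.
  exact: measurable_funepos.
apply: (@measurable_fun_fubini_tonelli_F _ _ _ _ _ mu ((EFin \o h)^\-)%E) => //.
exact: measurable_funeneg.
Qed.

Lemma Rintegral_pushforward_gen (P : probability S R) (X : {RV P >-> S'}) (h : S' -> R) :
  measurable_fun setT h -> (\int[distribution P X]_z h z = \int[P]_w h (X w))%R.
Proof.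
move=> mh; have mE : measurable_fun setT (EFin \o h) by exact/measurable_EFinP.
rewrite /Rintegral integralE [in RHS]integralE; congr (fine (_ - _)%E).
  rewrite ge0_integral_distribution//; last exact: measurable_funepos.
  by apply: eq_integral => w _; rewrite /= !funeposE.
rewrite ge0_integral_distribution//; last exact: measurable_funeneg.
by apply: eq_integral => w _; rewrite /= !funenegE.
Qed.

End parametrized_integrals.

(** For a >= 0 the set where p > a lies in [D], where [p] is continuous, so it is open; for a < 0 it
    is everything. *)
Lemma measurable_density {R : realType} (D : set R[i]) (p : R[i] -> R) :
  (forall z, 0 <= p z) -> open D -> {in D, continuous p} -> (forall z, ~ D z -> p z = 0) ->
  measurable_fun setT p.
Proof.
move=> p0 oD cp pD; apply: (measurability _ (RGenOInfty.measurableE R)).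
move=> _ [_ [a ->] <-]; rewrite setTI.
have [a0|a0] := ltP a 0.
  rewrite (_ : _ @^-1` _ = setT)//; apply/seteqP; split=> z //= _.
  by rewrite in_itv/= andbT (lt_le_trans a0).
have : open (p @^-1` `]a, +oo[%classic); last by move=> h; exact: sub_sigma_algebra.
rewrite openE => z /=; rewrite in_itv/= andbT => az.
have Dz : D z by apply: contrapT => /pD pz; move: az; rewrite pz ltNge a0.
have /cp/cvg_complexP h : z \in D by exact/mem_set.
have e0 : 0 < p z - a by rewrite subr_gt0.
have [e e1 he] := h _ e0.
apply/nbhs_complexP; exists e => // z' h1 h2.
rewrite /= in_itv/= andbT; have := he z' h1 h2.
by rewrite ltr_norml => /andP[? _]; lra.
Qed.

Section measurability.
Context {d d' : measure_display} {T : measurableType d} {R : realType}.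
Variables (P : probability T R) (xi : nat -> {RV P >-> R[i]}).
Variables (mu : probability R[i] R) (p : R[i] -> R).
Hypotheses (mp : measurable_fun setT p).

Lemma measurable_mean_inverse : measurable_fun setT (mean_inverse mu).
Proof.
have /measurable_funCP[h1 h2] : measurable_fun setT (fun q : R[i] * R[i] => (q.1 - q.2)^-1).
  apply: measurable_funCV; apply: measurable_funCB; [exact: measurable_fst|exact: measurable_snd].
by apply: measurable_funC => /=; [exact: (measurable_Rintegral_param mu h1)|exact: (measurable_Rintegral_param mu h2)].
Qed.

Lemma measurable_sqrt_density : measurable_fun setT (fun x => Num.sqrt (pi * p x)).
Proof.
apply: (measurableT_comp (continuous_measurable_fun (@sqrt_continuous R))).
exact: measurable_funM.
Qed.

Lemma measurable_regular e r n : measurable_fun setT (fun x => regular mu p x e r n).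
Proof.
have mF : measurable_fun setT (fun x => normc (mean_inverse mu x)).
  exact: measurable_normc measurable_mean_inverse.
have mk := measurable_sqrt_density.
have mdel : measurable_fun setT (fun x => 4 * ln (n%:R : R) ^+ 2 /
    (normc (mean_inverse mu x) * Num.sqrt (pi * p x) * clt_scale n)).
  apply: measurable_funM => //; apply: measurable_funinv; apply: measurable_funM => //.
  exact: measurable_funM.
have mm : measurable_fun setT (fun x => n%:R * normc (mean_inverse mu x) / 2).
  by apply: measurable_funM => //; exact: measurable_funM.
apply: measurable_and => //; apply: measurable_and; first exact: measurable_fun_ltr.
apply: measurable_and; first exact: measurable_fun_ltr.
apply: measurable_and => //; apply: measurable_and.
  apply: measurable_fun_ler => //; apply: measurable_funD => //; apply: measurable_funM => //.
  by do 2 apply: measurable_funM => //.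
apply: measurable_and; first by apply: measurable_fun_ler => //; exact: measurable_funinv.
apply: measurable_and; first by apply: measurable_fun_ler => //; exact: measurable_funX.
apply: measurable_fun_ler => //; apply: measurable_funD => //.
apply: measurable_funM; last exact: measurable_funinv.
by apply: measurable_funM; [exact: measurable_funM|apply: measurable_funX; exact: measurable_funD].
Qed.

Let dom := (R[i] * others xi 0)%type.

Let mx k : measurable_fun [set: dom] (fun q : dom => xi k.+1 q.2).
Proof. exact: (measurableT_comp (@measurable_xi_others _ _ _ P xi 0 k.+1 isT) (@measurable_snd _ _ _ _)). Qed.

Let mu1 : measurable_fun [set: dom] (fun q : dom => q.1).
Proof. exact: measurable_fst. Qed.

(** The second factor carries the sigma-algebra of the variables other than [xi 0], as needed to
    integrate over the centre by independence. *)
Lemma measurable_normalized_sum_pair n :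
  measurable_fun [set: dom] (fun q : dom => normalized_sum xi mu p q.1 n q.2).
Proof.
apply: measurable_funCM.
  apply: measurable_funCB.
    (* Shifting the index shows every variable as [xi k.+1], which is measurable for
       [others xi 0]. *)
    under eq_fun do rewrite big_add1.
    by apply: measurable_funC_sum => k; apply: measurable_funCV; exact: measurable_funCB.
  by apply: measurable_funCM => //; exact: (measurableT_comp measurable_mean_inverse mu1).
apply: measurable_funCV; apply: measurable_fun_realC; apply: measurable_funM => //.
exact: (measurableT_comp measurable_sqrt_density mu1).
Qed.

Lemma measurable_good_event_pair r n :
  measurable_fun [set: dom] (fun q : dom => good_event xi mu p q.1 r n q.2).
Proof.
apply: measurable_and.
  apply: measurable_fun_ler => //; rewrite /close_count; under eq_fun do rewrite big_add1.
  apply: measurable_sum => k; apply: measurable_bool_R; apply: measurable_fun_ler => //.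
  by apply: (measurableT_comp (@measurable_supnorm R)); exact: measurable_funCB.
apply: measurable_and.
  apply: measurable_fun_ler => //.
  exact: (measurableT_comp (@measurable_supnorm R) (measurable_normalized_sum_pair n)).
apply: measurable_fun_ler => //; rewrite /inverse_square_sum; under eq_fun do rewrite big_add1.
apply: measurable_sum => k; apply: measurable_funX; apply: measurable_normc.
by apply: measurable_funCV; exact: measurable_funCB.
Qed.

Lemma measurable_Rintegral_others (Psi : dom -> R) : measurable_fun setT Psi ->
  measurable_fun setT (fun x => \int[P]_w Psi (x, w))%R.
Proof.
move=> mPsi.
pose idm : {mfun T >-> others xi 0} := mfun_Sub (mem_set (@measurable_to_others _ _ _ P xi 0)).
rewrite (_ : (fun _ => _) = (fun x => \int[distribution P idm]_z Psi (x, z))%R); last first.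
  apply/funext => x; rewrite Rintegral_pushforward_gen//.
  exact: (measurableT_comp mPsi (pair1_measurable x)).
exact: measurable_Rintegral_param.
Qed.

End measurability.

Section randomization.
Context {d : measure_display} {T : measurableType d} {R : realType}.
Variables (P : probability T R) (xi : nat -> {RV P >-> R[i]}).
Variables (D : set R[i]) (p : R[i] -> R) (r : nat -> R).
Hypotheses (xi_indep : mutually_independent xi) (p0 : forall z, 0 <= p z).
Hypothesis xi_density : forall k, has_density (xi k) p.
Hypotheses (oD : open D) (cp : {in D, continuous p}) (pD : forall z, ~ D z -> p z = 0).

Let mu := distribution P (xi 0%N).

Let mp : measurable_fun setT p.
Proof. exact: (measurable_density p0 oD cp pD). Qed.

Let muE B : measurable B -> mu B = (\int[complex_lebesgue]_(z in B) (p z)%:E)%E.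
Proof. exact: xi_density. Qed.

Let xi_mu k : (0 < k)%N -> forall B, measurable B -> distribution P (xi k) B = mu B.
Proof. by move=> _ B mB; rewrite muE// xi_density. Qed.

Lemma cauchy_stieltjesE z : cauchy_stieltjes P (xi 1%N) z = mean_inverse mu z.
Proof.
have /measurable_funCP[h1 h2] : measurable_fun setT (fun y : R[i] => (z - y)^-1).
  by apply: measurable_funCV; exact: measurable_funCB.
have E (h : R[i] -> R) : measurable_fun setT h ->
    fine ('E_P[fun w => h (xi 1%N w)])%E = (\int[mu]_y h y)%R.
  move=> mh; rewrite unlock -[LHS]/(\int[P]_w h (xi 1%N w))%R -(Rintegral_pushforward_gen (xi 1%N) mh).
  by rewrite /Rintegral; congr fine; apply: eq_measure_integral => A mA _; exact: xi_mu.
by rewrite /cauchy_stieltjes /complex_expectation /mean_inverse (E _ h1) (E _ h2).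
Qed.

Hypothesis f_neq0 : \forall z \ae complex_lebesgue, D z -> cauchy_stieltjes P (xi 1%N) z != 0.

Let typical x := [/\ {for x, continuous p}, 0 < p x & mean_inverse mu x != 0].

(** The complement of [D] and the zero set of [p] are null because the density vanishes there; the
    exceptional set of [f_neq0] is null because [mu] has a density. *)
Let typical_ae : {ae mu, forall x, typical x}.
Proof.
have [N [mN N0 hN]] := f_neq0.
have mD : measurable D by exact: sub_sigma_algebra.
have mZ : measurable (p @^-1` [set 0]) by rewrite -[X in measurable X]setTI; exact: mp.
have null B : measurable B -> (\int[complex_lebesgue]_(z in B) (p z)%:E = 0)%E -> mu.-negligible B.
  by move=> mB h; apply/negligibleP => //; rewrite -h; exact: muE.
have n1 : mu.-negligible (~` D).
  by apply: null; [exact: measurableC|apply: integral0_eq => z /= /pD ->].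
have n2 : mu.-negligible (p @^-1` [set 0]).
  by apply: null => //; apply: integral0_eq => z /= ->.
have n3 : mu.-negligible N.
  apply: null => //; apply: null_set_integral => //.
  by apply/measurable_EFinP; exact: measurable_funTS.
apply: negligibleS (negligibleU n1 (negligibleU n2 n3)) => x /= nt.
have [Dx|] := pselect (D x); last by left.
have [pz|pz] := eqVneq (p x) 0; first by right; left.
right; right; apply: hN => /= H; apply: nt; split.
- by apply: cp; exact/mem_set.
- by rewrite lt_def pz p0.
- by rewrite -cauchy_stieltjesE; exact: H.
Qed.

Hypothesis r_gt0 : forall n, (0 < n)%N -> 0 < r n.
Hypothesis nr_cvg : (n%:R * r n) @[n --> \oo] --> +oo.
Hypothesis sqrtnr_cvg : (Num.sqrt n%:R * r n) @[n --> \oo] --> 0.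

Let typical_event e n x w : bool := good_event xi mu p x (r n) n w && regular mu p x e (r n) n.

Let measurable_typical_event e n : measurable_fun [set: R[i] * others xi 0] (fun q => (typical_event e n q.1 q.2)%:R : R).
Proof.
apply: measurable_bool_R; apply: measurable_and.
  exact: (measurable_good_event_pair mu mp (r n) n).
by apply: (measurableT_comp (measurable_regular mu mp e (r n) n)); exact: measurable_fst.
Qed.

(** Independence turns the probability into an integral over the centre. At almost every centre
    [regular] holds eventually and the good event has probability tending to 1; dominated
    convergence concludes. *)
Lemma randomized_good_event (e : R) : 0 < e ->
  (\int[P]_w (typical_event e n (xi 0%N w) w)%:R)%R @[n --> \oo] --> (1 : R).
Proof.
move=> e0.
have E n : (\int[P]_w (typical_event e n (xi 0%N w) w)%:R)%R =
    (\int[mu]_x \int[P]_w (typical_event e n x w)%:R)%R.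
  exact: (Rintegral_indep xi_indep (measurable_typical_event e n) (fun q => bool_R_le1 _)).
under eq_fun do rewrite E.
suff : (\int[mu]_x \int[P]_w (typical_event e n x w)%:R)%R @[n --> \oo] --> (\int[mu]_x (1 : R))%R.
  by rewrite Rintegral_cst_prob.
apply: (bounded_cvg_Rintegral (M := 1)) => //.
- by move=> n; exact: (@measurable_Rintegral_others _ _ _ P xi (fun q => (typical_event e n q.1 q.2)%:R) (measurable_typical_event e n)).
- move=> n x; apply: Rintegral_bound => [|w]; last exact: bool_R_le1.
  exact: (measurable_others (measurableT_comp (measurable_typical_event e n) (pair1_measurable x))).
- apply: filterS typical_ae => x [cx px fx].
  have := good_event_prob xi_indep xi_mu mp p0 muE cx px r_gt0 sqrtnr_cvg.
  apply: cvg_trans; apply: near_eq_cvg.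
  have := regular_near e0 fx px nr_cvg sqrtnr_cvg.
  apply: filterS => n hn; apply: eq_Rintegral => w _.
  by rewrite /typical_event hn andbT.
Qed.

Lemma randomized_clt (g : R[i] -> R) (M : R) : continuous g -> (forall z, `|g z| <= M) ->
  (\int[P]_w g (normalized_sum xi mu p (xi 0%N w) n w))%R @[n --> \oo] -->
  (\int[complex_std_normal]_z g z)%R.
Proof.
move=> cg gM; have mg := continuousC_measurable cg.
pose Psi n (q : R[i] * others xi 0) := g (normalized_sum xi mu p q.1 n q.2).
have mPsi n : measurable_fun setT (Psi n).
  exact: (measurableT_comp mg (@measurable_normalized_sum_pair _ _ _ P xi mu p mp n)).
have E n : (\int[P]_w g (normalized_sum xi mu p (xi 0%N w) n w))%R =
    (\int[mu]_x \int[P]_w Psi n (x, w))%R.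
  exact: (Rintegral_indep xi_indep (mPsi n) (fun q => gM _)).
under eq_fun do rewrite E.
rewrite -(Rintegral_cst_prob mu (\int[complex_std_normal]_z g z)%R).
apply: (bounded_cvg_Rintegral (M := M)) => //.
- by move=> n; exact: (@measurable_Rintegral_others _ _ _ P xi (Psi n) (mPsi n)).
- move=> n x; apply: Rintegral_bound => [|w]; last exact: gM.
  exact: (measurable_others (measurableT_comp (mPsi n) (pair1_measurable x))).
- apply: filterS typical_ae => x [cx px fx].
  exact: (normalized_sum_clt xi_indep xi_mu mp p0 muE cx px cg gM).
Qed.

Let f := cauchy_stieltjes P (xi 1%N).
Let crit n w := critical_point_in_disk (random_poly xi n w) (xi 0%N w) (r n).

Lemma unique_critical_point_prob : P [set w | exists! z, crit n w z] @[n --> \oo] --> 1%E.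
Proof.
(* Uniqueness does not involve the tolerance of the typical event, so the value 1 is arbitrary. *)
apply: (@squeeze_cvge _ _ _ _ (fun n => (\int[P]_w (typical_event 1 n (xi 0%N w) w)%:R)%R%:E) _ (cst 1%E)); last 2 first.
- by apply: cvg_EFin; [exact: nearW|exact: randomized_good_event].
- exact: cvg_cst.
near=> n.
have n0 : (0 < n)%N by near: n; exact: nbhs_infty_gt.
have mS : measurable [set w | exists! z, crit n w z].
  exact: (measurable_unique_critical_point _ (fun k => measurable_funPT (xi k)) (r_gt0 n0)).
rewrite probability_le1// andbT.
have mb : measurable_fun setT (fun w => (typical_event 1 n (xi 0%N w) w)%:R : R).
  have mpair : measurable_fun [set: T] (fun w : T => (xi 0%N w, w : others xi 0)).
    by apply: measurable_fun_pair => //; exact: measurable_to_others.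
  exact: (measurableT_comp (measurable_typical_event 1 n) mpair).
rewrite EFin_Rintegral; last by apply: (bounded_integrable _ (M := 1)) => // w; exact: bool_R_le1.
rewrite -[leRHS](congr1 P (setIT _)) -integral_indic//; apply: ge0_le_integral => //.
- exact/measurable_EFinP.
- by apply/measurable_EFinP; exact: measurable_indic.
move=> w _; rewrite lee_fin indicE; case: (boolP (typical_event 1 n (xi 0%N w) w)) => [/andP[h1 h2]|_] //.
rewrite mem_set//=; have [] := good_critical (r_gt0 n0) (erefl (xi 0%N w)) h2 h1; by [].
Unshelve. all: by end_near.
Qed.

Section rescaled_critical_point.
Variable zeta : nat -> {RV P >-> R[i]}.
Hypothesis zetaE : forall n w, (exists! z, crit n w z) -> crit n w (zeta n w).

Let X n w := f (xi 0%N w) ^+ 2 / (Num.sqrt (pi * p (xi 0%N w)))%:C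
  * (Num.sqrt (n%:R / ln n%:R))%:C * (n%:R * (zeta n w - xi 0%N w) + (f (xi 0%N w))^-1).

Let mX n : measurable_fun setT (X n).
Proof.
have m0 : measurable_fun setT (xi 0%N) by exact: measurable_funPT.
have mf : measurable_fun setT (fun w => f (xi 0%N w)).
  rewrite (_ : f = mean_inverse mu); last by apply/funext => z; exact: cauchy_stieltjesE.
  exact: (measurableT_comp (measurable_mean_inverse mu) m0).
apply: measurable_funCM; last first.
  apply: measurable_funCD; last exact: measurable_funCV.
  by apply: measurable_funCM => //; apply: measurable_funCB => //; exact: measurable_funPT.
apply: measurable_funCM => //; apply: measurable_funCM.
  by under eq_fun do rewrite expr2; exact: measurable_funCM.
apply: measurable_funCV; apply: measurable_fun_realC.
exact: (measurableT_comp (measurable_sqrt_density mp) m0).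
Qed.

Let Z n w := normalized_sum xi mu p (xi 0%N w) n w.

Let X_near_Z e n w : (0 < n)%N -> typical_event e n (xi 0%N w) w -> normc (X n w - Z n w) <= e.
Proof.
move=> n0 /andP[h1 h2]; have [u c] := good_critical (r_gt0 n0) (erefl (xi 0%N w)) h2 h1.
by have := c _ (zetaE u); rewrite /X /f cauchy_stieltjesE.
Qed.

Let mpair : measurable_fun [set: T] (fun w : T => (xi 0%N w, w : others xi 0)).
Proof. by apply: measurable_fun_pair => //; exact: measurable_to_others. Qed.

Let mZ n : measurable_fun setT (Z n).
Proof. exact: (measurableT_comp (@measurable_normalized_sum_pair _ _ _ P xi mu p mp n) mpair). Qed.

(** Slutsky's argument: on the typical event [X] and [Z] are uniformly close, off it the difference
    of the values of [g] is at most [2 * M], and [Z] has the required limit. *)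
Let X_cvg_compact (g : R[i] -> R) (M A : R) : continuous g -> (forall z, `|g z| <= M) ->
  (forall z, A < `|Re z| \/ A < `|Im z| -> g z = 0) ->
  (\int[P]_w g (X n w))%R @[n --> \oo] --> (\int[complex_std_normal]_z g z)%R.
Proof.
move=> cg gM gA; have mg := continuousC_measurable cg.
have M0 : 0 <= M by exact: le_trans (normr_ge0 _) (gM 0).
apply: cvg_uniform_limit => e e0.
exists (fun n => \int[P]_w g (Z n w))%R, (\int[complex_std_normal]_z g z)%R; split.
- have e2 : 0 < e / 2 by rewrite divr_gt0.
  have [dl dl0 hdl] := compactly_supported_unif_cont cg gA e2.
  (* With this bound on the probability of failure, the cost [2 * M] off the typical event is at
     most e/2. *)
  have eM : 0 < e / (4 * M + 4) by rewrite divr_gt0//; lra.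
  have := randomized_good_event dl0 => /cvgrPdist_le/(_ _ eM) hG.
  near=> n.
  have n0 : (0 < n)%N by near: n; exact: nbhs_infty_gt.
  have hn : `|1 - (\int[P]_w (typical_event dl n (xi 0%N w) w)%:R)%R| <= e / (4 * M + 4) by near: n.
  pose G w : R := (typical_event dl n (xi 0%N w) w)%:R.
  have mG : measurable_fun setT G by exact: (measurableT_comp (measurable_typical_event dl n) mpair).
  have iG : P.-integrable setT (EFin \o G).
    by apply: (bounded_integrable _ (M := 1)) => // w; exact: bool_R_le1.
  have i1 : P.-integrable setT (EFin \o (fun=> 1 : R)).
    by apply: (bounded_integrable _ (M := 1)) => // w; rewrite normr1.
  have iX : P.-integrable setT (EFin \o (fun w => g (X n w))).
    by apply: (bounded_integrable _ (M := M)) => //; exact: measurableT_comp.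
  have iZ : P.-integrable setT (EFin \o (fun w => g (Z n w))).
    by apply: (bounded_integrable _ (M := M)) => //; exact: measurableT_comp.
  have ie : P.-integrable setT (EFin \o (fun=> e / 2 : R)).
    by apply: (bounded_integrable _ (M := e / 2)) => // w; rewrite ger0_norm// ltW.
  have i1G := integrableB measurableT i1 iG.
  have iMG := integrableZl measurableT (2 * M) i1G.
  have pw w : `|g (X n w) - g (Z n w)| <= e / 2 + 2 * M * (1 - G w).
    rewrite /G; case: (boolP (typical_event dl n (xi 0%N w) w)) => h /=.
      rewrite subrr mulr0 addr0; have c := X_near_Z n0 h.
      apply: hdl; rewrite -?ReB -?ImB; [exact: le_trans (normc_Re _) c|exact: le_trans (normc_Im _) c].
    rewrite subr0 mulr1; apply: le_trans (ler_normB _ _) _.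
    by have := gM (X n w); have := gM (Z n w); lra.
  rewrite -RintegralB//; apply: le_trans (le_normr_Rintegral measurableT (integrableB measurableT iX iZ)) _.
  apply: le_trans (le_Rintegral measurableT (integrable_norm (integrableB measurableT iX iZ))
    (integrableD measurableT ie iMG) (fun w _ => pw w)) _.
  rewrite (RintegralD measurableT ie iMG) (RintegralZl (2 * M) measurableT i1G).
  rewrite (RintegralB measurableT i1 iG) !Rintegral_cst_prob.
  have := ler_norm (1 - (\int[P]_w G w)%R).
  move: hn; rewrite -/(Rintegral P setT G); set q := (1 - _) => h1 h2.
  have h3 : q <= e / (4 * M + 4) by exact: le_trans h2 h1.
  have h4 : 2 * M * q <= 2 * M * (e / (4 * M + 4)) by apply: ler_wpM2l => //; rewrite mulr_ge0.
  have h5 : 2 * M * (e / (4 * M + 4)) <= e / 2.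
    by rewrite mulrA ler_pdivrMr; [nra|lra].
  lra.
- by rewrite subrr normr0 ltW.
- exact: (randomized_clt cg gM).
Unshelve. all: by end_near.
Qed.

(** A merely bounded continuous test function need not be uniformly continuous, so
    [weak_conv_bounded] first reduces the claim to compact support. *)
Lemma rescaled_critical_point_clt : cvg_in_distribution P X complex_std_normal.
Proof.
move=> g cg [M gM]; have mg := continuousC_measurable cg.
pose Xn n : {RV P >-> R[i]} := mfun_Sub (mem_set (mX n)).
have : weak_conv (fun n => distribution P (Xn n)) complex_std_normal g.
  apply: (weak_conv_bounded _ cg gM) => h B A ch hB hA.
  rewrite /weak_conv; under eq_fun do rewrite (Rintegral_distribution _ (continuousC_measurable ch) hB).
  exact: (X_cvg_compact ch hB hA).
rewrite /weak_conv; under eq_fun do rewrite (Rintegral_distribution _ mg gM).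
move=> H; rewrite -EFin_Rintegral; last by apply: (bounded_integrable _ (M := M)).
have -> : (fun n => 'E_P[g \o X n])%E = (fun n => (\int[P]_w g (X n w))%R%:E).
  apply/funext => n; rewrite unlock EFin_Rintegral//.
  by apply: (bounded_integrable _ (M := M)) => //; exact: measurableT_comp.
by apply: cvg_EFin => //; exact: nearW.
Qed.

End rescaled_critical_point.

End randomization.

Theorem theorem2p1 (R : realType) (d : measure_display) (T : measurableType d)
    (P : probability T R) (xi : nat -> {RV P >-> R[i]})
    (D : set R[i]) (p : R[i] -> R) (r : nat -> R)
    (xi_indep : mutually_independent xi)
    (p_ge0 : forall z, 0 <= p z)
    (xi_density : forall k, has_density (xi k) p)
    (D_open : open D)
    (p_continuous : {in D, continuous p})
    (p_off_D : forall z, ~ D z -> p z = 0)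
    (f_neq0 : \forall z \ae complex_lebesgue,
       D z -> cauchy_stieltjes P (xi 1%N) z != 0)
    (r_gt0 : forall n, (0 < n)%N -> 0 < r n)
    (nr_cvg : (n%:R * r n) @[n --> \oo] --> +oo)
    (sqrtnr_cvg : (Num.sqrt n%:R * r n) @[n --> \oo] --> 0) :
  let f := cauchy_stieltjes P (xi 1%N) in
  let crit n w :=
    critical_point_in_disk (random_poly xi n w) (xi 0%N w) (r n) in
  P [set w | exists! z, crit n w z] @[n --> \oo] --> 1%E
  /\
  forall zeta : nat -> {RV P >-> R[i]},
    (forall n w, (exists! z, crit n w z) -> crit n w (zeta n w)) ->
    cvg_in_distribution P
      (fun n w =>
         f (xi 0%N w) ^+ 2 / (Num.sqrt (pi * p (xi 0%N w)))%:C
         * (Num.sqrt (n%:R / ln n%:R))%:C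
         * (n%:R * (zeta n w - xi 0%N w) + (f (xi 0%N w))^-1))
      complex_std_normal.
Proof.
move=> f crit; split.
  exact: (unique_critical_point_prob xi_indep p_ge0 xi_density D_open p_continuous p_off_D f_neq0 r_gt0 nr_cvg sqrtnr_cvg).
move=> zeta zetaE; exact: (rescaled_critical_point_clt xi_indep p_ge0 xi_density D_open p_continuous p_off_D f_neq0 r_gt0 nr_cvg sqrtnr_cvg zetaE).
Qed.
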